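(* Run Algorithm RPO-Regret (described in the context) with inputs $T\in\mathbb N$, $\delta\in(0,1)$ and $\lambda>0$. Then, with probability at least $1-\delta$, $$R(T)=\mathcal O\!\left(\sqrt{\kappa\, d^3\, T\,\log(dT/\delta)^3}\right),$$ where the constant hidden in $\mathcal O(\cdot)$ depends only on $B$, $L$, $\gamma$ and $\lambda$ (and on the absolute constant $C_0$).
   Context: Setting. Let $(\mathcal S,\mathcal A,\nu_0,P,\gamma)$ be an infinite-horizon discounted Markov decision process with state space $\mathcal S\subseteq\mathbb R^n$, compact action space $\mathcal A\subset\mathbb R^m$, initial state distribution $\nu_0$, transition kernel $P$ and discount factor $\gamma\in(0,1)$; write $H_\gamma:=(1-\gamma)^{-1}$. A continuous feature map $\phi:\mathcal S\times\mathcal A\to\mathbb R^d$ satisfies $\sup_{s,a}\|\phi(s,a)\|\le L$. The unknown reward parameter $\theta^*\in\mathbb R^d$ satisfies $\|\theta^*\|\le B$. For a trajectory $\tau=(s_0,a_0,s_1,a_1,\dots)$ let $\phi(\tau):=\sum_{h\ge0}\gamma^h\phi(s_h,a_h)$. For a stationary Markov policy $\pi:\mathcal S\to\Delta_{\mathcal A}$, $\mathbb P_\pi$ denotes the induced law of trajectories, $\phi(\pi):=\mathbb E_{\tau\sim\mathbb P_\pi}[\phi(\tau)]$, $V^\pi_\theta:=\langle\theta,\phi(\pi)\rangle$ and $V^*_\theta:=\sup_\pi V^\pi_\theta$ (supremum over stationary Markov policies). Preference oracle: given trajectories $\tau,\tau'$ it returns $y\in\{0,1\}$ with $\Pr[y=1]=\sigma(\langle\theta^*,\phi(\tau)-\phi(\tau')\rangle)$,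 $\sigma(x)=1/(1+e^{-x})$, conditionally independent of everything else given $(\tau,\tau')$. Let $\kappa:=\max_{\|\theta\|\le B,\ \|x\|\le 2LH_\gamma}1/\dot\sigma(\langle\theta,x\rangle)$. PAC-RL oracle: a procedure $\mathtt A(\theta,\varepsilon,\delta)$ that, for any $\theta\in\mathbb R^d$, $\varepsilon>0$, $\delta\in(0,1)$, returns a stationary Markov policy $\pi$ with $V^*_\theta-V^\pi_\theta\le\varepsilon$ with probability at least $1-\delta$. For a finite dataset $\mathcal D$ of pairs $(x,y)\in\mathbb R^d\times\{0,1\}$, $\mathcal L_{\mathcal D}(\theta):=-\sum_{(x,y)\in\mathcal D}[y\log\sigma(\langle\theta,x\rangle)+(1-y)\log\sigma(-\langle\theta,x\rangle)]$, and the constrained MLE is any $\hat\theta\in\arg\min_{\|\theta\|\le B}\mathcal L_{\mathcal D}(\theta)$. Confidence radius: $\beta_t(\delta):=\sqrt{C_0\big(\kappa[\log(1/\delta)+d\log\max\{e,4eBLH_\gamma(t-1)/d\}]+\lambda B^2\big)}$, where $C_0\ge1$ is a fixed absolute constant large enough that, whenever the pairs $(x_k,y_k)$ are generated adaptively with $\|x_k\|\le 2LH_\gamma$ and $y_k$ drawn from the preference model, with probability $\ge1-\delta$ simultaneously for all $t$, $\|\theta^*-\hat\theta_t\|_{V_t}\le\beta_t(\delta)$ (with $\hat\theta_t$ the constrained MLE on the first $t-1$ pairs and $V_t=\lambda I+\sum_{k<t}x_kx_k^\top$). Regret: for the policy pairs $(\pi_t,\pi'_t)$ played in rounds $t=1,\dots,T$,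 $R(T):=\tfrac12\sum_{t=1}^T\big(2V^*_{\theta^*}-V^{\pi_t}_{\theta^*}-V^{\pi'_t}_{\theta^*}\big)$. Algorithm RPO-Regret. Set $\varepsilon=1/\sqrt T$, $\delta'=\delta/5$, $V_1=\lambda I$, $\mathcal D_1=\emptyset$, $\hat\theta_1=0$, and let $\pi_0$ be an arbitrary policy. For $t=1,\dots,T$: sample $\tilde\theta_t\sim\mathcal N(\hat\theta_t,\beta_t(\delta')^2V_t^{-1})$; set $\pi_t=\mathtt A(\tilde\theta_t,\varepsilon,\delta'/T)$ and $\pi'_t=\pi_{t-1}$; sample $\tau_t\sim\mathbb P_{\pi_t}$, $\tau'_t\sim\mathbb P_{\pi'_t}$; set $x_t=\phi(\tau_t)-\phi(\tau'_t)$, $V_{t+1}=V_t+x_tx_t^\top$; query the preference oracle to get $y_t$ for $(\tau_t,\tau'_t)$; set $\mathcal D_{t+1}=\mathcal D_t\cup\{(x_t,y_t)\}$ and $\hat\theta_{t+1}\in\arg\min_{\|\theta\|\le B}\mathcal L_{\mathcal D_{t+1}}(\theta)$.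
   Formalization: The bound is proved under the extra assumption dT/δ ≥ e (so the log factor is at least 1); without it the claim fails, e.g. for d = T = 1 and δ → 1, where the right side tends to 0 but the regret of π_0 does not. *)

(* Defs.v *)
From HB Require Import structures.
From mathcomp Require Import all_boot all_order all_algebra.
From mathcomp Require Import all_classical all_reals all_analysis.
Set Implicit Arguments. Unset Strict Implicit. Unset Printing Implicit Defensive.
Import Order.TTheory GRing.Theory Num.Theory.
Import numFieldNormedType.Exports.
Local Open Scope classical_set_scope.
Local Open Scope ring_scope.

Definition traj (S A : Type) : Type := nat -> (S * A).
Definition traj_display : measure_display -> measure_display -> measure_display.
Proof. exact (fun d _ => d). Qed.

Section traj_meas.
Context {dS dA : measure_display} (S : measurableType dS) (A : measurableType dA).
HB.instance Definition _ := gen_eqMixin (traj S A).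
HB.instance Definition _ := gen_choiceMixin (traj S A).
HB.instance Definition _ := isPointed.Build (traj S A) (fun _ => point).
Definition traj_measurable : set (set (traj S A)) :=
  <<s \bigcup_(n in [set: nat])
      preimage_set_system [set: traj S A] (fun f : traj S A => f n) measurable >>.
Let m0 : traj_measurable set0. Proof. exact: sigma_algebra0. Qed.
Let mC U : traj_measurable U -> traj_measurable (~` U). Proof. exact: sigma_algebraC. Qed.
Let mU (F : (set (traj S A))^nat) :
  (forall i, traj_measurable (F i)) -> traj_measurable (\bigcup_i F i).
Proof. exact: sigma_algebra_bigcup. Qed.
HB.instance Definition _ :=
  @isMeasurable.Build (traj_display dS dA) (traj S A) traj_measurable m0 mC mU.
End traj_meas.

Section linalg.
Context {R : realType} {d : nat}.
Definition dotv (u v : 'cV[R]_d) : R := (u^T *m v) 0 0.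
Definition norm2 (u : 'cV[R]_d) : R := Num.sqrt (dotv u u).
Definition mnorm (V : 'M[R]_d) (u : 'cV[R]_d) : R := Num.sqrt (dotv u (V *m u)).
End linalg.

Definition sigm {R : realType} (x : R) : R := 1 / (1 + expR (- x)).

Definition Hgam {R : realType} (gam : R) : R := (1 - gam)^-1.

Definition kappa {R : realType} (d : nat) (B L gam : R) : R :=
  sup [set r : R | exists (th x : 'cV[R]_d),
          [/\ norm2 th <= B, norm2 x <= 2 * L * Hgam gam &
               r = (derive1 (@sigm R) (dotv th x))^-1]].

Definition beta_rad {R : realType} (C0 kap : R) (d : nat) (B L gam lam : R)
    (t : nat) (del : R) : R :=
  Num.sqrt (C0 * (kap * (ln (1 / del)
              + d%:R * ln (Num.max (expR 1)
                   (4 * expR 1 * B * L * Hgam gam * (t.-1)%:R / d%:R)))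
             + lam * B ^+ 2)).

Definition gram {R : realType} {d : nat} (lam : R) (x : nat -> 'cV[R]_d) (t : nat)
  : 'M[R]_d := lam%:M + \sum_(1 <= k < t) (x k *m (x k)^T).

Definition negloglik {R : realType} {d : nat} (x : nat -> 'cV[R]_d) (y : nat -> bool)
    (t : nat) (th : 'cV[R]_d) : R :=
  - \sum_(1 <= k < t)
      ((if y k then 1 else 0) * ln (sigm (dotv th (x k)))
       + (1 - (if y k then 1 else 0)) * ln (sigm (- dotv th (x k)))).

Definition is_cmle {R : realType} {d : nat} (B : R) (x : nat -> 'cV[R]_d)
    (y : nat -> bool) (t : nat) (th : 'cV[R]_d) : Prop :=
  norm2 th <= B /\
  forall th' : 'cV[R]_d, norm2 th' <= B -> negloglik x y t th <= negloglik x y t th'.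

Section meas.
Context {dO : measure_display} {Om : measurableType dO} {R : realType}.

Definition sub_sigma (F : set (set Om)) : Prop :=
  sigma_algebra [set: Om] F /\ F `<=` measurable.

Definition Fmeas_real (F : set (set Om)) (f : Om -> R) : Prop :=
  forall B : set R, measurable B -> F (f @^-1` B).

Definition Fmeas_vec (F : set (set Om)) {d : nat} (f : Om -> 'cV[R]_d) : Prop :=
  forall i : 'I_d, Fmeas_real F (fun w => f w i 0).

Definition Fmeas_bool (F : set (set Om)) (f : Om -> bool) : Prop :=
  F [set w | f w].

Definition Fmeas_to {dX : measure_display} {X : measurableType dX}
    (F : set (set Om)) (f : Om -> X) : Prop :=
  forall C : set X, measurable C -> F (f @^-1` C).

(* "with probability at least p, Q holds": there is an event of probability
   at least p on which Q holds (inner probability, so that no measurability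
   of [set w | Q w] needs to be assumed). *)
Definition whp (Pr : probability Om R) (p : R) (Q : Om -> Prop) : Prop :=
  exists E : set Om, measurable E /\ (p%:E <= Pr E)%E /\ (forall w, E w -> Q w).
End meas.

Section mdp.
Context {R : realType} {dS dA : measure_display}
  {S : measurableType dS} {A : measurableType dA}.

Definition policy := R.-pker S ~> A.

Local Open Scope ereal_scope.
(* Probability, under the trajectory law of pi, of the cylinder
   {tau | tau 0 \in C 0, ..., tau H \in C H}, computed by the usual
   iterated integrals: cyl_int n k s is the probability, started from
   state s at time k, that the next n+1 pairs lie in C k, ..., C (k+n). *)
Fixpoint cyl_int (P : R.-pker (S * A)%type ~> S) (pi : policy)
    (C : nat -> set (S * A)) (n k : nat) (s : S) : \bar R :=
  match n with
  | 0 => \int[pi s]_a (\1_(C k) (s, a))%:E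
  | n'.+1 => \int[pi s]_a ((\1_(C k) (s, a))%:E *
                            \int[P (s, a)]_s' cyl_int P pi C n' k.+1 s')
  end.

Definition is_traj_law (nu0 : probability S R) (P : R.-pker (S * A)%type ~> S)
    (pi : policy) (mu : probability (traj S A) R) : Prop :=
  forall (H : nat) (C : nat -> set (S * A)),
    (forall h, measurable (C h)) ->
    mu [set tau : traj S A | forall h, (h <= H)%N -> C h (tau h)]
    = \int[nu0]_s cyl_int P pi C H 0 s.
Local Close Scope ereal_scope.

Context {d : nat}.
Definition phi_traj (phi : S * A -> 'cV[R]_d) (gam : R) (tau : traj S A) : 'cV[R]_d :=
  \col_i limn (fun N : nat => \sum_(h < N) gam ^+ h * phi (tau h) i 0).

Definition phi_pol (trajlaw : policy -> probability (traj S A) R)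
    (phi : S * A -> 'cV[R]_d) (gam : R) (pi : policy) : 'cV[R]_d :=
  \col_i Rintegral (trajlaw pi) [set: traj S A] (fun tau => phi_traj phi gam tau i 0).

Definition Vpi trajlaw phi gam (th : 'cV[R]_d) (pi : policy) : R :=
  dotv th (phi_pol trajlaw phi gam pi).
Definition Vstar trajlaw phi gam (th : 'cV[R]_d) : R :=
  sup [set r : R | exists pi : policy, r = Vpi trajlaw phi gam th pi].
End mdp.

(* The defining property of the absolute constant C0: for adaptively   *)
(* generated data with ||x_k|| <= 2 L H_gamma and y_k drawn from the  *)
(* preference model, the constrained MLE satisfies, with probability  *)
(* >= 1 - delta simultaneously for all t >= 1,                        *)
(*   ||theta* - hat theta_t||_{V_t} <= beta_t(delta).                 *)
(* Adaptivity is expressed through a filtration G: G t contains the   *)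
(* history up to and including x_t, and y_t is G(t+1)-measurable.     *)
(* Stated for processes of any finite length N (rounds 1..N), with    *)
(* the guarantee for all t = 1..N+1.                                   *)
Definition C0_valid {R : realType} (d : nat) (thstar : 'cV[R]_d)
    (B L gam lam C0 : R) : Prop :=
  forall (dO : measure_display) (Om : measurableType dO) (Pr : probability Om R)
    (N : nat) (G : nat -> set (set Om)) (x : nat -> Om -> 'cV[R]_d)
    (y : nat -> Om -> bool) (thhat : nat -> Om -> 'cV[R]_d) (del : R),
    0 < del < 1 ->
    (forall t, sub_sigma (G t)) ->
    (forall t, G t `<=` G t.+1) ->
    (forall t, (1 <= t <= N)%N -> Fmeas_vec (G t) (x t)) ->
    (forall t, (1 <= t <= N)%N -> Fmeas_bool (G t.+1) (y t)) ->
    (forall t w, (1 <= t <= N)%N -> norm2 (x t w) <= 2 * L * Hgam gam) ->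
    (forall t E, (1 <= t <= N)%N -> G t E ->
       Pr (E `&` [set w | y t w]) =
       (\int[Pr]_(w in E) (sigm (dotv thstar (x t w)))%:E)%E) ->
    (forall t w, (1 <= t <= N.+1)%N ->
       is_cmle B (fun k => x k w) (fun k => y k w) t (thhat t w)) ->
    whp Pr (1 - del) (fun w => forall t, (1 <= t <= N.+1)%N ->
      mnorm (gram lam (fun k => x k w) t) (thstar - thhat t w)
        <= beta_rad C0 (kappa d B L gam) d B L gam lam t del).

(* A run of Algorithm RPO-Regret.                                      *)
(* Randomness lives on (Om, Pr). Within round t the information grows  *)
(* as   Fpre t (history of rounds < t)  <=  Fth t (+ theta~_t)         *)
(*      <= Fpol t (+ pi_t)  <=  Ftraj t (+ tau_t, tau'_t)              *)
(*      <= Fpre (t+1) (+ y_t),                                         *)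
(* and each sampling step has the prescribed conditional law given the *)
(* preceding sigma-algebra.                                            *)
Section run.
Context {R : realType} {dS dA dO : measure_display}
  {S : measurableType dS} {A : measurableType dA} {Om : measurableType dO}.
Context {d : nat}.
Variables (trajlaw : @policy R _ _ S A -> probability (traj S A) R)
  (phi : S * A -> 'cV[R]_d) (gam : R) (thstar : 'cV[R]_d)
  (B L lam C0 : R) (T : nat) (del : R)
  (Pr : probability Om R)
  (Fpre Fth Fpol Ftraj : nat -> set (set Om))
  (pi0 : @policy R _ _ S A)
  (thtil thhat : nat -> Om -> 'cV[R]_d)
  (pol : nat -> Om -> @policy R _ _ S A)
  (tau tau' : nat -> Om -> traj S A)
  (y : nat -> Om -> bool).

Definition xfeat (t : nat) (w : Om) : 'cV[R]_d :=
  phi_traj phi gam (tau t w) - phi_traj phi gam (tau' t w).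

Definition Vgram (t : nat) (w : Om) : 'M[R]_d := gram lam (fun k => xfeat k w) t.

Definition del' : R := del / 5.
Definition eps_T : R := (Num.sqrt T%:R)^-1.
Definition beta_t (t : nat) : R :=
  beta_rad C0 (kappa d B L gam) d B L gam lam t del'.

Definition rpo_run : Prop :=
  (forall t, sub_sigma (Fpre t) /\ sub_sigma (Fth t) /\ sub_sigma (Fpol t)
             /\ sub_sigma (Ftraj t)) /\
  (forall t, Fpre t `<=` Fth t /\ Fth t `<=` Fpol t /\ Fpol t `<=` Ftraj t
             /\ Ftraj t `<=` Fpre t.+1) /\
  (forall t, Fmeas_vec (Fpre t) (thhat t)) /\
  (forall t, Fmeas_vec (Fth t) (thtil t)) /\
  (forall t (C : set (traj S A)), measurable C ->
     Fmeas_real (Fpol t) (fun w => fine (trajlaw (pol t w) C))) /\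
  (forall t, Fmeas_to (Ftraj t) (tau t) /\ Fmeas_to (Ftraj t) (tau' t)) /\
  (forall t, Fmeas_bool (Fpre t.+1) (y t)) /\
  (forall w, pol 0 w = pi0) /\
  (forall w, thhat 1 w = 0) /\
  (forall t w, (2 <= t <= T.+1)%N ->
     is_cmle B (fun k => xfeat k w) (fun k => y k w) t (thhat t w)) /\
  (* theta~_t ~ N(hat theta_t, beta_t(delta')^2 V_t^{-1}) given the past,
     stated through all one-dimensional projections u^T theta~_t, u <> 0 *)
  (forall t, (1 <= t <= T)%N ->
     forall (E : set Om) (u : 'cV[R]_d) (Bs : set R),
       Fpre t E -> u != 0 -> measurable Bs ->
       Pr (E `&` [set w | Bs (dotv u (thtil t w))]) =
       (\int[Pr]_(w in E)
          normal_prob (dotv u (thhat t w))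
            (beta_t t * Num.sqrt (dotv u (invmx (Vgram t w) *m u))) Bs)%E) /\
  (* pi_t = A(theta~_t, eps, delta'/T): PAC guarantee given the past and theta~_t *)
  (forall t, (1 <= t <= T)%N ->
     forall E : set Om, Fth t E ->
       exists G : set Om, Fpol t G /\
         G `<=` E `&` [set w | Vstar trajlaw phi gam (thtil t w)
                                - Vpi trajlaw phi gam (thtil t w) (pol t w) <= eps_T] /\
         (((1 - del' / T%:R)%:E * Pr E) <= Pr G)%E) /\
  (* tau_t ~ P_{pi_t}, tau'_t ~ P_{pi'_t} with pi'_t = pi_{t-1}, independently,
     given the past *)
  (forall t, (1 <= t <= T)%N ->
     forall (E : set Om) (C D : set (traj S A)),
       Fpol t E -> measurable C -> measurable D ->
       Pr (E `&` [set w | C (tau t w) /\ D (tau' t w)]) =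
       (\int[Pr]_(w in E) (trajlaw (pol t w) C * trajlaw (pol t.-1 w) D))%E) /\
  (forall t, (1 <= t <= T)%N ->
     forall E : set Om, Ftraj t E ->
       Pr (E `&` [set w | y t w]) =
       (\int[Pr]_(w in E) (sigm (dotv thstar (xfeat t w)))%:E)%E).

Definition regret (w : Om) : R :=
  2^-1 * \sum_(1 <= t < T.+1)
     (2 * Vstar trajlaw phi gam thstar - Vpi trajlaw phi gam thstar (pol t w)
      - Vpi trajlaw phi gam thstar (pol t.-1 w)).
End run.

(* Main.v *)
(** Thompson sampling over the differences [D_t = phi(pi_t) - phi(pi_(t-1))].
    Write [ths] for the true parameter, [thh_t] for its estimate, [tht_t] for the
    sample, [J_t th = Vstar th - <th, phi(pi_(t-1))>], which is convex with
    approximate subgradient [D_t] at [tht_t], and [b_t] for the [V_t^-1]-norm of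
    [D_t]. When [ths] and [tht_t] are both close to [thh_t] in [V_t]-norm, the
    regret of round [t] is at most
    [J_t ths - J_t tht_t + eps + |tht_t - ths|_{V_t} b_t], and
    [J_t ths - J_t tht_t] is at most [gap_t], the supremum of [J_t ths - J_t th]
    over an ellipsoid around [thh_t], which depends on the past only. Gaussian
    anticoncentration in the history-dependent direction
    [phi(pi_opt) - phi(pi_(t-1))] makes round [t] optimistic with conditional
    probability at least a constant, and then [gap_t] is itself [O(eps)] plus the
    radius times [b_t]. As [gap_t] is predictable, an exponential supermartingale
    bounds the sum of all the gaps by the sum over the optimistic rounds. By
    Jensen, [b_t^2] is at most the conditional mean of the squared [V_t^-1]-norm
    of [x_t]; the same supermartingale and the elliptical potential lemma bound
    the sum of the [b_t^2] by [O(d log)].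

    Conditional expectations never appear: an inequality between them is
    expressed by integrating over all the events of the sigma-algebra. *)
Require Import Defs.
From HB Require Import structures.
From mathcomp Require Import all_boot all_order all_algebra.
From mathcomp Require Import all_classical all_reals all_analysis.
From mathcomp Require Import measurable_realfun ring lra.
Set Implicit Arguments. Unset Strict Implicit. Unset Printing Implicit Defensive.
Import Order.TTheory GRing.Theory Num.Theory.
Import numFieldNormedType.Exports.
Local Open Scope classical_set_scope.
Local Open Scope ring_scope.

(** * Linear algebra *)

(** With [l = ln (dT/delta)] and up to constants, the rate is a product of three factors: the
    confidence radius [sqrt (kappa d l)], the sampling width [sqrt (d l)] in units of that radius,
    and the sum of the [b_t], of order [sqrt (T d l)] by Cauchy-Schwarz. The width costs [sqrt d]
    because the law of the sample is known along single directions only: its [V_t]-norm is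
    controlled by a union bound over the directions that make up the Gram matrix. The same
    restriction shapes the optimism step, whose direction is random: the law has to be carried from
    fixed directions to directions measurable in the past, by rounding them to a countable grid. The
    gap is a supremum over an ellipsoid, and not [J_t ths - J_t tht_t] itself, because the latter
    depends on the same sample as the optimism event and could not be pulled out of its conditional
    probability. Taking [pi_(t-1)] as the opponent makes [J_t] known before the sample. *)

Section linear_algebra.
Context {R : realType}.

Section dot.
Context {d : nat}.
Implicit Types (u v w : 'cV[R]_d) (A : 'M[R]_d) (a : R).

Lemma dotvE u v : dotv u v = \sum_i u i 0 * v i 0.
Proof. by rewrite /dotv mxE; apply: eq_bigr => i _; rewrite mxE. Qed.

Lemma dotvC u v : dotv u v = dotv v u.
Proof. by rewrite !dotvE; apply: eq_bigr => i _; rewrite mulrC. Qed.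

Lemma dotvDl u v w : dotv (u + v) w = dotv u w + dotv v w.
Proof. by rewrite /dotv linearD mulmxDl mxE. Qed.

Lemma dotvDr u v w : dotv w (u + v) = dotv w u + dotv w v.
Proof. by rewrite dotvC dotvDl !(dotvC w). Qed.

Lemma dotvZl a u v : dotv (a *: u) v = a * dotv u v.
Proof. by rewrite /dotv linearZ -scalemxAl mxE. Qed.

Lemma dotvZr a u v : dotv u (a *: v) = a * dotv u v.
Proof. by rewrite dotvC dotvZl dotvC. Qed.

Lemma dotvNl u v : dotv (- u) v = - dotv u v.
Proof. by rewrite -scaleN1r dotvZl mulN1r. Qed.

Lemma dotvNr u v : dotv u (- v) = - dotv u v.
Proof. by rewrite dotvC dotvNl dotvC. Qed.

Lemma dotvBl u v w : dotv (u - v) w = dotv u w - dotv v w.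
Proof. by rewrite dotvDl dotvNl. Qed.

Lemma dotvBr u v w : dotv w (u - v) = dotv w u - dotv w v.
Proof. by rewrite dotvDr dotvNr. Qed.

Lemma dotv0l u : dotv 0 u = 0.
Proof. by rewrite -(scale0r 0) dotvZl mul0r. Qed.

Lemma dotv0r u : dotv u 0 = 0.
Proof. by rewrite dotvC dotv0l. Qed.

Lemma dotv_mulmx A u v : dotv u (A *m v) = dotv (A^T *m u) v.
Proof. by rewrite /dotv trmx_mul trmxK mulmxA. Qed.

Lemma dotv_ge0 u : 0 <= dotv u u.
Proof. by rewrite dotvE sumr_ge0// => i _; rewrite -expr2 sqr_ge0. Qed.

Lemma dotv_gt0 u : u != 0 -> 0 < dotv u u.
Proof.
move=> u0; rewrite lt_neqAle dotv_ge0 andbT; apply: contra u0 => /eqP h.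
have /psumr_eq0P {}h : \sum_i u i 0 * u i 0 = 0 by rewrite -dotvE -h.
apply/eqP/colP => i; have /eqP := h (fun i _ => sqr_ge0 (u i 0)) i isT.
by rewrite mxE mulf_eq0 orbb => /eqP.
Qed.

Lemma norm2_ge0 u : 0 <= norm2 u. Proof. exact: sqrtr_ge0. Qed.

Lemma norm2_sqr u : norm2 u ^+ 2 = dotv u u.
Proof. by rewrite sqr_sqrtr// dotv_ge0. Qed.

Lemma norm20 : norm2 (0 : 'cV[R]_d) = 0.
Proof. by rewrite /norm2 dotv0l sqrtr0. Qed.

Definition posdef A := A^T = A /\ forall u, u != 0 -> 0 < dotv u (A *m u).

Lemma posdef_ge0 A u : posdef A -> 0 <= dotv u (A *m u).
Proof.
by move=> [_ p]; have [->|/p/ltW//] := eqVneq u 0; rewrite dotv0l.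
Qed.

Lemma posdef_dotC A u v : posdef A -> dotv u (A *m v) = dotv v (A *m u).
Proof. by move=> [s _]; rewrite dotv_mulmx s dotvC. Qed.

Lemma posdef_cauchy A u v : posdef A ->
  `|dotv u (A *m v)| <= mnorm A u * mnorm A v.
Proof.
move=> pA; have [->|v0] := eqVneq v 0.
  by rewrite mulmx0 dotv0r normr0 mulr_ge0 ?sqrtr_ge0.
have qv : 0 < dotv v (A *m v) by case: pA => _; exact.
rewrite -(@ler_pXn2r _ 2%N) ?nnegrE ?mulr_ge0 ?sqrtr_ge0//.
rewrite exprMn !sqr_sqrtr ?posdef_ge0// real_normK ?num_real//.
set q := dotv v (A *m v) in qv *; set p := dotv u (A *m v).
(* [p / q] makes [u - (p / q) v] orthogonal to [v] for the form of [A]; that its square is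
   non-negative is the inequality. *)
have := posdef_ge0 (u - (p / q) *: v) pA.
rewrite mulmxBr -scalemxAr dotvBl !dotvBr !dotvZl !dotvZr.
rewrite (posdef_dotC v u pA) -/p -/q divfK ?gt_eqF// subrr subr0 subr_ge0.
by rewrite mulrAC ler_pdivrMr// -expr2.
Qed.

Lemma posdef1 : posdef (1%:M : 'M[R]_d).
Proof.
by split; [rewrite trmx1|move=> u u0; rewrite mul1mx dotv_gt0].
Qed.

Lemma dotv_cauchy u v : `|dotv u v| <= norm2 u * norm2 v.
Proof. by have := posdef_cauchy u v posdef1; rewrite /mnorm !mul1mx. Qed.

Lemma dotv_le u v : dotv u v <= norm2 u * norm2 v.
Proof. exact: le_trans (ler_norm _) (dotv_cauchy u v). Qed.

Lemma norm2D u v : norm2 (u + v) <= norm2 u + norm2 v.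
Proof.
rewrite -(@ler_pXn2r _ 2%N) ?nnegrE ?addr_ge0 ?norm2_ge0//.
rewrite norm2_sqr dotvDl !dotvDr sqrrD !norm2_sqr (dotvC v u).
have := dotv_le u v; lra.
Qed.

Lemma norm2N u : norm2 (- u) = norm2 u.
Proof. by rewrite /norm2 dotvNl dotvNr opprK. Qed.

Lemma norm2B u v : norm2 (u - v) <= norm2 u + norm2 v.
Proof. by rewrite (le_trans (norm2D _ _))// norm2N. Qed.

Lemma ler_norm2_coord u i : `|u i 0| <= norm2 u.
Proof.
rewrite -(@ler_pXn2r _ 2%N) ?nnegrE ?norm2_ge0// norm2_sqr dotvE.
by rewrite (bigD1 i)//= real_normK ?num_real// expr2 lerDl sumr_ge0// => j _; rewrite -expr2 sqr_ge0.
Qed.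

(** Taking [v = u] and cancelling one factor suffices. Discounted sums and their means are defined
    coordinatewise; bounding their projections instead of their coordinates avoids losing a factor
    [sqrt d]. *)
Lemma norm2_le_of_dot u c : 0 <= c -> (forall v, dotv v u <= norm2 v * c) -> norm2 u <= c.
Proof.
move=> c0 /(_ u); have [|u0] := eqVneq (norm2 u) 0; first by move=> ->.
by rewrite -norm2_sqr expr2 ler_pM2l// lt_neqAle eq_sym u0 norm2_ge0.
Qed.

End dot.

Lemma schur_det n (a : R) (b : 'cV[R]_n) (C : 'M[R]_n) : a != 0 ->
  \det (block_mx a%:M b^T b C) = a * \det (C - a^-1 *: (b *m b^T)).
Proof.
move=> a0.
have -> : block_mx a%:M b^T b C =
   block_mx 1%:M 0 (a^-1 *: b) 1%:M *m block_mx a%:M b^T 0 (C - a^-1 *: (b *m b^T)).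
  rewrite mulmx_block !mul1mx !mul0mx !addr0 -!scalemxAl mul_mx_scalar scalerA.
  by rewrite mulVf// scale1r addrC subrK.
by rewrite det_mulmx det_lblock det_ublock !det1 !mul1r det_scalar expr1.
Qed.

Lemma dotv_block n (x y : 'cV[R]_1) (u v : 'cV[R]_n) :
  dotv (col_mx x u) (col_mx y v) = dotv x y + dotv u v.
Proof. by rewrite /dotv tr_col_mx mul_row_col mxE. Qed.

Lemma posdef_diag n (A : 'M[R]_n) i : posdef A -> 0 < A i i.
Proof.
move=> [_ /(_ (delta_mx i 0))]; have -> : delta_mx i (0 : 'I_1) != 0 :> 'cV[R]_n.
  by apply/eqP => /colP/(_ i); rewrite !mxE !eqxx => /eqP; rewrite oner_eq0.
move=> /(_ isT); suff -> : dotv (delta_mx i 0) (A *m delta_mx i 0) = A i i by [].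
rewrite dotvE (bigD1 i)//= big1 => [|j ji]; last by rewrite mxE (negbTE ji) mul0r.
rewrite !mxE !eqxx mul1r addr0 (bigD1 i)//= big1 => [|j ji]; last by rewrite mxE (negbTE ji) mulr0.
by rewrite !mxE !eqxx mulr1 addr0.
Qed.

(* Hadamard's inequality, through Schur complements. *)
Lemma posdef_det n (A : 'M[R]_n) : posdef A ->
  0 < \det A /\ \det A <= \prod_i A i i.
Proof.
elim: n A => [|n IH]; first by move=> A _; rewrite det_mx00 big_ord0 ltr01.
rewrite -[n.+1]/(1 + n)%N => A pA; have sA := pA.1.
pose a := A 0 0; pose b : 'cV_n := dlsubmx A; pose C := drsubmx A.
have a0 : 0 < a by exact: posdef_diag.
have AE : A = block_mx a%:M b^T b C.
  rewrite -[LHS]submxK; congr block_mx.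
    by apply/matrixP => i j; rewrite !ord1 !mxE eqxx mulr1n /a; congr (A _ _); apply/val_inj.
  by rewrite /b trmx_dlsub sA.
have sC : C^T = C by rewrite /C trmx_drsub sA.
pose C' := C - a^-1 *: (b *m b^T).
have pC : posdef C'.
  split.
    by rewrite /C' linearB linearZ/= trmx_mul trmxK sC.
  move=> y y0.
  (* For fixed [y] this first coordinate minimises the quadratic form of [A], and the minimum is the
     form of [C'] at [y]. *)
  pose v : 'cV_(1 + n) := col_mx (- a^-1 *: (b^T *m y)) y.
  have v0 : v != 0.
    apply: contra y0 => /eqP h; apply/eqP.
    by rewrite -(col_mxKd (- a^-1 *: (b^T *m y)) y) -/v h linear0.
  have := pA.2 _ v0; rewrite {1}AE mul_block_col dotv_block.
  rewrite mul_scalar_mx scalerA mulrN divff ?gt_eqF// scaleN1r addNr dotv0r add0r.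
  rewrite /C' mulmxBl -scalemxAl -scalemxAr.
  by rewrite scaleNr addrC mulmxA.
have [dp dl] := IH _ pC.
have dA : \det A = a * \det C' by rewrite {1}AE schur_det ?gt_eqF.
split; first by rewrite dA mulr_gt0.
rewrite dA big_ord_recl/= -/a ler_pM2l//; apply: le_trans dl _.
apply: ler_prod => i _; rewrite (ltW (posdef_diag _ pC))/= !mxE.
have -> : A (lift ord0 i) (lift ord0 i) = A (rshift 1 i) (rshift 1 i).
  by congr (A _ _); apply/val_inj.
by rewrite lerBlDr lerDl mulr_ge0 ?invr_ge0 ?(ltW a0)// big_ord1 !mxE -expr2 sqr_ge0.
Qed.

Section inverse.
Context {d : nat}.
Implicit Types (u v x : 'cV[R]_d) (A V : 'M[R]_d).

Lemma posdef_unit A : posdef A -> A \in unitmx.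
Proof. by move=> /posdef_det[h _]; rewrite unitmxE unitfE gt_eqF. Qed.

Lemma posdef_inv A : posdef A -> posdef (invmx A).
Proof.
move=> pA; have uA := posdef_unit pA; split; first by rewrite trmx_inv pA.1.
move=> u u0; rewrite -{1}(mulKVmx uA u) dotvC.
apply: pA.2; apply: contra u0 => /eqP h.
by rewrite -(mulKVmx uA u) h mulmx0.
Qed.

(** Cauchy-Schwarz for the form of [A], at [u] and [A^-1 v]. It separates the error of a parameter
    from the size of a feature difference. *)
Lemma mnorm_dual A u v : posdef A -> `|dotv u v| <= mnorm A u * mnorm (invmx A) v.
Proof.
move=> pA; have uA := posdef_unit pA.
have := posdef_cauchy u (invmx A *m v) pA; rewrite mulKVmx//.
suff -> : mnorm A (invmx A *m v) = mnorm (invmx A) v by [].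
by rewrite /mnorm mulKVmx// dotvC.
Qed.

Lemma mnorm_ge0 A u : 0 <= mnorm A u. Proof. exact: sqrtr_ge0. Qed.

Lemma mnormN A u : mnorm A (- u) = mnorm A u.
Proof. by rewrite /mnorm mulmxN dotvNl dotvNr opprK. Qed.

Lemma mnormD A u v : posdef A -> mnorm A (u + v) <= mnorm A u + mnorm A v.
Proof.
move=> pA; rewrite -(@ler_pXn2r _ 2%N) ?nnegrE ?addr_ge0 ?mnorm_ge0//.
rewrite sqrrD !sqr_sqrtr ?posdef_ge0// mulmxDr dotvDl !dotvDr (posdef_dotC v u pA).
have := le_trans (ler_norm _) (posdef_cauchy u v pA); lra.
Qed.

(** The matrix determinant lemma: the bordered matrix [M] has two block triangular factorisations,
    one eliminating each diagonal block. *)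
Lemma det_rank1 V x : V \in unitmx ->
  \det (V + x *m x^T) = \det V * (1 + dotv x (invmx V *m x)).
Proof.
move=> uV.
pose M := block_mx (1%:M : 'M[R]_1) (- x^T) x V.
have e1 : \det M = \det (V + x *m x^T).
  have -> : M = block_mx 1%:M 0 x 1%:M *m block_mx 1%:M (- x^T) 0 (V + x *m x^T).
    by rewrite mulmx_block !mul1mx !mul0mx !addr0 mulmx1 mulmxN addrC addrK.
  by rewrite det_mulmx det_lblock det_ublock !det1 !mul1r.
have e2 : \det M = (1 + dotv x (invmx V *m x)) * \det V.
  have -> : M = block_mx 1%:M (- x^T *m invmx V) 0 1%:M *m
                block_mx (1%:M + x^T *m invmx V *m x) 0 x V.
    rewrite mulmx_block !mul1mx !mul0mx !add0r mulmxKV//.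
    by rewrite !mulNmx addrK.
  rewrite det_mulmx det_lblock det_ublock !det1 !mul1r det_mx11.
  by rewrite mxE [1%:M _ _]mxE /dotv mulmxA mulr1n.
by rewrite -e1 e2 mulrC.
Qed.

End inverse.

End linear_algebra.

(** * Gram matrices and the elliptical potential *)

Section gram_matrix.
Context {R : realType} {d : nat}.
Variables (lam : R) (x : nat -> 'cV[R]_d).
Hypothesis lam0 : 0 < lam.
Local Notation V := (gram lam x).

Lemma gramS t : (1 <= t)%N -> V t.+1 = V t + x t *m (x t)^T.
Proof. by move=> t1; rewrite /gram big_nat_recr//= addrA. Qed.

Lemma gram1 : V 1 = lam%:M.
Proof. by rewrite /gram big_geq// addr0. Qed.

Lemma gram_quad t u :
  dotv u (V t *m u) = lam * dotv u u + \sum_(1 <= k < t) dotv (x k) u ^+ 2.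
Proof.
rewrite /gram mulmxDl mul_scalar_mx dotvDr dotvZr; congr (_ + _).
rewrite mulmx_suml dotvC /dotv [(\sum_(_ <= _ < _) _)^T]linear_sum/= mulmx_suml summxE.
apply: eq_bigr => k _; rewrite -mulmxA [(x k)^T *m u]mx11_scalar mul_mx_scalar.
by rewrite linearZ/= -scalemxAl mxE expr2 [(_%:M) 0 0]mxE mulr1n.
Qed.

Lemma gram_posdef t : posdef (V t).
Proof.
split.
  rewrite /gram linearD/= tr_scalar_mx linear_sum; congr (_ + _).
  by apply: eq_bigr => k _; rewrite /= trmx_mul trmxK.
move=> u u0; rewrite gram_quad ltr_wpDr ?mulr_gt0 ?dotv_gt0//.
by apply: sumr_ge0 => k _; exact: sqr_ge0.
Qed.

(** With [c = V^-1 u], the ridge term gives [lam |c|^2 <= <c, V c> = <u, c>], and Cauchy-Schwarz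
    concludes; no eigenvalues are involved. *)
Lemma gram_inv_le t u : dotv u (invmx (V t) *m u) <= dotv u u / lam.
Proof.
have uV := posdef_unit (gram_posdef t).
set c := invmx (V t) *m u.
have e : lam * dotv c c <= dotv u c.
  rewrite -[X in _ <= dotv X c](mulKVmx uV u) -/c (dotvC _ c) gram_quad lerDl.
  by apply: sumr_ge0 => k _; exact: sqr_ge0.
have [->|uc0] := eqVneq (dotv u c) 0; first by rewrite divr_ge0 ?dotv_ge0 ?ltW.
have uc : 0 < dotv u c.
  by rewrite lt_neqAle eq_sym uc0 (posdef_ge0 _ (posdef_inv (gram_posdef t))).
rewrite ler_pdivlMr// -(ler_pM2r uc).
have h : dotv u c ^+ 2 <= dotv u u * dotv c c.
  rewrite -!norm2_sqr -exprMn -(real_normK (num_real (dotv u c))).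
  by rewrite lerXn2r ?nnegrE ?mulr_ge0 ?norm2_ge0 ?dotv_cauchy.
have h1 := ler_wpM2l (ltW lam0) h; have h2 := ler_wpM2l (dotv_ge0 u) e.
lra.
Qed.

Lemma dotv_tr (A : 'M[R]_d) u : dotv u (A *m u) = \tr (A *m (u *m u^T)).
Proof. by rewrite mulmxA mxtrace_mulC /mxtrace big_ord1. Qed.

(** The trace of [V^-1 V], split along the summands of the Gram matrix. It makes the sample norm
    grow with [d], not with the number of directions in the union bound. *)
Lemma gram_trace t : lam * \tr (invmx (V t)) +
  \sum_(1 <= k < t) dotv (x k) (invmx (V t) *m x k) = d%:R.
Proof.
under eq_bigr do rewrite dotv_tr.
rewrite -mxtrace1 -(mulVmx (posdef_unit (gram_posdef t))) [in RHS]/gram.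
rewrite mulmxDr mul_mx_scalar linearD linearZ mulmx_sumr linear_sum/=.
by rewrite -/(gram lam x t).
Qed.

(* The squared [V]-norm of [z] is a sum of squares over [d + t - 1] directions,
   whose dual norms have squares summing to [d]. *)
Lemma gram_directions t r (z : 'cV[R]_d) :
  (forall i, z i 0 ^+ 2 <= r * invmx (V t) i i) ->
  (forall k, (1 <= k < t)%N ->
    dotv (x k) z ^+ 2 <= r * dotv (x k) (invmx (V t) *m x k)) ->
  dotv z (V t *m z) <= r * d%:R.
Proof.
move=> hi hk; rewrite gram_quad -(gram_trace t) mulrDr mulrCA.
rewrite lerD//.
  rewrite ler_pM2l// dotvE mulr_sumr; apply: ler_sum => i _.
  by rewrite -expr2.
by rewrite mulr_sumr big_nat_cond [leRHS]big_nat_cond ler_sum// => k /andP[/hk].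
Qed.

Variable X2 : R.
Hypothesis hX : forall k, dotv (x k) (x k) <= X2.

Lemma gram_logdet t : (1 <= t)%N ->
  \sum_(1 <= k < t) ln (1 + dotv (x k) (invmx (V k) *m x k)) =
  ln (\det (V t)) - ln (\det (V 1)).
Proof.
case: t => // t _; elim: t => [|t IH]; first by rewrite big_geq// subrr.
rewrite big_nat_recr//= IH (@gramS t.+1)// det_rank1 ?posdef_unit//; last exact: gram_posdef.
have := posdef_ge0 (x t.+1) (posdef_inv (gram_posdef t.+1)) => h.
rewrite lnM ?posrE ?(posdef_det (gram_posdef _)).1 ?ltr_wpDr//.
by rewrite addrAC.
Qed.

(** Each term [s] is at most [X2 / lam], hence at most [1 + X2 / lam] times [s / (1 + s)], which is
    below [ln (1 + s)]. The logarithms telescope into a determinant, and Hadamard's inequality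
    bounds it by the diagonal, whose entries are at most [lam + T X2]. *)
Lemma elliptical_potential T : 0 <= X2 ->
  \sum_(1 <= k < T.+1) dotv (x k) (invmx (V k) *m x k) <=
  (1 + X2 / lam) * (d%:R * ln (1 + T%:R * (X2 / lam))).
Proof.
move=> X20; have m0 : 0 <= X2 / lam by rewrite divr_ge0 // ltW.
apply: (@le_trans _ _ ((1 + X2 / lam) *
    \sum_(1 <= k < T.+1) ln (1 + dotv (x k) (invmx (V k) *m x k)))).
  rewrite mulr_sumr ler_sum// => k _; set s := dotv _ _.
  have s0 : 0 <= s by exact/posdef_ge0/posdef_inv/gram_posdef.
  have sM : s <= X2 / lam.
    by apply: le_trans (gram_inv_le _ _) _; rewrite ler_pM2r ?invr_gt0.
  have h : s / (1 + s) <= ln (1 + s).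
    have p : 0 < 1 + s by rewrite ltr_pwDl.
    have := le_ln1Dx (x := - (s / (1 + s))).
    have e : 1 + - (s / (1 + s)) = (1 + s)^-1 by field; rewrite gt_eqF.
    rewrite e lnV ?posrE// lerN2; apply.
    by rewrite -subr_gt0 opprK addrC e invr_gt0.
  apply: le_trans (_ : (1 + X2 / lam) * (s / (1 + s)) <= _).
    rewrite mulrCA ler_peMr// ler_pdivlMr ?mul1r ?lerD2l//.
    by rewrite ltr_pwDl.
  by rewrite ler_wpM2l// addr_ge0.
rewrite ler_wpM2l ?addr_ge0// gram_logdet// gram1 det_scalar lerBlDr.
have p : 0 < 1 + T%:R * (X2 / lam) by rewrite ltr_pwDl// mulr_ge0.
rewrite lnXn// -(mulr_natl (ln lam)) -mulrDr.
have [dp dl] := posdef_det (gram_posdef T.+1).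
rewrite -lnM ?posrE// (mulr_natl (ln _)) -lnXn ?mulr_gt0// ler_ln ?posrE ?exprn_gt0 ?mulr_gt0//.
apply: le_trans dl _; rewrite -[X in _ ^+ X](card_ord d) -prodr_const.
apply: ler_prod => i _; rewrite (ltW (posdef_diag _ (gram_posdef _)))/=.
rewrite mulrDl mul1r -mulrA divfK ?gt_eqF// /gram !mxE eqxx mulr1n lerD2l.
rewrite summxE; apply: (@le_trans _ _ (\sum_(1 <= k < T.+1) X2)); last first.
  by rewrite big_const_nat subSS subn0 iter_addr_0 (mulr_natl X2).
apply: ler_sum => k _; apply: le_trans (hX k).
rewrite mxE big_ord1 mxE -expr2 -norm2_sqr -(real_normK (num_real (x k i 0))).
by rewrite lerXn2r ?nnegrE ?norm2_ge0// ler_norm2_coord.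
Qed.

End gram_matrix.

(** * Expectation of bounded functions and predictable concentration *)

Section expectation.
Context {dX : measure_display} {X : measurableType dX} {R : realType}.
Variable mu : probability X R.

(** The bound holds everywhere rather than almost everywhere, so the class does not depend on [mu],
    is closed under sums and products, and is integrable for every probability. *)
Definition bmeas (f : X -> R) :=
  measurable_fun [set: X] f /\ exists M, forall x, `|f x| <= M.

Definition Ex (f : X -> R) : R := \int[mu]_x f x.

Lemma bmeas_integrable f : bmeas f -> mu.-integrable setT (EFin \o f).
Proof.
move=> [mf [M hM]]; apply: measurable_bounded_integrable => //.
  exact: le_lt_trans (probability_le1 mu measurableT) (ltry _).
exists M; split; first exact: num_real.
by move=> y My x _; apply: le_trans (hM x) (ltW My).
Qed.

Lemma bmeas_cst c : bmeas (fun=> c).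
Proof. by split => //; exists `|c|. Qed.

Lemma bmeasD f g : bmeas f -> bmeas g -> bmeas (fun x => f x + g x).
Proof.
move=> [mf [M hM]] [mg [N hN]]; split; first exact: measurable_funD.
by exists (M + N) => x; rewrite (le_trans (ler_normD _ _))// lerD.
Qed.

Lemma bmeasM f g : bmeas f -> bmeas g -> bmeas (fun x => f x * g x).
Proof.
move=> [mf [M hM]] [mg [N hN]]; split; first exact: measurable_funM.
by exists (M * N) => x; rewrite normrM ler_pM.
Qed.

Lemma bmeasN f : bmeas f -> bmeas (fun x => - f x).
Proof.
move=> [mf [M hM]]; split; first exact: measurable_funN.
by exists M => x; rewrite normrN.
Qed.

Lemma bmeasB f g : bmeas f -> bmeas g -> bmeas (fun x => f x - g x).
Proof. by move=> bf bg; apply: bmeasD => //; exact: bmeasN. Qed.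

Lemma bmeas_indic E : measurable E -> bmeas (\1_E).
Proof.
move=> mE; split; first exact: measurable_indic.
by exists 1 => x; rewrite indicE; case: (_ \in _); rewrite ?normr1 ?normr0.
Qed.

Lemma bmeas_sum (I : Type) (s : seq I) (f : I -> X -> R) :
  (forall i, bmeas (f i)) -> bmeas (fun x => \sum_(i <- s) f i x).
Proof.
move=> h; elim: s => [|i s IH].
  by under eq_fun do rewrite big_nil; exact: bmeas_cst.
by under eq_fun do rewrite big_cons; exact: bmeasD.
Qed.

Lemma Ex_cst c : Ex (fun=> c) = c.
Proof.
rewrite /Ex Rintegral_cst// -[RHS]mulr1; congr (_ * _).
by have /(congr1 fine) := probability_setT mu.
Qed.

Lemma ExD f g : bmeas f -> bmeas g -> Ex (fun x => f x + g x) = Ex f + Ex g.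
Proof. by move=> /bmeas_integrable ? /bmeas_integrable ?; exact: RintegralD. Qed.

Lemma ExZ c f : bmeas f -> Ex (fun x => c * f x) = c * Ex f.
Proof. by move=> /bmeas_integrable ?; exact: RintegralZl. Qed.

Lemma ExB f g : bmeas f -> bmeas g -> Ex (fun x => f x - g x) = Ex f - Ex g.
Proof. by move=> /bmeas_integrable ? /bmeas_integrable ?; exact: RintegralB. Qed.

Lemma le_Ex f g : bmeas f -> bmeas g -> (forall x, f x <= g x) -> Ex f <= Ex g.
Proof.
by move=> /bmeas_integrable ? /bmeas_integrable ? h; apply: le_Rintegral => // x _.
Qed.

Lemma Ex_ge0 f : (forall x, 0 <= f x) -> 0 <= Ex f.
Proof. by move=> h; apply: Rintegral_ge0 => x _. Qed.

Lemma Ex_sum (I : Type) (s : seq I) (f : I -> X -> R) :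
  (forall i, bmeas (f i)) -> Ex (fun x => \sum_(i <- s) f i x) = \sum_(i <- s) Ex (f i).
Proof.
move=> h; elim: s => [|i s IH].
  by under eq_fun do rewrite big_nil; rewrite Ex_cst big_nil.
under eq_fun do rewrite big_cons.
by rewrite ExD ?IH ?big_cons//; exact: bmeas_sum.
Qed.

Lemma Ex_indic E : measurable E -> Ex (\1_E) = fine (mu E).
Proof. by move=> mE; rewrite /Ex /Rintegral integral_indic// setIT. Qed.

Lemma EFin_Ex f : bmeas f -> (Ex f)%:E = (\int[mu]_x (f x)%:E)%E.
Proof.
by move=> bf; rewrite /Ex /Rintegral fineK//; exact/integrable_fin_num/bmeas_integrable.
Qed.

Lemma EFin_Ex_set f E : measurable E -> bmeas f ->
  (Ex (fun x => \1_E x * f x))%:E = (\int[mu]_(x in E) (f x)%:E)%E.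
Proof.
move=> mE bf; rewrite EFin_Ex; last exact/bmeasM/bf/bmeas_indic.
rewrite [RHS]integral_mkcond; apply: eq_integral => x _.
rewrite patchE indicE; case: (x \in E); first by rewrite mul1r.
by rewrite mul0r.
Qed.

Lemma bounded_bmeas (f : X -> R) (a b : R) : measurable_fun [set: X] f ->
  (forall x, a <= f x <= b) -> bmeas f.
Proof.
move=> mf h; split => //; exists (`|a| + `|b|) => x.
have /andP[ax xb] := h x; rewrite ler_norml; apply/andP; split.
  have := ler_norm (- a); rewrite normrN => h1; have h2 := normr_ge0 b; lra.
have h1 := ler_norm b; have h2 := normr_ge0 a; lra.
Qed.

Lemma fine_le_prob E c : measurable E -> (mu E <= c%:E)%E -> fine (mu E) <= c.
Proof. by move=> mE; rewrite -lee_fin fineK ?fin_num_measure. Qed.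

End expectation.

Lemma le_of_le_harmonic {R : realType} (a b c : R) :
  (forall n : nat, a <= b + c / n.+1%:R) -> a <= b.
Proof.
move=> h; rewrite leNgt; apply/negP => ba.
have c0 : 0 < c by have := h 0%N; rewrite divr1; lra.
have [n hn] : exists n : nat, c / n.+1%:R < a - b.
  exists (Num.truncn (c / (a - b))); rewrite ltr_pdivrMr// mulrC -ltr_pdivrMr ?subr_gt0//.
  by exact: truncnS_gt.
have {h} := h n; move: hn; set q := c / _ => hn h; lra.
Qed.

Section staircase.
Context {R : realType}.

(* [floor (n.+1 * r) / n.+1] on [0, 1], written as a sum of indicators so that
   identities between probabilities extend to expectations. *)
Definition stair (n : nat) (r : R) : R :=
  n.+1%:R^-1 * \sum_(k < n.+1) (k.+1%:R <= n.+1%:R * r)%R%:R.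

(** The sum counts the integers from 1 to [n] that are at most [r]; the induction peels off the
    threshold 1 and shifts [r] by 1. *)
Lemma stair_sum (n : nat) (r : R) : 0 <= r ->
  \sum_(k < n) (k.+1%:R <= r)%R%:R <= r /\
  (r <= n%:R -> r <= \sum_(k < n) (k.+1%:R <= r)%R%:R + 1).
Proof.
elim: n r => [|n IH] r r0.
  by rewrite big_ord0; split => // h; rewrite add0r (le_trans h).
rewrite big_ord_recl/=; have [r1|r1] := leP 1 r.
  have [h1 h2] := IH (r - 1) ltac:(by rewrite subr_ge0).
  have e : \sum_(i < n) ((lift ord0 i).+1%:R <= r)%R%:R =
           \sum_(k < n) (k.+1%:R <= r - 1)%R%:R :> R.
    by apply: eq_bigr => i _; rewrite lerBrDr natr1.
  rewrite {}e mulr1n -natr1; split; first by lra.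
  by move=> h; have := h2 ltac:(lra); lra.
rewrite add0r big1 => [|i _].
  by split => // _; rewrite add0r ltW.
by apply/eqP; rewrite pnatr_eq0 eqb0 -ltNge (lt_le_trans r1)// ler1n.
Qed.

Lemma stair_bound n r : 0 <= r <= 1 -> stair n r <= r <= stair n r + n.+1%:R^-1.
Proof.
move=> /andP[r0 r1]; have [h1 h2] := stair_sum n.+1 (mulr_ge0 (ler0n R n.+1) r0).
have n0 : 0 < n.+1%:R :> R by [].
have /h2 {}h2 : n.+1%:R * r <= n.+1%:R by rewrite ler_piMr.
rewrite /stair; apply/andP; split.
  by rewrite ler_pdivrMl.
by rewrite -[X in _ + X]mulr1 -mulrDr ler_pdivlMl.
Qed.

Lemma stair_ge0 n r : 0 <= stair n r.
Proof. by rewrite mulr_ge0 ?invr_ge0// sumr_ge0. Qed.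

Lemma stairE (X : Type) (f : X -> R) n x :
  stair n (f x) =
  n.+1%:R^-1 * \sum_(k < n.+1) \1_[set x | k.+1%:R <= n.+1%:R * f x] x.
Proof.
congr (_ * _); apply: eq_bigr => k _; rewrite indicE; congr ((nat_of_bool _)%:R).
by apply/idP/idP => [h|/set_mem//]; exact/mem_set.
Qed.

End staircase.

(** * Measurability with respect to a sub-sigma-algebra *)

Section sub_sigma_algebras.
Context {dO : measure_display} {Om : measurableType dO} {R : realType}.
Implicit Types (F : set (set Om)) (f g : Om -> R).

Lemma sub_sigma_measurable F E : sub_sigma F -> F E -> measurable E.
Proof. by case=> _; exact. Qed.

(** [F] is already a sigma-algebra, so the type it generates has exactly [F] as measurable sets, and
    the closure properties of [measurable_fun] carry over to [Fmeas_real F]. *)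
Lemma Fmeas_realP F f : sub_sigma F ->
  Fmeas_real F f <-> measurable_fun [set: g_sigma_algebraType F] f.
Proof.
move=> [sF _]; split => h.
  by move=> _ B mB; rewrite setTI; rewrite /measurable/= (sigma_algebra_id sF); exact: h.
move=> B mB; have := h measurableT B mB; rewrite setTI.
by rewrite /measurable/= (sigma_algebra_id sF).
Qed.

Lemma g_sigma_measurable F (E : set Om) : sub_sigma F ->
  F E <-> measurable (E : set (g_sigma_algebraType F)).
Proof. by move=> [sF _]; rewrite /measurable/= (sigma_algebra_id sF). Qed.

Lemma Fmeas_real_measurable F f : sub_sigma F -> Fmeas_real F f ->
  measurable_fun [set: Om] f.
Proof. by move=> [_ sF] h _ B mB; rewrite setTI; exact/sF/h. Qed.

Lemma Fmeas_realS F F' f : F `<=` F' -> Fmeas_real F f -> Fmeas_real F' f.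
Proof. by move=> s h B mB; exact/s/h. Qed.

Lemma sub_sigmaI F A B : sub_sigma F -> F A -> F B -> F (A `&` B).
Proof.
by move=> sF /(g_sigma_measurable _ sF) ? /(g_sigma_measurable _ sF) ?;
  apply/(g_sigma_measurable _ sF); exact: measurableI.
Qed.

Lemma sub_sigmaT F : sub_sigma F -> F setT.
Proof. by move=> sF; apply/(g_sigma_measurable _ sF). Qed.

Lemma Fmeas_ler F f g : sub_sigma F -> Fmeas_real F f -> Fmeas_real F g ->
  F [set w | f w <= g w].
Proof.
move=> sF /(Fmeas_realP _ sF) mf /(Fmeas_realP _ sF) mg.
apply/(g_sigma_measurable _ sF).
have := measurable_fun_ler mf mg => /(_ measurableT [set true] I).
by rewrite setTI.
Qed.

Lemma Fmeas_ltr F f g : sub_sigma F -> Fmeas_real F f -> Fmeas_real F g ->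
  F [set w | f w < g w].
Proof.
move=> sF /(Fmeas_realP _ sF) mf /(Fmeas_realP _ sF) mg.
apply/(g_sigma_measurable _ sF).
have := measurable_fun_ltr mf mg => /(_ measurableT [set true] I).
by rewrite setTI.
Qed.

Lemma Fmeas_cst F (c : R) : sub_sigma F -> Fmeas_real F (fun=> c).
Proof. by move=> sF; apply/(Fmeas_realP _ sF). Qed.

Lemma Fmeas_realD F f g : sub_sigma F -> Fmeas_real F f -> Fmeas_real F g ->
  Fmeas_real F (fun w => f w + g w).
Proof.
move=> sF /(Fmeas_realP _ sF) mf /(Fmeas_realP _ sF) mg.
by apply/(Fmeas_realP _ sF); exact: measurable_funD.
Qed.

Lemma Fmeas_realM F f g : sub_sigma F -> Fmeas_real F f -> Fmeas_real F g ->
  Fmeas_real F (fun w => f w * g w).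
Proof.
move=> sF /(Fmeas_realP _ sF) mf /(Fmeas_realP _ sF) mg.
by apply/(Fmeas_realP _ sF); exact: measurable_funM.
Qed.

Lemma Fmeas_realZ F c f : sub_sigma F -> Fmeas_real F f ->
  Fmeas_real F (fun w => c * f w).
Proof. by move=> sF mf; apply: Fmeas_realM => //; exact: Fmeas_cst. Qed.

Lemma Fmeas_realN F f : sub_sigma F -> Fmeas_real F f -> Fmeas_real F (fun w => - f w).
Proof.
move=> sF /(Fmeas_realP _ sF) mf.
by apply/(Fmeas_realP _ sF); exact: measurable_funN.
Qed.

Lemma Fmeas_realB F f g : sub_sigma F -> Fmeas_real F f -> Fmeas_real F g ->
  Fmeas_real F (fun w => f w - g w).
Proof. by move=> sF mf mg; apply: Fmeas_realD => //; exact: Fmeas_realN. Qed.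

Lemma Fmeas_comp F (h : R -> R) f : measurable_fun [set: R] h -> Fmeas_real F f ->
  Fmeas_real F (fun w => h (f w)).
Proof.
move=> mh mf B mB; have := mh measurableT B mB; rewrite setTI => m.
exact: (mf _ m).
Qed.

Lemma Fmeas_sum F (I : Type) (s : seq I) (f : I -> Om -> R) : sub_sigma F ->
  (forall i, Fmeas_real F (f i)) -> Fmeas_real F (fun w => \sum_(i <- s) f i w).
Proof.
move=> sF h; elim: s => [|i s IH].
  by under eq_fun do rewrite big_nil; exact: Fmeas_cst.
by under eq_fun do rewrite big_cons; exact: Fmeas_realD.
Qed.

Lemma Fmeas_prod F (I : Type) (s : seq I) (f : I -> Om -> R) : sub_sigma F ->
  (forall i, Fmeas_real F (f i)) -> Fmeas_real F (fun w => \prod_(i <- s) f i w).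
Proof.
move=> sF h; elim: s => [|i s IH].
  by under eq_fun do rewrite big_nil; exact: Fmeas_cst.
by under eq_fun do rewrite big_cons; exact: Fmeas_realM.
Qed.

Lemma Fmeas_sum_nat F (m n : nat) (f : nat -> Om -> R) : sub_sigma F ->
  (forall k, (m <= k < n)%N -> Fmeas_real F (f k)) ->
  Fmeas_real F (fun w => \sum_(m <= k < n) f k w).
Proof.
move=> sF h.
have -> : (fun w => \sum_(m <= k < n) f k w) =
  (fun w => \sum_(m <= k < n) (if (m <= k < n)%N then f k w else 0)).
  by apply/funext => w; apply: eq_big_nat => k ->.
apply: Fmeas_sum => // k; have [mkn|_] := boolP (m <= k < n)%N; first exact: h.
exact: Fmeas_cst.
Qed.

Lemma Fmeas_indic F E : sub_sigma F -> F E -> Fmeas_real F (\1_E : Om -> R).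
Proof.
move=> sF /(g_sigma_measurable _ sF) mE; apply/(Fmeas_realP _ sF).
exact: measurable_indic.
Qed.

Lemma measurable_sqrt : measurable_fun [set: R] (@Num.sqrt R).
Proof. by apply: nondecreasing_measurable => // x y xy; exact: ler_wsqrtr. Qed.

End sub_sigma_algebras.

(** * Conditional inequalities without conditional expectations *)

Section conditional_inequality.
Context {dO : measure_display} {Om : measurableType dO} {R : realType}.
Variable Pr : probability Om R.

(** The hypothesis says [E[Y | F] <= E[Z | F]]. A staircase below [W] is a positive combination of
    indicators of events of [F], where the hypothesis applies; replacing [W] by it costs at most
    [B / n.+1] on the side of [Y], and on the side of [Z] it only lowers the mean because [Z] is
    non-negative. *)
Lemma cond_le_extend (F : set (set Om)) (Y Z W : Om -> R) (M : R) :
  sub_sigma F -> bmeas Y -> bmeas Z ->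
  (forall w, 0 <= Y w) -> (forall w, 0 <= Z w) ->
  Fmeas_real F W -> (forall w, 0 <= W w <= M) ->
  (forall E, F E -> Ex Pr (fun w => \1_E w * Y w) <= Ex Pr (fun w => \1_E w * Z w)) ->
  Ex Pr (fun w => W w * Y w) <= Ex Pr (fun w => W w * Z w).
Proof.
move=> sF bY bZ Y0 Z0 mW W0M h.
(* Staircases approximate values in [[0, 1]], hence the rescaling; a bound [M <= 0] forces [W] to
   vanish. *)
wlog: W M mW W0M / M = 1 => [hwlog|M1].
  have [M0|M0] := leP M 0.
    have W0 w : W w = 0.
      by apply/eqP; rewrite eq_le; have /andP[-> /le_trans ->] := W0M w.
    have e f : Ex Pr (fun w => W w * f w) = 0.
      by under eq_fun do rewrite W0 mul0r; rewrite Ex_cst.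
    by rewrite !e.
  have bW : bmeas W by apply: bounded_bmeas W0M; exact: Fmeas_real_measurable mW.
  have := hwlog (fun w => M^-1 * W w) 1 (Fmeas_realZ _ sF mW) => /(_ _ erefl).
  have e f : (fun w => M^-1 * W w * f w) = (fun w => M^-1 * (W w * f w)).
    by apply/funext => w; rewrite mulrA.
  rewrite !e !ExZ ?ler_pM2l ?invr_gt0//; try exact: bmeasM.
  apply=> w; have /andP[w0 w1] := W0M w.
  by rewrite mulr_ge0 ?invr_ge0 ?(ltW M0)//= mulrC ler_pdivrMr// mul1r.
rewrite {}M1 in W0M.
have [_ [B hB]] := bY.
apply: (@le_of_le_harmonic _ _ _ B) => n.
pose S w := stair n (W w).
pose A (k : 'I_n.+1) := [set w | k.+1%:R <= n.+1%:R * W w].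
have FA k : F (A k).
  by apply: Fmeas_ler => //; [exact: Fmeas_cst|exact: Fmeas_realZ].
have mA k : measurable (A k) by exact: sub_sigma_measurable sF (FA k).
have ES f : bmeas f -> Ex Pr (fun w => S w * f w) =
    n.+1%:R^-1 * \sum_(k < n.+1) Ex Pr (fun w => \1_(A k) w * f w).
  move=> bf; rewrite -Ex_sum ?index_enum//; last first.
    by move=> k; apply: bmeasM bf; exact: bmeas_indic.
  rewrite -ExZ; last by apply: bmeas_sum => k; apply: bmeasM bf; exact: bmeas_indic.
  by congr (Ex _ _); apply/funext => w; rewrite /S stairE -mulrA mulr_suml.
have bS : bmeas S.
  rewrite (_ : S = fun w => n.+1%:R^-1 * \sum_(k < n.+1) \1_(A k) w); last first.
    by apply/funext => w; rewrite /S stairE.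
  by apply: bmeasM; [exact: bmeas_cst|apply: bmeas_sum => k; exact: bmeas_indic].
have bW : bmeas W by apply: bounded_bmeas W0M; exact: Fmeas_real_measurable mW.
apply: (@le_trans _ _ (Ex Pr (fun w => S w * Y w + B / n.+1%:R))).
  apply: le_Ex; [exact: bmeasM|by apply: bmeasD (bmeas_cst _); exact: bmeasM|].
  move=> w; have /andP[_ h2] := stair_bound n (W0M w).
  have hBw : Y w <= B by rewrite -(ger0_norm (Y0 w)).
  apply: le_trans (ler_wpM2r (Y0 w) h2) _; rewrite mulrDl lerD2l mulrC.
  by rewrite ler_wpM2r// invr_ge0.
rewrite ExD ?Ex_cst ?lerD2r; [|exact: bmeasM|exact: bmeas_cst].
apply: (@le_trans _ _ (Ex Pr (fun w => S w * Z w))).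
  by rewrite !ES// ler_wpM2l ?invr_ge0//; apply: ler_sum => k _; exact: h.
apply: le_Ex; try exact: bmeasM.
by move=> w; rewrite ler_wpM2r//; have /andP[] := stair_bound n (W0M w).
Qed.

(** Since [(1 + z) (1 - z / 2) >= 1] on [[0, 1]]. The slope one half is what puts [Y_k / 2] against
    [Z_k] in the supermartingale, and the factor 2 in the conclusions. *)
Lemma expRN_le_half (z : R) : 0 <= z <= 1 -> expR (- z) <= 1 - z / 2.
Proof.
move=> /andP[z0 z1]; rewrite expRN.
have h : 1 + z <= expR z by exact: expR_ge1Dx.
apply: (@le_trans _ _ (1 + z)^-1); first by rewrite lef_pV2 ?posrE ?expR_gt0//; lra.
rewrite -[leLHS]mul1r ler_pdivrMr; nra.
Qed.

(* [exp (sum (Y_k / 2 - Z_k))] is a supermartingale. *)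
Lemma predictable_sum_concentration (F : nat -> set (set Om)) (Y Z : nat -> Om -> R)
    (T : nat) (del : R) :
  (forall t, sub_sigma (F t)) -> (forall t, F t `<=` F t.+1) ->
  (forall t, (1 <= t <= T)%N -> Fmeas_real (F t) (Y t)) ->
  (forall t, (1 <= t <= T)%N -> Fmeas_real (F t.+1) (Z t)) ->
  (forall t w, (1 <= t <= T)%N -> 0 <= Y t w <= 1) ->
  (forall t w, (1 <= t <= T)%N -> 0 <= Z t w <= 1) ->
  (forall t E, (1 <= t <= T)%N -> F t E ->
     Ex Pr (fun w => \1_E w * Y t w) <= Ex Pr (fun w => \1_E w * Z t w)) ->
  0 < del ->
  exists E : set Om, [/\ measurable E, (Pr (~` E) <= del%:E)%E &
    forall w, E w -> \sum_(1 <= t < T.+1) Y t w <=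
       2 * \sum_(1 <= t < T.+1) Z t w + 2 * ln (1 / del)].
Proof.
move=> sF incF mY mZ Y01 Z01 hYZ del0.
pose M n w := expR (\sum_(1 <= k < n.+1) (Y k w / 2 - Z k w)).
have incFle s t : (s <= t)%N -> F s `<=` F t.
  move=> /subnK <-; elim: (t - s)%N => // k IH.
  by rewrite addSn; apply: subset_trans IH (incF _).
have mM n : (n <= T)%N -> Fmeas_real (F n.+1) (M n).
  move=> nT; apply: (Fmeas_comp (@measurable_expR R)).
  apply: Fmeas_sum_nat => // k /andP[k1 kn].
  have kT : (1 <= k <= T)%N by rewrite k1 (leq_trans _ nT).
  apply: Fmeas_realB => //.
    under eq_fun do rewrite mulrC; apply: Fmeas_realZ => //.
    by apply: Fmeas_realS (mY k kT); apply: incFle; exact: ltnW.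
  by apply: Fmeas_realS (mZ k kT); exact: incFle.
have M_ge0 n w : 0 <= M n w by exact: expR_ge0.
have bdM n w : (n <= T)%N -> M n w <= expR n%:R.
  move=> nT; rewrite ler_expR.
  have -> : n%:R = \sum_(1 <= k < n.+1) 1 :> R.
    by rewrite sumr_const_nat subSS subn0.
  rewrite big_nat_cond [leRHS]big_nat_cond; apply: ler_sum => k /andP[/andP[k1 kn] _].
  have kT : (1 <= k <= T)%N by rewrite k1 (leq_trans _ nT).
  by have := Y01 k w kT; have := Z01 k w kT; lra.
have bM n : (n <= T)%N -> bmeas (M n).
  move=> nT; apply: (@bounded_bmeas _ _ _ _ 0 (expR n%:R)).
    exact: Fmeas_real_measurable (mM n nT).
  by move=> w; rewrite M_ge0 bdM.
have EM n : (n <= T)%N -> Ex Pr (M n) <= 1.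
  elim: n => [|n IH] nT.
    rewrite (_ : M 0%N = fun=> 1) ?Ex_cst//.
    by apply/funext => w; rewrite /M big_geq// expR0.
  have kT : (1 <= n.+1 <= T)%N by [].
  (* [W] is the part of the next value known beforehand. The rest, [exp (- Z)], is at most
     [1 - Z / 2]; the hypothesis weighted by [W] trades [Z] for [Y], and
     [1 - Y / 2 <= exp (- Y / 2)] brings the mean back to that of [M n]. *)
  pose W w := M n w * expR (Y n.+1 w / 2).
  have mW : Fmeas_real (F n.+1) W.
    apply: Fmeas_realM => //; first exact/mM/ltnW.
    apply: (Fmeas_comp (@measurable_expR R)).
    by under eq_fun do rewrite mulrC; apply: Fmeas_realZ => //; exact: mY.
  have W01 w : 0 <= W w <= expR n%:R * expR 1.
    rewrite mulr_ge0 ?expR_ge0//= ler_pM ?expR_ge0 ?bdM ?(ltnW nT)// ler_expR.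
    by have := Y01 _ w kT; lra.
  have bW : bmeas W by apply: bounded_bmeas W01; exact: Fmeas_real_measurable mW.
  have bY : bmeas (Y n.+1).
    by apply: bounded_bmeas (fun w => Y01 _ w kT); exact: Fmeas_real_measurable (mY _ kT).
  have bZ : bmeas (Z n.+1).
    by apply: bounded_bmeas (fun w => Z01 _ w kT); exact: Fmeas_real_measurable (mZ _ kT).
  have key : Ex Pr (fun w => W w * Y n.+1 w) <= Ex Pr (fun w => W w * Z n.+1 w).
    apply: (@cond_le_extend (F n.+1) _ _ _ (expR n%:R * expR 1)) => //.
    - by move=> w; have /andP[] := Y01 _ w kT.
    - by move=> w; have /andP[] := Z01 _ w kT.
    - by move=> E; exact: hYZ.
  apply: (@le_trans _ _ (Ex Pr (fun w => W w - 2^-1 * (W w * Z n.+1 w)))).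
    apply: le_Ex; [exact: bM| |].
      apply: bmeasB => //; apply: bmeasM; first exact: bmeas_cst.
      exact: bmeasM.
    move=> w; rewrite /M big_nat_recr//= expRD expRD mulrA -/(M n w) -/(W w).
    have h := expRN_le_half (Z01 _ w kT); have /andP[w0 _] := W01 w.
    by apply: le_trans (ler_wpM2l w0 h) _; lra.
  have bm f c : bmeas f -> bmeas (fun w => c * f w).
    by apply: bmeasM; exact: bmeas_cst.
  rewrite ExB// ?ExZ//; try (by apply: bmeasM); last by apply: bm; apply: bmeasM.
  apply: (@le_trans _ _ (Ex Pr W - 2^-1 * Ex Pr (fun w => W w * Y n.+1 w))).
    by rewrite lerD2l lerN2 ler_pM2l.
  rewrite -ExZ; last exact: bmeasM.
  rewrite -ExB//; last by apply: bm; apply: bmeasM.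
  apply: le_trans (IH (ltnW nT)); apply: le_Ex.
  - by apply: bmeasB => //; apply: bm; apply: bmeasM.
  - exact/bM/ltnW.
  move=> w; set s := Y n.+1 w.
  have h : 1 - s / 2 <= expR (- (s / 2)) by exact: expR_ge1Dx.
  have -> : W w - 2^-1 * (W w * s) = W w * (1 - s / 2) by lra.
  have /andP[w0 _] := W01 w; apply: le_trans (ler_wpM2l w0 h) _.
  by rewrite /W -/s -mulrA -expRD subrr expR0 mulr1.
have mE : measurable [set w | M T w <= del^-1].
  apply: sub_sigma_measurable (sF T.+1) _.
  by apply: Fmeas_ler => //; [exact: mM|exact: Fmeas_cst].
(* Markov's inequality for [M T], whose mean is at most 1; on this event, taking logarithms gives
   the bound. *)
exists [set w | M T w <= del^-1]; split => //.
  have mEC := measurableC mE.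
  rewrite -[Pr _]fineK ?fin_num_measure// lee_fin -Ex_indic//.
  apply: (@le_trans _ _ (Ex Pr (fun w => del * M T w))).
    apply: le_Ex; first exact: bmeas_indic.
      by apply: bmeasM; [exact: bmeas_cst|exact: bM].
    move=> w; rewrite indicE; case: (boolP (w \in _)) => [/set_mem/= /negP|_].
      by rewrite -ltNge -(ltr_pM2l del0) divff ?gt_eqF// => /ltW.
    by rewrite mulr_ge0// ltW.
  rewrite ExZ; last exact: bM.
  by rewrite -[leRHS]mulr1 ler_pM2l// EM.
move=> w /=; rewrite -ler_ln ?posrE ?invr_gt0 ?expR_gt0// expRK div1r.
by rewrite sumrB -mulr_suml; lra.
Qed.

End conditional_inequality.

(** * Gaussian tails *)

Section normal_tails.
Context {R : realType}.
Implicit Types m s q : R.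

(** On the tail, the density centred at [m] is at most [exp (- q^2 / 2)] times the density centred
    at [m + q s], because the cross term of the square has the right sign; the latter density has
    mass at most 1 there. *)
Lemma normal_upper_tail m s q : 0 < s -> 0 <= q ->
  (normal_prob m s `](m + q * s)%R, +oo[%classic <= (expR (- (q ^+ 2 / 2)))%:E)%E.
Proof.
move=> s0 q0; have sn0 : s != 0 by rewrite gt_eqF.
have pm m' : measurable_fun setT (fun x => (normal_pdf m' s x)%:E).
  by apply/measurable_EFinP; exact: measurable_normal_pdf.
apply: (@le_trans _ _ (\int[lebesgue_measure]_(x in `](m + q * s)%R, +oo[)
   ((expR (- (q ^+ 2 / 2)))%:E * (normal_pdf (m + q * s) s x)%:E))%E).
  apply: ge0_le_integral => //.
  - by move=> x _; rewrite lee_fin normal_pdf_ge0.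
  - exact: (measurable_funTS (pm m)).
  - by apply: emeasurable_funM => //; exact: (measurable_funTS (pm _)).
  move=> x /=; rewrite in_itv/= andbT => hx.
  rewrite -EFinM lee_fin !normal_pdfE//.
  rewrite mulrCA ler_pM2l ?normal_peak_gt0// /normal_fun -expRD ler_expR.
  have s2 : 0 < s ^+ 2 *+ 2 by rewrite pmulrn_lgt0// exprn_gt0.
  have h : 0 <= q * s * (x - (m + q * s)) by rewrite !mulr_ge0 ?subr_ge0 ?(ltW hx) ?(ltW s0).
  rewrite -subr_ge0.
  have -> : - (q ^+ 2 / 2) + - (x - (m + q * s)) ^+ 2 / (s ^+ 2 *+ 2) -
     - (x - m) ^+ 2 / (s ^+ 2 *+ 2) =
     2 * (q * s * (x - (m + q * s))) / (s ^+ 2 *+ 2) by field.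
  by rewrite divr_ge0 ?(ltW s2)// mulr_ge0.
rewrite ge0_integralZl//.
- rewrite -[leRHS]mule1; apply: lee_wpmul2l; first by rewrite lee_fin expR_ge0.
  rewrite -(integral_normal_pdf (m + q * s) s).
  apply: ge0_subset_integral => //; first exact: pm.
  by move=> x _; rewrite lee_fin normal_pdf_ge0.
- exact: (measurable_funTS (pm _)).
- by move=> x _; rewrite lee_fin normal_pdf_ge0.
Qed.

(** The standard normal density at 2. It bounds from below the mass between one and two deviations
    under the mean: an interval of length [s] on which the density is smallest at the far end. *)
Definition normal_p0 : R := expR (- 2) * (Num.sqrt (pi *+ 2))^-1.

Lemma normal_p0_gt0 : 0 < normal_p0.
Proof.
by rewrite mulr_gt0 ?expR_gt0// invr_gt0 sqrtr_gt0 pmulrn_lgt0// pi_gt0.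
Qed.

Lemma normal_mass m s : 0 < s ->
  (normal_p0%:E <= normal_prob m s `[(m - 2 * s)%R, (m - s)%R]%classic)%E.
Proof.
move=> s0; have sn0 : s != 0 by rewrite gt_eqF.
have -> : (normal_p0%:E = \int[lebesgue_measure]_(x in `[(m - 2 * s)%R, (m - s)%R])
   (normal_peak s * expR (-2))%:E)%E.
  rewrite integral_cst//= lebesgue_measure_itv/= lte_fin ltrD2l ltrN2.
  rewrite ifT; last by rewrite ltr_pMl ?ltr1n.
  rewrite -EFinD -EFinM /normal_p0 /normal_peak -mulrnAr sqrtrM ?sqr_ge0// sqrtr_sqr gtr0_norm//.
  congr EFin; field.
  by rewrite sn0 gt_eqF// sqrtr_gt0 pmulrn_lgt0// pi_gt0.
apply: ge0_le_integral => //.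
- by move=> x _; rewrite lee_fin mulr_ge0 ?normal_peak_ge0 ?expR_ge0.
- by apply/measurable_EFinP/measurable_funTS; exact: measurable_normal_pdf.
move=> x /=; rewrite in_itv/= => /andP[x1 x2].
rewrite lee_fin normal_pdfE// ler_pM2l ?normal_peak_gt0// /normal_fun ler_expR.
have s2 : 0 < s ^+ 2 *+ 2 by rewrite pmulrn_lgt0// exprn_gt0.
rewrite ler_pdivlMr// mulNr lerN2.
have : 0 <= (x - (m - 2 * s)) * (m + 2 * s - x).
  by rewrite mulr_ge0 ?subr_ge0//; lra.
by rewrite -mulr_natr; nra.
Qed.

(** Stated as an upper tail with [q = -1], so that it fits the same tail hypothesis as the Gaussian
    upper bound when directions become random. *)
Lemma normal_anticoncentration m s : 0 < s ->
  (normal_prob m s `](m + (- 1) * s)%R, +oo[%classic <= (1 - normal_p0)%:E)%E.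
Proof.
move=> s0; rewrite mulN1r.
have -> : `]m - s, +oo[%classic = ~` `]-oo, (m - s)%R]%classic by rewrite setCitvl.
rewrite [leLHS]probability_setC// EFinB leeB//.
apply: le_trans (normal_mass m s0) _; apply: le_measure; rewrite ?inE//.
by move=> x /=; rewrite !in_itv/= => /andP[_ ->].
Qed.

Lemma normal_p0_lt1 : normal_p0 <= 1.
Proof.
have := normal_mass 0 (ltr01 : 0 < 1 :> R).
by move/le_trans => /(_ _ (probability_le1 _ _)); rewrite lee_fin; apply.
Qed.

End normal_tails.

(** * Integrals of possibly non-measurable functions and countable partitions *)

Section nonmeasurable_bound.
Context {dO : measure_display} {Om : measurableType dO} {R : realType}.
Variable Pr : probability Om R.
Import HBNNSimple.

(* [f] need not be measurable: in the Gaussian sampling clause the integrand is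
   a normal probability with random parameters. *)
Lemma integral_le_cst (E : set Om) (f : Om -> \bar R) (c : R) : measurable E ->
  (forall w, 0 <= f w)%E -> (forall w, E w -> f w <= c%:E)%E ->
  (\int[Pr]_(w in E) f w <= c%:E * Pr E)%E.
Proof.
move=> mE f0 fc.
have [->|/set0P[w0 Ew0]] := eqVneq E set0.
  by rewrite integral_set0 measure0 mule0.
have c0 : 0 <= c by have := le_trans (f0 w0) (fc _ Ew0); rewrite lee_fin.
(* The integral is the supremum over simple functions below the integrand. Each of them is at most
   [c * \1_E], and only these have to be measurable. *)
rewrite integral_mkcond ge0_integralTE; last first.
  by move=> w; rewrite erestrict_ge0.
apply: ge_ereal_sup => _ [g /= gf <-].
rewrite -integralT_nnsfun -[(c%:E * _)%E](_ : \int[Pr]_w (c * \1_E w)%:E = _)%E.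
  apply: ge0_le_integral => //.
  - by move=> w _; rewrite lee_fin.
  - by apply/measurable_EFinP; exact: measurable_funPT.
  - by apply/measurable_EFinP; apply: measurable_funM => //; exact: measurable_indic.
  move=> w _; apply: le_trans (gf w) _; rewrite patchE indicE.
  by case: (boolP (w \in E)) => [/set_mem/fc|_]; rewrite ?mulr1 ?mulr0.
under eq_integral do rewrite EFinM.
by rewrite ge0_integralZl// ?integral_indic ?setIT//; apply/measurable_EFinP; exact: measurable_indic.
Qed.

Lemma countable_partition_le (K : Om -> nat) (X Y : set Om) (c : R) :
  (forall k, measurable [set w | K w = k]) -> measurable X -> measurable Y -> 0 <= c ->
  (forall k, Pr (X `&` [set w | K w = k]) <= c%:E * Pr (Y `&` [set w | K w = k]))%E ->
  (Pr X <= c%:E * Pr Y)%E.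
Proof.
move=> mK mX mY c0 h.
have U (Z : set Om) : Z = \bigcup_(k in setT) (Z `&` [set w | K w = k]).
  by apply/seteqP; split => [w Zw|w [k _ []]//]; exists (K w).
have tr (Z : set Om) : trivIset setT (fun k => Z `&` [set w | K w = k]).
  by move=> i j _ _ [w [[_ <-] [_ <-]]].
have mZ (Z : set Om) : measurable Z -> forall i, measurable (Z `&` [set w | K w = i]).
  by move=> ? i; exact: measurableI.
rewrite {1}(U X) {1}(U Y) !measure_bigcup//; try by move=> i _; exact: mZ.
rewrite -nneseriesZl//.
by apply: lee_nneseries => i *; [exact: measure_ge0|exact: h].
Qed.

End nonmeasurable_bound.

(** * Gaussian samples in random directions *)

Section measurable_matrices.
Context {dO : measure_display} {Om : measurableType dO} {R : realType}.
Variable F : set (set Om).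
Hypothesis sF : sub_sigma F.

Definition Fmeas_mx (m n : nat) (M : Om -> 'M[R]_(m, n)) :=
  forall i j, Fmeas_real F (fun w => M w i j).

Lemma Fmeas_vecP d (u : Om -> 'cV[R]_d) : Fmeas_vec F u -> Fmeas_mx u.
Proof. by move=> h i j; rewrite ord1; exact: h. Qed.

Lemma Fmeas_mulmx m n p (M : Om -> 'M[R]_(m, n)) (N : Om -> 'M[R]_(n, p)) :
  Fmeas_mx M -> Fmeas_mx N -> Fmeas_mx (fun w => M w *m N w).
Proof.
move=> hM hN i j; under eq_fun do rewrite mxE.
by apply: Fmeas_sum => // k; exact: Fmeas_realM.
Qed.

Lemma Fmeas_trmx m n (M : Om -> 'M[R]_(m, n)) :
  Fmeas_mx M -> Fmeas_mx (fun w => (M w)^T).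
Proof. by move=> hM i j; under eq_fun do rewrite mxE; exact: hM. Qed.

Lemma Fmeas_mxB m n (M N : Om -> 'M[R]_(m, n)) :
  Fmeas_mx M -> Fmeas_mx N -> Fmeas_mx (fun w => M w - N w).
Proof.
by move=> hM hN i j; under eq_fun do rewrite !mxE; exact: Fmeas_realB.
Qed.

Lemma Fmeas_cst_mx m n (M : 'M[R]_(m, n)) : Fmeas_mx (fun=> M).
Proof. by move=> i j; exact: Fmeas_cst. Qed.

Lemma Fmeas_det n (M : Om -> 'M[R]_n) : Fmeas_mx M -> Fmeas_real F (fun w => \det (M w)).
Proof.
move=> hM; rewrite /determinant; apply: Fmeas_sum => // s.
by apply: Fmeas_realZ => //; exact: Fmeas_prod.
Qed.

Lemma Fmeas_invmx n (M : Om -> 'M[R]_n) : Fmeas_mx M ->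
  (forall w, posdef (M w)) -> Fmeas_mx (fun w => invmx (M w)).
Proof.
move=> hM pM i j.
(* [expR (- ln x)] is [x^-1] on positive reals, and visibly measurable. *)
have -> : (fun w => invmx (M w) i j) =
   (fun w => expR (- ln (\det (M w))) * cofactor (M w) j i).
  apply/funext => w; have p := posdef_unit (pM w).
  rewrite /invmx p !mxE expRN lnK//.
  by rewrite posrE; have [] := posdef_det (pM w).
apply: Fmeas_realM => //.
  apply: (Fmeas_comp (@measurable_expR R)); apply: Fmeas_realN => //.
  by apply: (Fmeas_comp (@measurable_ln R)); exact: Fmeas_det.
apply: Fmeas_realZ => //; apply: Fmeas_det => a b.
by under eq_fun do rewrite !mxE; exact: hM.
Qed.

Lemma Fmeas_dotv d (u v : Om -> 'cV[R]_d) : Fmeas_mx u -> Fmeas_mx v ->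
  Fmeas_real F (fun w => dotv (u w) (v w)).
Proof.
by move=> hu hv; apply: (Fmeas_mulmx (Fmeas_trmx hu) hv).
Qed.

Lemma Fmeas_mnorm d (A : Om -> 'M[R]_d) (u : Om -> 'cV[R]_d) :
  Fmeas_mx A -> Fmeas_mx u -> Fmeas_real F (fun w => mnorm (A w) (u w)).
Proof.
move=> hA hu; apply: (Fmeas_comp measurable_sqrt); apply: Fmeas_dotv => //.
exact: Fmeas_mulmx.
Qed.

Lemma Fmeas_gram d (x : nat -> Om -> 'cV[R]_d) lam t :
  (forall k, (1 <= k < t)%N -> Fmeas_mx (x k)) ->
  Fmeas_mx (fun w => gram lam (fun k => x k w) t).
Proof.
move=> hx i j; under eq_fun do rewrite /gram mxE summxE.
apply: Fmeas_realD => //; first exact: Fmeas_cst.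
apply: Fmeas_sum_nat => // k kt.
by apply: Fmeas_mulmx => //; [exact: hx|exact/Fmeas_trmx/hx].
Qed.

End measurable_matrices.

Lemma sub_sigma_full {dO : measure_display} (Om : measurableType dO) :
  sub_sigma (measurable : set (set Om)).
Proof. by split => //; exact: sigma_algebra_measurable. Qed.

Lemma cvg_seq_sum {R : realType} (I : Type) (s : seq I) (f : I -> nat -> R) (l : I -> R) :
  (forall i, f i @ \oo --> l i) ->
  (fun n => \sum_(i <- s) f i n) @ \oo --> \sum_(i <- s) l i.
Proof.
move=> h; elim: s => [|i s IH].
  by under eq_fun do rewrite big_nil; rewrite big_nil; exact: cvg_cst.
by under eq_fun do rewrite big_cons; rewrite big_cons; exact: cvgD.
Qed.

Section gaussian_direction.
Context {dO : measure_display} {Om : measurableType dO} {R : realType} {d : nat}.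
Variables (Pr : probability Om R) (F : set (set Om)).
Variables (th c : Om -> 'cV[R]_d) (A : Om -> 'M[R]_d) (beta : R).
Hypotheses (sF : sub_sigma F) (mth : Fmeas_mx measurable th).
Hypotheses (mc : Fmeas_mx F c) (mA : Fmeas_mx F A) (pA : forall w, posdef (A w)).
Hypothesis beta0 : 0 < beta.
Hypothesis gauss : forall (E : set Om) (u : 'cV[R]_d) (Bs : set R),
  F E -> u != 0 -> measurable Bs ->
  Pr (E `&` [set w | Bs (dotv u (th w))]) =
  (\int[Pr]_(w in E) normal_prob (dotv u (c w)) (beta * mnorm (A w) u) Bs)%E.
Variables (q psi : R).
Hypothesis psi0 : 0 <= psi.
Hypothesis hpsi : forall m s : R, 0 < s ->
  (normal_prob m s `](m + q * s)%R, +oo[%classic <= psi%:E)%E.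

Let h (v : 'cV[R]_d) w := dotv v (c w) + q * (beta * mnorm (A w) v).

Let fixed_direction (E : set Om) v (a : R) : F E -> (forall w, E w -> h v w <= a) ->
  (Pr (E `&` [set w | (a < dotv v (th w))%R]) <= psi%:E * Pr E)%E.
Proof.
(* The sampling law excludes the direction 0. There [h] vanishes, so the threshold is non-negative
   and the event is empty. *)
move=> FE ha; have [v0|v0] := eqVneq v 0.
  rewrite (_ : _ `&` _ = set0) ?measure0 ?mule_ge0 ?lee_fin//.
  apply/seteqP; split => // w [/ha /=]; rewrite /h v0 !dotv0l /mnorm mulmx0 dotv0l.
  by rewrite sqrtr0 !mulr0 addr0 => /le_lt_trans /[apply]; rewrite ltxx.
have -> : [set w | (a < dotv v (th w))%R] = [set w | `]a, +oo[%classic (dotv v (th w))].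
  by apply/seteqP; split => w /=; rewrite in_itv/= andbT.
rewrite gauss//; apply: integral_le_cst => //; first exact: sub_sigma_measurable FE.
move=> w Ew; set s := beta * _.
have s0 : 0 < s by rewrite mulr_gt0// sqrtr_gt0; case: (pA w) => _; exact.
apply: le_trans (hpsi (dotv v (c w)) s0); apply: le_measure; rewrite ?inE//.
move=> x /=; rewrite !in_itv/= !andbT; apply: le_lt_trans.
exact: ha.
Qed.

(** [fl] names a cell by an integer and [rnd] returns a point strictly above the whole cell: the
    cells are countable, and the error is at most [1 / n.+1]. *)
Let rnd (n : nat) (z : int) : R := (z + 1)%:~R / n.+1%:R.
Let fl (n : nat) (r : R) : int := Num.floor (r * n.+1%:R).

Let rnd_lt n r : r < rnd n (fl n r).
Proof. by rewrite /rnd ltr_pdivlMr// floorD1_gt. Qed.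

Let rnd_le n r : rnd n (fl n r) <= r + n.+1%:R^-1.
Proof.
rewrite /rnd ler_pdivrMr// mulrDl mulVf// intrD lerD2r.
exact: floor_le.
Qed.

Let rnd_cvg r : (fun n => rnd n (fl n r)) @ \oo --> r.
Proof.
apply: (@squeeze_cvgr _ _ _ _ (fun=> r) (fun n => r + n.+1%:R^-1)).
- by near=> n; rewrite (ltW (rnd_lt n r)) rnd_le.
- exact: cvg_cst.
rewrite -[X in _ --> X]addr0; apply: cvgD; [exact: cvg_cst|exact: cvg_harmonic].
Unshelve. all: by end_near. Qed.

Let fl_cell n (f : Om -> R) (z : int) : Fmeas_real F f -> F [set w | fl n (f w) = z].
Proof.
move=> mf; have -> : [set w | fl n (f w) = z] =
   [set w | z%:~R <= n.+1%:R * f w] `&` [set w | n.+1%:R * f w < (z + 1)%:~R].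
  apply/seteqP; split => w /=; rewrite /fl mulrC.
    by move=> <-; split; [exact: floor_le|exact: floorD1_gt].
  by move=> [h1 h2]; apply: floor_def; rewrite h1 h2.
by apply: sub_sigmaI => //; [apply: Fmeas_ler|apply: Fmeas_ltr] => //;
  [exact: Fmeas_cst|exact: Fmeas_realZ|exact: Fmeas_realZ|exact: Fmeas_cst].
Qed.

Let rnd_meas n (f : Om -> R) : Fmeas_real F f -> Fmeas_real F (fun w => rnd n (fl n (f w))).
Proof.
apply: (@Fmeas_comp _ _ _ _ (fun r => rnd n (fl n r))).
apply: nondecreasing_measurable => // x y xy; rewrite /rnd /fl.
by rewrite ler_pM2r ?invr_gt0// ler_int lerD2r le_floor// ler_pM2r.
Qed.

Variable u : Om -> 'cV[R]_d.
Hypothesis mu : Fmeas_mx F u.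

Let vn n w : 'cV[R]_d := \col_i rnd n (fl n (u w i 0)).
Let an n w : R := rnd n (fl n (h (vn n w) w)).

Let mh (v : Om -> 'cV[R]_d) : Fmeas_mx F v -> Fmeas_real F (fun w => h (v w) w).
Proof.
move=> mv; apply: Fmeas_realD => //; first exact: Fmeas_dotv.
by do 2 apply: Fmeas_realZ => //; exact: Fmeas_mnorm.
Qed.

Let mvn n : Fmeas_mx F (vn n).
Proof. by move=> i j; under eq_fun do rewrite mxE; exact: rnd_meas. Qed.

Let full (f : Om -> R) : Fmeas_real F f -> Fmeas_real measurable f.
Proof. by case: sF => _ s; exact: Fmeas_realS. Qed.

Let full_mx m n (f : Om -> 'M[R]_(m, n)) : Fmeas_mx F f -> Fmeas_mx measurable f.
Proof. by move=> h' i j; exact/full/h'. Qed.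

(* On each cell of the rounding the direction and the threshold are constant,
   so the law of a fixed projection applies; rounding up keeps the threshold
   above the mean plus [q] deviations. *)
Let Xn n := [set w | an n w < dotv (vn n w) (th w)].

Let mXn n : measurable (Xn n).
Proof.
have sm := sub_sigma_full Om.
apply: (Fmeas_ltr sm); first exact/full/rnd_meas/mh/mvn.
by apply: Fmeas_dotv => //; exact/full_mx/mvn.
Qed.

Let Xn_le n (E : set Om) : F E -> (Pr (E `&` Xn n) <= psi%:E * Pr E)%E.
Proof.
move=> FE; have mE := sub_sigma_measurable sF FE.
(* The integer cells of the direction and of the threshold are coded by a single natural number,
   which indexes the partition. *)
pose K w := pickle ((\col_i fl n (u w i 0), fl n (h (vn n w) w)) : 'cV[int]_d * int).
have FK k : F [set w | K w = k].
  have [[[iv ia] e]|hn] := pselect (exists p, pickle (p : 'cV[int]_d * int) = k); last first.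
    rewrite (_ : [set w | K w = k] = set0); first exact/(g_sigma_measurable _ sF).
    by apply/seteqP; split => // w /= e; apply: hn; eexists; exact: e.
  have -> : [set w | K w = k] =
     (\bigcap_(i in [set: 'I_d]) [set w | fl n (u w i 0) = iv i 0]) `&`
     [set w | fl n (h (vn n w) w) = ia].
    apply/seteqP; split => w /=.
      rewrite /K -e => /(pcan_inj pickleK) [e1 e2]; split => // i _ /=.
      by rewrite -e1 mxE.
    move=> [h1 h2]; rewrite /K h2 -e; congr (pickle (_, _)).
    by apply/colP => i; rewrite mxE h1.
  apply: sub_sigmaI => //; last exact/fl_cell/mh/mvn.
  apply/(g_sigma_measurable _ sF); apply: fin_bigcap_measurable => // i _.
  by apply/(g_sigma_measurable _ sF); exact: fl_cell.
apply: (countable_partition_le (K := K)) => //.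
- by move=> k; exact: sub_sigma_measurable (FK k).
- exact: measurableI.
move=> k; have [Ck|Ck] := eqVneq (E `&` [set w | K w = k]) set0.
  by rewrite setIAC Ck set0I !measure0 mule0.
have /set0P[w0 [Ew0 Kw0]] := Ck.
have cell w : K w = k -> vn n w = vn n w0 /\ an n w = an n w0.
  rewrite -Kw0 => /(pcan_inj pickleK) [/colP e1 e2]; split; last by rewrite /an e2.
  by apply/colP => i; rewrite !mxE; have := e1 i; rewrite !mxE => ->.
have -> : E `&` Xn n `&` [set w | K w = k] =
   E `&` [set w | K w = k] `&` [set w | (an n w0 < dotv (vn n w0) (th w))%R].
  apply/seteqP; split => w /=; first by move=> [[Ew Xw] /[dup] Kw /cell[<- <-]].
  by move=> [[Ew /[dup] Kw /cell[<- <-]] Xw].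
apply: fixed_direction; first exact: sub_sigmaI.
by move=> w [Ew /cell[<- <-]]; exact/ltW/rnd_lt.
Qed.

(** As the roundings converge, the strict inequality puts the outcome in [Xn n] for all large [n].
    The event thus lies in the increasing union of the [Y N], and each [Y N] is contained in [Xn N].
    Leaving [q] and [psi] general serves both the upper tails and anticoncentration. *)
Lemma gaussian_direction (E : set Om) : F E ->
  (Pr (E `&` [set w | (dotv (u w) (c w) + q * (beta * mnorm (A w) (u w))
                       < dotv (u w) (th w))%R]) <= psi%:E * Pr E)%E.
Proof.
move=> FE; have mE := sub_sigma_measurable sF FE.
set X := [set w | _].
pose Y N := E `&` \bigcap_(n in [set n | (N <= n)%N]) Xn n.
have mY N : measurable (Y N).
  by apply: measurableI => //; apply: bigcap_measurable => //; exists N => /=.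
have sm := sub_sigma_full Om.
have mX : measurable X.
  by apply: (Fmeas_ltr sm); [exact/full/mh|apply: Fmeas_dotv => //; exact/full_mx].
have XY : E `&` X `<=` \bigcup_N Y N.
  move=> w [Ew Xw].
  have vc i : (fun n => vn n w i 0) @ \oo --> u w i 0.
    by under eq_fun do rewrite mxE; exact: rnd_cvg.
  have dc (z : 'cV[R]_d) : (fun n => dotv (vn n w) z) @ \oo --> dotv (u w) z.
    rewrite dotvE; under eq_fun do rewrite dotvE.
    apply: cvg_seq_sum => i; apply: cvgM; [exact: vc|exact: cvg_cst].
  have ac : (fun n => mnorm (A w) (vn n w)) @ \oo --> mnorm (A w) (u w).
    apply: (@continuous_cvg _ _ _ _ _ _ (@Num.sqrt R)); first exact: sqrt_continuous.
    rewrite dotvE; under eq_fun do rewrite dotvE.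
    apply: cvg_seq_sum => i; apply: cvgM; first exact: vc.
    rewrite mxE; under eq_fun do rewrite mxE.
    by apply: cvg_seq_sum => j; apply: cvgM; [exact: cvg_cst|exact: vc].
  have hc : (fun n => h (vn n w) w) @ \oo --> h (u w) w.
    by apply: cvgD; [exact: dc|do 2 (apply: cvgM; first exact: cvg_cst)].
  have gc : (fun n => dotv (vn n w) (th w) - (h (vn n w) w + n.+1%:R^-1)) @ \oo -->
     dotv (u w) (th w) - (h (u w) w + 0).
    by apply: cvgB; [exact: dc|apply: cvgD; [exact: hc|exact: cvg_harmonic]].
  have : 0 < dotv (u w) (th w) - (h (u w) w + 0) by rewrite addr0 subr_gt0.
  move=> /(cvgr_gt _ gc) [N _ hN]; exists N => //; split => // n /hN /=.
  by rewrite subr_gt0; apply: le_lt_trans; exact: rnd_le.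
have mU : measurable (\bigcup_N Y N) by exact: bigcupT_measurable.
apply: (@le_trans _ _ (Pr (\bigcup_N Y N))).
  by apply: le_measure; rewrite ?inE//; exact: measurableI.
have ndY : {homo Y : n m / (n <= m)%N >-> (n <= m)%O}.
  move=> n m nm; apply/subsetPset => w [Ew hw]; split => // k /= mk.
  by apply: hw => /=; exact: leq_trans mk.
have cY := nondecreasing_cvg_mu (mu := Pr) mY mU ndY.
rewrite -(cvg_lim _ cY)//; apply: lime_le; first by apply/cvg_ex; eexists; exact: cY.
near=> n; apply: le_trans (Xn_le n FE); apply: le_measure; rewrite ?inE//.
  exact: measurableI.
by move=> w [Ew hw]; split => //; apply: hw => /=.
Unshelve. all: by end_near. Qed.

End gaussian_direction.

(** * Sampling from a random probability *)

Section kernel_mean.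
Context {dO dX : measure_display} {Om : measurableType dO} {X : measurableType dX} {R : realType}.
Variables (Pr : probability Om R) (F : set (set Om)).
Variables (kap : Om -> probability X R) (T : Om -> X).
Hypothesis sF : sub_sigma F.
Hypothesis mk : forall C, measurable C -> Fmeas_real F (fun w => fine (kap w C)).

Let level (f : X -> R) n (k : 'I_n.+1) := [set x | k.+1%:R <= n.+1%:R * f x].

Let mlevel f n k : measurable_fun setT f -> measurable (@level f n k).
Proof.
move=> mf; have sm := sub_sigma_full X.
apply: (Fmeas_ler sm); first exact: Fmeas_cst.
by apply: Fmeas_realZ => // B mB; rewrite -[_ @^-1` _]setTI; exact: mf.
Qed.

Let bmeas_stair (f : X -> R) n : measurable_fun setT f -> bmeas (fun x => stair n (f x)).
Proof.
move=> mf; under eq_fun do rewrite stairE.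
by apply: bmeasM; [exact: bmeas_cst|apply: bmeas_sum => k; exact/bmeas_indic/mlevel].
Qed.

Let stair_mean (nu : probability X R) (f : X -> R) n : measurable_fun setT f ->
  Ex nu (fun x => stair n (f x)) = n.+1%:R^-1 * \sum_(k < n.+1) fine (nu (@level f n k)).
Proof.
move=> mf; under eq_fun do rewrite stairE.
rewrite ExZ; last by apply: bmeas_sum => k; exact/bmeas_indic/mlevel.
rewrite Ex_sum; last by move=> k; exact/bmeas_indic/mlevel.
by congr (_ * _); apply: eq_bigr => k _; rewrite Ex_indic//; exact: mlevel.
Qed.

Let mean_bound (nu : probability X R) (f : X -> R) n : measurable_fun setT f ->
  (forall x, 0 <= f x <= 1) ->
  Ex nu (fun x => stair n (f x)) <= Ex nu f <= Ex nu (fun x => stair n (f x)) + n.+1%:R^-1.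
Proof.
move=> mf f01; have bf : bmeas f by exact: bounded_bmeas f01.
apply/andP; split.
  apply: le_Ex => //; first exact: bmeas_stair.
  by move=> x; have /andP[] := stair_bound n (f01 x).
rewrite -[X in _ + X](Ex_cst nu) -ExD; [|exact: bmeas_stair|exact: bmeas_cst].
apply: le_Ex => //; first by apply: bmeasD; [exact: bmeas_stair|exact: bmeas_cst].
by move=> x; have /andP[] := stair_bound n (f01 x).
Qed.

Let mstair (f : X -> R) n : measurable_fun setT f ->
  Fmeas_real F (fun w => Ex (kap w) (fun x => stair n (f x))).
Proof.
move=> mf; under eq_fun do rewrite stair_mean//.
by apply: Fmeas_realZ => //; apply: Fmeas_sum => // k; exact/mk/mlevel.
Qed.

Let kernel_mean_meas01 (f : X -> R) : measurable_fun setT f ->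
  (forall x, 0 <= f x <= 1) -> Fmeas_real F (fun w => Ex (kap w) f).
Proof.
move=> mf f01; apply/(Fmeas_realP _ sF).
apply: (@measurable_fun_cvg _ (g_sigma_algebraType F) R setT (fun n w => Ex (kap w) (fun x => stair n (f x)))).
  by move=> n; apply/(Fmeas_realP _ sF); exact: mstair.
move=> w _; apply: (@squeeze_cvgr _ _ _ _ (fun n => Ex (kap w) f - n.+1%:R^-1) (fun=> Ex (kap w) f)).
- near=> n; have /andP[h1 h2] := mean_bound (kap w) n mf f01.
  by rewrite h1 lerBlDr h2.
- rewrite -[X in _ --> X]subr0; apply: cvgB; [exact: cvg_cst|exact: cvg_harmonic].
- exact: cvg_cst.
Unshelve. all: by end_near. Qed.

Let affine (f : X -> R) M : 0 < M -> f = (fun x => 2 * M * ((f x + M) / (2 * M)) - M).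
Proof. by move=> M0; apply/funext => x; field; rewrite gt_eqF. Qed.

Let affine01 (f : X -> R) M : 0 < M -> (forall x, `|f x| <= M) ->
  forall x, 0 <= (f x + M) / (2 * M) <= 1.
Proof.
move=> M0 hf x; have := hf x; rewrite ler_norml => /andP[h1 h2].
have M2 : 0 < 2 * M by rewrite mulr_gt0.
by rewrite divr_ge0 ?(ltW M2)//= ?ler_pdivrMr//; lra.
Qed.

Let maffine (f : X -> R) M : measurable_fun setT f -> measurable_fun setT (fun x => (f x + M) / (2 * M)).
Proof. by move=> mf; apply: measurable_funM => //; exact: measurable_funD. Qed.

Let Ex_affine (nu : probability X R) (f : X -> R) M : 0 < M -> bmeas f ->
  Ex nu f = 2 * M * Ex nu (fun x => (f x + M) / (2 * M)) - M.
Proof.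
move=> M0 bf; rewrite {1}(affine f M0).
have b : bmeas (fun x => (f x + M) / (2 * M)).
  by apply: bmeasM; [apply: bmeasD => //|]; exact: bmeas_cst.
by rewrite ExB ?ExZ ?Ex_cst//; [apply: bmeasM => //|]; exact: bmeas_cst.
Qed.

(** Measurability is given for the probabilities of sets. The mean of a staircase is a combination
    of such probabilities, means of functions with values in [[0, 1]] are limits of these, and an
    affine change of scale reaches bounded functions. *)
Lemma kernel_mean_meas (f : X -> R) : bmeas f -> Fmeas_real F (fun w => Ex (kap w) f).
Proof.
move=> bf; have [mf [N hN]] := bf.
have M0 : 0 < `|N| + 1 by rewrite ltr_pwDr.
have hM x : `|f x| <= `|N| + 1.
  by rewrite (le_trans (hN x))// (le_trans (ler_norm N))// lerDl.
under eq_fun do rewrite (Ex_affine _ M0 bf).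
apply: Fmeas_realB => //; last exact: Fmeas_cst.
apply: Fmeas_realZ => //; apply: kernel_mean_meas01; first exact: maffine.
exact: affine01.
Qed.

Hypothesis mT : forall C, measurable C -> measurable (T @^-1` C).
Hypothesis law : forall E C, F E -> measurable C ->
  (Pr (E `&` T @^-1` C) = \int[Pr]_(w in E) kap w C)%E.

Let mcomp (f : X -> R) : bmeas f -> bmeas (fun w => f (T w)).
Proof.
move=> [mf [N hN]]; split; last by exists N.
move=> _ B mB; rewrite setTI; have := mf measurableT B mB; rewrite setTI => m.
exact: (mT m).
Qed.

Let law_real E C : F E -> measurable C ->
  Ex Pr (fun w => \1_E w * \1_(T @^-1` C) w) = Ex Pr (fun w => \1_E w * fine (kap w C)).
Proof.
move=> FE mC; have mE := sub_sigma_measurable sF FE.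
have b : bmeas (fun w => fine (kap w C)).
  apply: (@bounded_bmeas _ _ _ _ 0 1).
    by apply: Fmeas_real_measurable (mk mC).
  by move=> w; rewrite fine_ge0//= fine_le_prob// probability_le1.
apply: EFin_inj; rewrite !EFin_Ex_set//; last exact/bmeas_indic/mT.
rewrite integral_indic//; last exact: mT.
rewrite setIC; apply: etrans (law FE mC) _; apply: eq_integral => w _.
by rewrite fineK//; exact: fin_num_measure.
Qed.

Let kernel_mean_law01 (f : X -> R) E : bmeas f -> (forall x, 0 <= f x <= 1) -> F E ->
  Ex Pr (fun w => \1_E w * f (T w)) = Ex Pr (fun w => \1_E w * Ex (kap w) f).
Proof.
move=> bf f01 FE; have mf := bf.1; have mE := sub_sigma_measurable sF FE.
have bE : bmeas (\1_E : Om -> R) by exact: bmeas_indic.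
have bm (g : X -> R) : bmeas g -> (forall x, 0 <= g x <= 1) -> bmeas (fun w => Ex (kap w) g).
  move=> bg g01; apply: (@bounded_bmeas _ _ _ _ 0 1).
    by apply: Fmeas_real_measurable sF _; exact: kernel_mean_meas.
  move=> w; rewrite Ex_ge0/=; last by move=> x; have /andP[] := g01 x.
  rewrite -[leRHS](Ex_cst (kap w)); apply: le_Ex => //; first exact: bmeas_cst.
  by move=> x; have /andP[] := g01 x.
have s01 n x : 0 <= stair n (f x) <= 1.
  rewrite stair_ge0/=; have /andP[h _] := stair_bound n (f01 x).
  by apply: le_trans h _; have /andP[] := f01 x.
have bs n : bmeas (fun x => stair n (f x)) by exact: bmeas_stair.
have mid n : Ex Pr (fun w => \1_E w * stair n (f (T w))) =
             Ex Pr (fun w => \1_E w * Ex (kap w) (fun x => stair n (f x))).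
  transitivity (n.+1%:R^-1 * \sum_(k < n.+1) Ex Pr (fun w => \1_E w * \1_(T @^-1` @level f n k) w)).
    rewrite -Ex_sum -?ExZ; last first.
    - by move=> k; apply: bmeasM => //; apply/bmeas_indic/mT/mlevel.
    - by apply: bmeas_sum => k; apply: bmeasM => //; apply/bmeas_indic/mT/mlevel.
    congr (Ex _ _); apply/funext => w; rewrite stairE mulrCA mulr_sumr.
    by congr (_ * _); apply: eq_bigr => k _; rewrite !indicE.
  under eq_bigr => k _ do rewrite (law_real FE (mlevel k mf)).
  have bk k : bmeas (fun w => \1_E w * fine (kap w (@level f n k))).
    apply: bmeasM => //; apply: (@bounded_bmeas _ _ _ _ 0 1).
      by apply: Fmeas_real_measurable sF _; exact/mk/mlevel.
    move=> w; have ml := mlevel k mf.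
    by rewrite fine_ge0//= fine_le_prob// probability_le1.
  rewrite -Ex_sum// -ExZ; last exact: bmeas_sum.
  congr (Ex _ _); apply/funext => w; rewrite stair_mean// [RHS]mulrCA.
  by rewrite (mulr_sumr _ _ _ (\1_E w)).
have half (g h : Om -> R) n : bmeas g -> bmeas h -> (forall w, g w <= h w + n.+1%:R^-1) ->
   Ex Pr (fun w => \1_E w * g w) <= Ex Pr (fun w => \1_E w * h w) + 1 / n.+1%:R.
  move=> bg bh gh.
  rewrite -[X in _ + X](Ex_cst Pr) -ExD; [|exact: bmeasM|exact: bmeas_cst].
  apply: le_Ex; [exact: bmeasM|by apply: bmeasD; [exact: bmeasM|exact: bmeas_cst]|].
  move=> w; rewrite indicE; case: (w \in E); last by rewrite !mul0r add0r div1r invr_ge0.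
  by rewrite !mul1r; exact: gh.
have mono (g h : Om -> R) : bmeas g -> bmeas h -> (forall w, g w <= h w) ->
   Ex Pr (fun w => \1_E w * g w) <= Ex Pr (fun w => \1_E w * h w).
  move=> bg bh gh; apply: le_Ex; try exact: bmeasM.
  by move=> w; rewrite ler_wpM2l.
apply/le_anti/andP; split; apply: (@le_of_le_harmonic _ _ _ 1) => n.
  apply: le_trans (half (fun w => f (T w)) (fun w => stair n (f (T w))) n _ _ _) _ => //.
  - exact: mcomp.
  - exact: (mcomp (bs n)).
  - by move=> w; have /andP[] := stair_bound n (f01 (T w)).
  rewrite lerD2r mid; apply: mono => [||w]; [exact: bm|exact: bm|].
  by have /andP[] := mean_bound (kap w) n mf f01.
apply: le_trans (half (fun w => Ex (kap w) f)
   (fun w => Ex (kap w) (fun x => stair n (f x))) n _ _ _) _.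
- exact: bm.
- exact: bm.
- by move=> w; have /andP[] := mean_bound (kap w) n mf f01.
rewrite lerD2r -mid; apply: mono => [||w]; [exact: (mcomp (bs n))|exact: mcomp|].
by have /andP[] := stair_bound n (f01 (T w)).
Qed.

(** The sampling law is likewise given on sets: it is exact for staircases, whose distance to [f] is
    at most [1 / n.+1] on both sides of the identity. *)
Lemma kernel_mean_law (f : X -> R) E : bmeas f -> F E ->
  Ex Pr (fun w => \1_E w * f (T w)) = Ex Pr (fun w => \1_E w * Ex (kap w) f).
Proof.
move=> bf FE; have [mf [N hN]] := bf.
have M0 : 0 < `|N| + 1 by rewrite ltr_pwDr.
have hM x : `|f x| <= `|N| + 1.
  by rewrite (le_trans (hN x))// (le_trans (ler_norm N))// lerDl.
set M := `|N| + 1 in M0 hM.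
pose g x := (f x + M) / (2 * M).
have g01 : forall x, 0 <= g x <= 1 by exact: affine01.
have bg : bmeas g by apply: bounded_bmeas g01; exact: maffine.
have bE : bmeas (\1_E : Om -> R) by apply: bmeas_indic; exact: sub_sigma_measurable FE.
have bk : bmeas (fun w => Ex (kap w) g).
  apply: (@bounded_bmeas _ _ _ _ 0 1).
    by apply: Fmeas_real_measurable sF _; exact: kernel_mean_meas.
  move=> w; rewrite Ex_ge0/=; last by move=> x; have /andP[] := g01 x.
  rewrite -[leRHS](Ex_cst (kap w)); apply: le_Ex => //; first exact: bmeas_cst.
  by move=> x; have /andP[] := g01 x.
have lin (h : Om -> R) : bmeas h -> Ex Pr (fun w => \1_E w * (2 * M * h w - M)) =
   2 * M * Ex Pr (fun w => \1_E w * h w) - M * Ex Pr (\1_E).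
  move=> bh; rewrite -!ExZ//; last exact: bmeasM.
  rewrite -ExB; [|by apply: bmeasM; [exact: bmeas_cst|exact: bmeasM]|by apply: bmeasM => //; exact: bmeas_cst].
  by congr (Ex _ _); apply/funext => w; ring.
have e1 : (fun w => \1_E w * f (T w)) = (fun w => \1_E w * (2 * M * g (T w) - M)).
  by apply/funext => w; have /(congr1 (@^~ (T w))) /= -> := affine f M0.
have e2 : (fun w => \1_E w * Ex (kap w) f) = (fun w => \1_E w * (2 * M * Ex (kap w) g - M)).
  by apply/funext => w; rewrite (Ex_affine _ M0 bf).
rewrite e1 e2.
by rewrite !lin//; [rewrite kernel_mean_law01|exact: mcomp].
Qed.

End kernel_mean.

(** * Discounted features and values *)

Section values.
Context {R : realType} {dS dA : measure_display}
  {S : measurableType dS} {A : measurableType dA} {d : nat}.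
Variables (trajlaw : @policy R _ _ S A -> probability (traj S A) R)
  (phi : S * A -> 'cV[R]_d) (gam L : R).
Hypothesis gam01 : 0 < gam < 1.
Hypothesis mphi : forall i : 'I_d, measurable_fun [set: S * A] (fun sa => phi sa i 0).
Hypothesis phiL : forall sa, norm2 (phi sa) <= L.
Local Notation H := (Hgam gam).
Local Notation phit := (phi_traj phi gam).
Local Notation phip := (phi_pol trajlaw phi gam).
Local Notation V := (Vpi trajlaw phi gam).
Local Notation J := (Vstar trajlaw phi gam).

Lemma Hgam_gt0 : 0 < H.
Proof. by rewrite invr_gt0 subr_gt0; case/andP: gam01. Qed.

Lemma feature_bound_ge0 : 0 <= L.
Proof. exact: le_trans (norm2_ge0 _) (phiL point). Qed.

Let partial (tau : traj S A) (N : nat) : 'cV[R]_d :=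
  \col_i \sum_(h < N) gam ^+ h * phi (tau h) i 0.

Let geometric_le N : \sum_(h < N) gam ^+ h <= H.
Proof.
have [g0 g1] := andP gam01; have p : 0 < 1 - gam by rewrite subr_gt0.
rewrite /Hgam -[leRHS]mul1r ler_pdivlMr//.
have -> : (\sum_(h < N) gam ^+ h) * (1 - gam) = 1 - gam ^+ N.
  elim: N => [|N IH]; first by rewrite big_ord0 mul0r expr0 subrr.
  by rewrite big_ord_recr/= mulrDl IH exprS; ring.
by rewrite gerBl exprn_ge0// ltW.
Qed.

Let partial_cvg tau i : (fun N => partial tau N i 0) @ \oo --> phit tau i 0.
Proof.
have [g0 g1] := andP gam01.
rewrite mxE; under [X in X @ \oo]eq_fun do rewrite mxE.
have : cvgn [normed series (fun h => gam ^+ h * phi (tau h) i 0)].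
  apply: (@series_le_cvg _ _ (fun h => L * gam ^+ h)).
  - by move=> n; exact: normr_ge0.
  - by move=> n; rewrite mulr_ge0 ?feature_bound_ge0 ?exprn_ge0 ?ltW.
  - move=> n /=; rewrite normrM ger0_norm ?exprn_ge0 ?(ltW g0)// mulrC ler_wpM2r ?exprn_ge0 ?(ltW g0)//.
    by apply: le_trans (phiL (tau n)); exact: ler_norm2_coord.
  - by apply: is_cvg_geometric_series; rewrite ger0_norm// ltW.
move=> /normed_cvg; rewrite /series/=.
by under eq_fun do rewrite big_mkord.
Qed.

Let dot_partial tau v N : dotv v (partial tau N) <= norm2 v * (L * H).
Proof.
have [g0 g1] := andP gam01.
have -> : dotv v (partial tau N) = \sum_(h < N) gam ^+ h * dotv v (phi (tau h)).
  rewrite dotvE; under eq_bigr do rewrite mxE mulr_sumr.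
  rewrite exchange_big; apply: eq_bigr => h _; rewrite dotvE mulr_sumr.
  by apply: eq_bigr => i _; rewrite mulrCA.
apply: (@le_trans _ _ (\sum_(h < N) gam ^+ h * (norm2 v * L))).
  apply: ler_sum => h _; rewrite ler_wpM2l ?exprn_ge0 ?(ltW g0)//.
  by apply: le_trans (dotv_le _ _) _; rewrite ler_wpM2l ?norm2_ge0.
rewrite -mulr_suml mulrC mulrA ler_wpM2l ?geometric_le//.
by rewrite mulr_ge0 ?norm2_ge0 ?feature_bound_ge0.
Qed.

Let LH_ge0 : 0 <= L * H.
Proof. by rewrite mulr_ge0 ?feature_bound_ge0 ?ltW ?Hgam_gt0. Qed.

Lemma norm2_phi_traj tau : norm2 (phit tau) <= L * H.
Proof.
apply: norm2_le_of_dot => // v.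
have c : (fun N => dotv v (partial tau N)) @ \oo --> dotv v (phit tau).
  rewrite dotvE; under eq_fun do rewrite dotvE.
  by apply: cvg_seq_sum => i; apply: cvgM; [exact: cvg_cst|exact: partial_cvg].
rewrite -(cvg_lim _ c)//; apply: limr_le; first by apply/cvg_ex; eexists; exact: c.
by near=> N; exact: dot_partial.
Unshelve. all: by end_near. Qed.

Lemma measurable_traj_coord n : measurable_fun [set: traj S A] (fun tau : traj S A => tau n).
Proof.
move=> _ C mC; apply: sub_sigma_algebra; exists n => //.
by exists C.
Qed.

Lemma bmeas_phi_traj i : bmeas (fun tau => phit tau i 0).
Proof.
split; last first.
  exists (L * H) => tau; apply: le_trans (norm2_phi_traj tau); exact: ler_norm2_coord.
apply: (@measurable_fun_cvg _ _ _ _ (fun N tau => partial tau N i 0)); last first.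
  by move=> tau _; exact: partial_cvg.
move=> N; under eq_fun do rewrite mxE.
apply: measurable_sum => h; apply: measurable_funM => //.
apply: (measurableT_comp (mphi i)); exact: measurable_traj_coord.
Qed.

Lemma bmeas_dot_phi_traj v : bmeas (fun tau => dotv v (phit tau)).
Proof.
under eq_fun do rewrite dotvE.
by apply: bmeas_sum => i; apply: bmeasM; [exact: bmeas_cst|exact: bmeas_phi_traj].
Qed.

Lemma phi_polE pi i : phip pi i 0 = Ex (trajlaw pi) (fun tau => phit tau i 0).
Proof. by rewrite mxE. Qed.

Lemma dot_phi_pol v pi : dotv v (phip pi) = Ex (trajlaw pi) (fun tau => dotv v (phit tau)).
Proof.
under [in RHS]eq_fun do rewrite dotvE.
rewrite Ex_sum; last first.
  by move=> i; apply: bmeasM; [exact: bmeas_cst|exact: bmeas_phi_traj].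
rewrite dotvE; apply: eq_bigr => i _.
by rewrite phi_polE ExZ//; exact: bmeas_phi_traj.
Qed.

Lemma norm2_phi_pol pi : norm2 (phip pi) <= L * H.
Proof.
apply: norm2_le_of_dot => // v; rewrite dot_phi_pol -[leRHS](Ex_cst (trajlaw pi)).
apply: le_Ex; [exact: bmeas_dot_phi_traj|exact: bmeas_cst|move=> tau].
by apply: le_trans (dotv_le _ _) _; rewrite ler_wpM2l ?norm2_ge0 ?norm2_phi_traj.
Qed.

Lemma norm_Vpi th pi : `|V th pi| <= norm2 th * (L * H).
Proof.
apply: le_trans (dotv_cauchy _ _) _.
by rewrite ler_wpM2l ?norm2_ge0 ?norm2_phi_pol.
Qed.

Variable pi0 : @policy R _ _ S A.

(** [sup] takes a default value on empty or unbounded sets; [pi0] provides a value, and the feature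
    bound an upper bound. *)
Let has_sup_V th : has_sup [set r : R | exists pi, r = V th pi].
Proof.
split; first by exists (V th pi0), pi0.
exists (norm2 th * (L * H)) => _ [pi ->].
exact: le_trans (ler_norm _) (norm_Vpi _ _).
Qed.

Lemma Vpi_le_Vstar th pi : V th pi <= J th.
Proof. by apply: (sup_upper_bound (has_sup_V th)); exists pi. Qed.

Lemma Vstar_le th c : (forall pi, V th pi <= c) -> J th <= c.
Proof.
by move=> h; apply: ge_sup; [case: (has_sup_V th)|move=> _ [pi ->]].
Qed.

Lemma Vstar_bound th : J th <= norm2 th * (L * H).
Proof. by apply: Vstar_le => pi; exact: le_trans (ler_norm _) (norm_Vpi _ _). Qed.

Lemma Vstar_lip th th' : J th - J th' <= norm2 (th - th') * (L * H).
Proof.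
rewrite lerBlDr; apply: Vstar_le => pi.
have -> : V th pi = V (th - th') pi + V th' pi by rewrite /Vpi -dotvDl subrK.
by rewrite lerD ?Vpi_le_Vstar// (le_trans (ler_norm _))// norm_Vpi.
Qed.

(** The supremum need not be attained; the comparator of the optimism argument is optimal only up to
    the oracle accuracy. *)
Lemma Vstar_approx th e : 0 < e -> exists pi, J th - e < V th pi.
Proof.
move=> e0; have := sup_adherent e0 (has_sup_V th).
by move=> [_ [pi ->] h]; exists pi.
Qed.

End values.

(** * Failure probabilities and constants *)

Section good_events.
Context {dO : measure_display} {Om : measurableType dO} {R : realType}.
Variable Pr : probability Om R.

(** [whp] rephrased through the complement, so that failure probabilities add under conjunction. *)
Definition fails_atmost (c : R) (P : Om -> Prop) :=
  exists E : set Om, [/\ measurable E, (Pr (~` E) <= c%:E)%E & forall w, E w -> P w].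

Lemma fails_atmostW c c' (P Q : Om -> Prop) : fails_atmost c P -> c <= c' ->
  (forall w, P w -> Q w) -> fails_atmost c' Q.
Proof.
move=> [E [mE PE h]] cc PQ; exists E; split => //; last by move=> w /h/PQ.
by apply: le_trans PE _; rewrite lee_fin.
Qed.

Lemma fails_atmostT c (P : Om -> Prop) : 0 <= c -> (forall w, P w) -> fails_atmost c P.
Proof. by move=> c0 h; exists setT; split => //; rewrite setCT measure0 lee_fin. Qed.

Lemma fails_atmostI a b (P Q : Om -> Prop) : fails_atmost a P -> fails_atmost b Q ->
  fails_atmost (a + b) (fun w => P w /\ Q w).
Proof.
move=> [E [mE PE hE]] [G [mG PG hG]]; exists (E `&` G); split.
- exact: measurableI.
- rewrite setCI EFinD; apply: le_trans (leeD PE PG).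
  by apply: measureU2; exact: measurableC.
- by move=> w [/hE ? /hG].
Qed.

Lemma fails_atmost_seq (I : eqType) (s : seq I) c (P : I -> Om -> Prop) : 0 <= c ->
  (forall i, i \in s -> fails_atmost c (P i)) ->
  fails_atmost ((size s)%:R * c) (fun w => forall i, i \in s -> P i w).
Proof.
move=> c0; elim: s => [|i s IH] h.
  by apply: fails_atmostT => //; rewrite mul0r.
have h1 := h i (mem_head _ _).
have h2 := IH (fun j js => h j (mem_behead (s := i :: s) js)).
apply: fails_atmostW (fails_atmostI h1 h2) _ _.
  by rewrite /= -natr1 mulrDl mul1r addrC.
by move=> w [Pi Ps] j; rewrite inE => /predU1P[->//|]; exact: Ps.
Qed.

Lemma fails_atmost_nat (n : nat) c (P : nat -> Om -> Prop) : 0 <= c ->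
  (forall t, (1 <= t <= n)%N -> fails_atmost c (P t)) ->
  fails_atmost (n%:R * c) (fun w => forall t, (1 <= t <= n)%N -> P t w).
Proof.
move=> c0 h.
have := @fails_atmost_seq _ (iota 1 n) c P c0; rewrite size_iota => h'.
apply: fails_atmostW (h' _) (lexx _) _ => [t|w hw t tn].
  by rewrite mem_iota add1n ltnS => /h.
by apply: hw; rewrite mem_iota add1n ltnS.
Qed.

Lemma fails_atmost_le (E : set Om) c : measurable E -> (Pr E <= c%:E)%E ->
  fails_atmost c (fun w => ~ E w).
Proof.
by move=> mE h; exists (~` E); split => //; [exact: measurableC|rewrite setCK].
Qed.

Lemma fails_atmost_ge (E : set Om) c : measurable E -> ((1 - c)%:E <= Pr E)%E ->
  fails_atmost c E.
Proof.
move=> mE h; exists E; split => //; rewrite probability_setC//.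
by move: h; rewrite -[Pr E]fineK ?fin_num_measure// -EFinB !lee_fin; lra.
Qed.

Lemma fails_atmost_whp c (P : Om -> Prop) : fails_atmost c P -> whp Pr (1 - c) P.
Proof.
move=> [E [mE h hE]]; exists E; split => //; split => //.
move: h; rewrite probability_setC// -[Pr E]fineK ?fin_num_measure// -EFinB !lee_fin; lra.
Qed.

Lemma whp_fails_atmost c (P : Om -> Prop) : whp Pr (1 - c) P -> fails_atmost c P.
Proof.
move=> [E [mE [h hE]]]; have [G [mG PG hG]] := fails_atmost_ge mE h.
by exists G; split => // w /hG/hE.
Qed.

(** Adding constants makes [Y], [Z] and [W] non-negative, so that [cond_le_extend] applies in both
    directions. The extra terms agree because the hypothesis at the full event equates the means of
    [Y] and [Z]. *)
Lemma cond_eq_extend (F : set (set Om)) (Y Z W : Om -> R) :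
  sub_sigma F -> bmeas Y -> bmeas Z -> Fmeas_real F W -> (exists M, forall w, `|W w| <= M) ->
  (forall E, F E -> Ex Pr (fun w => \1_E w * Y w) = Ex Pr (fun w => \1_E w * Z w)) ->
  Ex Pr (fun w => W w * Y w) = Ex Pr (fun w => W w * Z w).
Proof.
move=> sF bY bZ mW [M hM] h.
have [_ [a ha]] := bY; have [_ [b hb]] := bZ.
have bW : bmeas W by split; [exact: Fmeas_real_measurable mW|exists M].
set K := `|a| + `|b|.
have K0 : 0 <= K by rewrite addr_ge0.
have YK w : - K <= Y w.
  have := ha w; rewrite ler_norml => /andP[+ _]; apply: le_trans.
  by rewrite lerN2 (le_trans (ler_norm a))// lerDl.
have ZK w : - K <= Z w.
  have := hb w; rewrite ler_norml => /andP[+ _]; apply: le_trans.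
  by rewrite lerN2 (le_trans (ler_norm b))// lerDr.
have WM w : 0 <= W w + M <= M + M.
  have := hM w; rewrite ler_norml => /andP[h1 h2]; apply/andP; split; lra.
have bc c : bmeas (fun=> c : R) by exact: bmeas_cst.
have expand (f : Om -> R) : bmeas f -> Ex Pr (fun w => (W w + M) * (f w + K)) =
    Ex Pr (fun w => W w * f w) + (M * Ex Pr f + (K * Ex Pr W + M * K)).
  move=> bf.
  have bWf : bmeas (fun w => W w * f w) by exact: bmeasM.
  have bMf : bmeas (fun w => M * f w) by exact: bmeasM.
  have bKW : bmeas (fun w => K * W w) by exact: bmeasM.
  rewrite -(Ex_cst Pr (M * K)) -!ExZ// -!ExD//; try by repeat apply: bmeasD.
  by congr (Ex _ _); apply/funext => w; ring.
have hT : Ex Pr Y = Ex Pr Z.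
  have := h _ (sub_sigmaT sF); have e (f : Om -> R) : (fun w => \1_setT w * f w) = f.
    by apply/funext => w; rewrite indicT mul1r.
  by rewrite !e.
have shift E (f : Om -> R) : F E -> bmeas f ->
   Ex Pr (fun w => \1_E w * (f w + K)) = Ex Pr (fun w => \1_E w * f w) + K * Ex Pr (\1_E).
  move=> FE bf; have bE : bmeas (\1_E : Om -> R) by apply: bmeas_indic; exact: sub_sigma_measurable FE.
  have b1 : bmeas (fun w => \1_E w * f w) by exact: bmeasM.
  have b2 : bmeas (fun w => K * \1_E w) by exact: bmeasM.
  by rewrite -ExZ// -ExD//; congr (Ex _ _); apply/funext => w; ring.
have mW' : Fmeas_real F (fun w => W w + M) by apply: Fmeas_realD => //; exact: Fmeas_cst.
have half (f g : Om -> R) : bmeas f -> bmeas g -> (forall w, - K <= f w) -> (forall w, - K <= g w) ->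
   (forall E, F E -> Ex Pr (fun w => \1_E w * f w) = Ex Pr (fun w => \1_E w * g w)) ->
   Ex Pr (fun w => (W w + M) * (f w + K)) <= Ex Pr (fun w => (W w + M) * (g w + K)).
  move=> bf bg fK gK e.
  apply: (cond_le_extend (Y := fun w => f w + K) (Z := fun w => g w + K) (W := fun w => W w + M) sF _ _ _ _ mW' WM).
  - exact: bmeasD.
  - exact: bmeasD.
  - by move=> w; rewrite -lerBlDr sub0r.
  - by move=> w; rewrite -lerBlDr sub0r.
  - by move=> E FE; rewrite !shift// e.
have : Ex Pr (fun w => (W w + M) * (Y w + K)) = Ex Pr (fun w => (W w + M) * (Z w + K)).
  by apply/le_anti/andP; split; apply: half => // E FE; rewrite h.
by rewrite !expand// hT => /addIr.
Qed.

End good_events.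

(** * The curvature constant of the logistic link *)

Section logistic_constant.
Context {R : realType}.

Lemma derive1_sigm (x : R) : (derive1 (@sigm R) x)^-1 = expR x + 2 + expR (- x).
Proof.
have p : 1 + expR (- x) != 0 by rewrite gt_eqF// ltr_pwDl// expR_ge0.
have dE : is_derive x 1 (fun y : R => 1 + expR (- y)) (- expR (- x)).
  have d1 : is_derive x 1 (fun y : R => - y) (-1).
    exact: (is_deriveN (is_derive_id x (1 : R))).
  have d2 : is_derive x 1 (expR \o (fun y : R => - y)) (expR (- x) * -1).
    exact: is_derive1_comp.
  apply: (is_derive_eq (is_deriveD (is_derive_cst (1 : R) x (1 : R)) d2)).
  by rewrite add0r mulrN1.
have dS : is_derive x 1 (@sigm R) (expR (- x) / (1 + expR (- x)) ^+ 2).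
  have -> : @sigm R = (fun y : R => (1 + expR (- y))^-1).
    by apply/funext => y; rewrite /sigm div1r.
  apply: (is_derive_eq (@is_deriveV R (fun y : R => 1 + expR (- y)) x _ 1 p dE)).
  by rewrite scaleNr scalerN opprK mulrC.
rewrite derive1E derive_val invf_div.
have e0 : expR (- x) != 0 by rewrite gt_eqF// expR_gt0.
have -> : expR x = (expR (- x))^-1 by rewrite -expRN opprK.
by field.
Qed.

(** The value 4, reached at [th = x = 0], belongs to the set. The explicit inverse derivative also
    bounds the set, without which [sup] would not dominate its elements. *)
Lemma kappa_ge1 d (B L gam : R) : 0 <= B -> 0 <= 2 * L * Hgam gam -> 1 <= kappa d B L gam.
Proof.
move=> B0 X0; set X := 2 * L * Hgam gam in X0 *.
apply: (@le_trans _ _ 4); first by rewrite ler1n.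
apply: ub_le_sup.
  exists (expR (B * X) + 2 + expR (B * X)) => _ [th [x [hth hx ->]]].
  rewrite derive1_sigm.
  have h : `|dotv th x| <= B * X.
    by apply: le_trans (dotv_cauchy _ _) _; rewrite ler_pM ?norm2_ge0.
  move: h; rewrite ler_norml => /andP[h1 h2].
  by rewrite lerD ?lerD2r ?ler_expR// lerNl.
exists 0, 0; rewrite !norm20; split => //.
by rewrite derive1_sigm dotv0l oppr0 expR0; lra.
Qed.

End logistic_constant.

(** * Density of rational vectors *)

Section rational_vectors.
Context {R : realType} {d : nat}.

Definition ratvec (n : nat) : 'cV[R]_d :=
  if unpickle n is Some v then map_mx ratr (v : 'cV[rat]_d) else 0.

Lemma ratvec_dense (th : 'cV[R]_d) (e : R) : 0 < e -> exists n, norm2 (ratvec n - th) <= e.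
Proof.
(* The squared error is at most [d e'^2 <= e^2]; dividing by [d.+1] rather than [d] covers dimension
   0. *)
move=> e0; pose e' := e / d.+1%:R.
have e'0 : 0 < e' by rewrite divr_gt0.
have hq i : exists q : rat, th i 0 < ratr q < th i 0 + e'.
  have : th i 0 < th i 0 + e' by rewrite ltrDl.
  by move=> /rat_in_itvoo [q]; rewrite in_itv/=; exists q.
pose v : 'cV[rat]_d := \col_i xchoose (hq i).
exists (pickle v); rewrite /ratvec pickleK.
rewrite -(@ler_pXn2r _ 2%N) ?nnegrE ?norm2_ge0 ?(ltW e0)// norm2_sqr dotvE.
apply: (@le_trans _ _ (\sum_(i < d) e' ^+ 2)).
  apply: ler_sum => i _; rewrite -expr2 !mxE.
  have /andP[h1 h2] := xchooseP (hq i).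
  by rewrite lerXn2r ?nnegrE ?(ltW e'0)// ?subr_ge0 ?(ltW h1)// lerBlDl ltW.
rewrite sumr_const card_ord /e' expr_div_n -[_ *+ d]mulr_natl mulrCA ler_piMr ?sqr_ge0//.
rewrite ler_pdivrMr ?exprn_gt0// mul1r -natrX ler_nat.
by rewrite (leq_trans (leqnSn d))// leq_pmulr.
Qed.

End rational_vectors.

(** * A run of the algorithm *)

Section run_analysis.
Context {R : realType} {dS dA dO : measure_display}
  {S : measurableType dS} {A : measurableType dA} {Om : measurableType dO} {d : nat}.
Variables (trajlaw : @policy R _ _ S A -> probability (traj S A) R)
  (phi : S * A -> 'cV[R]_d) (gam : R) (thstar : 'cV[R]_d)
  (B L lam C0 : R) (T : nat) (del : R) (Pr : probability Om R)
  (Fpre Fth Fpol Ftraj : nat -> set (set Om)) (pi0 : @policy R _ _ S A)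
  (thtil thhat : nat -> Om -> 'cV[R]_d) (pol : nat -> Om -> @policy R _ _ S A)
  (tau tau' : nat -> Om -> traj S A) (y : nat -> Om -> bool).
Hypotheses (gam01 : 0 < gam < 1) (lam0 : 0 < lam) (C01 : 1 <= C0).
Hypothesis mphi : forall i : 'I_d, measurable_fun [set: S * A] (fun sa => phi sa i 0).
Hypothesis phiL : forall sa, norm2 (phi sa) <= L.
Hypothesis starB : norm2 thstar <= B.
Hypothesis C0v : C0_valid thstar B L gam lam C0.
Hypothesis del01 : 0 < del < 1.
Hypothesis run : rpo_run trajlaw phi gam thstar B L lam C0 T del Pr Fpre Fth Fpol Ftraj
      pi0 thtil thhat pol tau tau' y.

Local Notation H := (Hgam gam).
Local Notation phip pi := (phi_pol trajlaw phi gam pi).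
Local Notation V := (Vgram phi gam lam tau tau').
Local Notation x := (xfeat phi gam tau tau').
Local Notation beta := (beta_t (d := d) gam B L lam C0 del).
Local Notation Vpi := (Vpi trajlaw phi gam).
Local Notation J := (Vstar trajlaw phi gam).
Local Notation D t w := (phip (pol t w) - phip (pol t.-1 w)).
Local Notation X := (2 * L * H).
Local Notation z t w := (thtil t w - thhat t w).

Lemma diameter_ge0 : 0 <= X.
Proof.
by rewrite mulr_ge0 ?(ltW (Hgam_gt0 gam01))// mulr_ge0// (feature_bound_ge0 phiL).
Qed.

Lemma radius_ge0 : 0 <= B.
Proof. exact: le_trans (norm2_ge0 _) starB. Qed.

Lemma failure_share_bounds : 0 < del' del < 1.
Proof. by move: del01; rewrite /del' => /andP[h1 h2]; apply/andP; split; lra. Qed.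

(** Strict positivity keeps the sampled projections non-degenerate, as the tail bounds demand. It
    comes from [ln (1 / del') > 0] and [kappa >= 1]. *)
Lemma beta_gt0 t : 0 < beta t.
Proof.
have k1 := kappa_ge1 d radius_ge0 diameter_ge0.
have /andP[e0 e1] := failure_share_bounds.
rewrite sqrtr_gt0 mulr_gt0 ?(lt_le_trans ltr01 C01)// ltr_pwDl//.
  rewrite mulr_gt0 ?(lt_le_trans ltr01 k1)// ltr_pwDl//.
    by rewrite div1r lnV ?posrE// oppr_gt0 ln_lt0// e0 e1.
  rewrite mulr_ge0// ln_ge0// le_max; apply/orP; left.
  by have := expR_ge1Dx (1 : R); lra.
by rewrite mulr_ge0 ?sqr_ge0 ?(ltW lam0).
Qed.

Lemma V_posdef t w : posdef (V t w).
Proof. exact: gram_posdef. Qed.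

Lemma norm2_x t w : norm2 (x t w) <= X.
Proof.
rewrite (le_trans (norm2B _ _))// (_ : X = L * H + L * H); last by ring.
by rewrite lerD ?(norm2_phi_traj gam01 phiL).
Qed.

Lemma norm2_D t w : norm2 (D t w) <= X.
Proof.
rewrite (le_trans (norm2B _ _))// (_ : X = L * H + L * H); last by ring.
by rewrite lerD ?(norm2_phi_pol trajlaw gam01 mphi phiL).
Qed.

Lemma run_sub_sigma t : [/\ sub_sigma (Fpre t), sub_sigma (Fth t), sub_sigma (Fpol t) &
  sub_sigma (Ftraj t)].
Proof. by case: run => /(_ t)[? [? [? ?]]] _. Qed.

Lemma run_filtration t : [/\ Fpre t `<=` Fth t, Fth t `<=` Fpol t, Fpol t `<=` Ftraj t &
  Ftraj t `<=` Fpre t.+1].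
Proof. by case: run => _ [/(_ t)[? [? [? ?]]] _]. Qed.

Lemma Fpre_mono s t : (s <= t)%N -> Fpre s `<=` Fpre t.
Proof.
move=> /subnK <-; elim: (t - s)%N => // k IH; rewrite addSn.
have [i1 i2 i3 i4] := run_filtration (k + s).
by apply: subset_trans IH _; apply: subset_trans i1 (subset_trans i2 (subset_trans i3 i4)).
Qed.

Lemma Fpol_Fpre s t : (s < t)%N -> Fpol s `<=` Fpre t.
Proof.
move=> st; have [_ _ i3 i4] := run_filtration s.
exact: subset_trans (subset_trans i3 i4) (Fpre_mono st).
Qed.

Lemma meas_thhat t : Fmeas_mx (Fpre t) (thhat t).
Proof. by apply: Fmeas_vecP; case: run => _ [_ [h _]]. Qed.

Lemma meas_thtil t : Fmeas_mx (Fth t) (thtil t).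
Proof. by apply: Fmeas_vecP; case: run => _ [_ [_ [h _]]]. Qed.

Lemma meas_kernel t C : measurable C -> Fmeas_real (Fpol t) (fun w => fine (trajlaw (pol t w) C)).
Proof. by case: run => _ [_ [_ [_ [h _]]]]; exact: h. Qed.

Lemma meas_phip t : Fmeas_mx (Fpol t) (fun w => phip (pol t w)).
Proof.
move=> i j; rewrite ord1; have [_ _ s _] := run_sub_sigma t.
under eq_fun do rewrite phi_polE.
apply: (kernel_mean_meas s); first exact: meas_kernel.
exact: (bmeas_phi_traj gam01 mphi phiL).
Qed.

Lemma FmeasS_mx F F' m n (M : Om -> 'M[R]_(m, n)) : F `<=` F' -> Fmeas_mx F M -> Fmeas_mx F' M.
Proof. by move=> s h i j; exact: Fmeas_realS (h i j). Qed.

Lemma meas_tau t C : measurable C -> Ftraj t (tau t @^-1` C) /\ Ftraj t (tau' t @^-1` C).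
Proof.
by case: run => _ [_ [_ [_ [_ [/(_ t)[h1 h2] _]]]]] mC; split; [exact: h1|exact: h2].
Qed.

Lemma meas_x t : Fmeas_mx (Ftraj t) (x t).
Proof.
have [_ _ _ s] := run_sub_sigma t.
apply: Fmeas_mxB => // i j Bs mB; rewrite ord1.
  have [mf _] := bmeas_phi_traj gam01 mphi phiL i.
  have := mf measurableT Bs mB; rewrite setTI => m.
  exact: (meas_tau t m).1.
have [mf _] := bmeas_phi_traj gam01 mphi phiL i.
have := mf measurableT Bs mB; rewrite setTI => m.
exact: (meas_tau t m).2.
Qed.

Lemma meas_V t : Fmeas_mx (Fpre t) (V t).
Proof.
have [s _ _ _] := run_sub_sigma t.
apply: Fmeas_gram => // k /andP[_ kt]; have [_ _ _ i4] := run_filtration k.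
by apply: FmeasS_mx (meas_x k); apply: subset_trans i4 (Fpre_mono kt).
Qed.

Lemma meas_Vinv t : Fmeas_mx (Fpre t) (fun w => invmx (V t w)).
Proof.
have [s _ _ _] := run_sub_sigma t.
by apply: Fmeas_invmx => //; [exact: meas_V|exact: V_posdef].
Qed.

(** * Confidence, oracle accuracy and sample width *)

Lemma confidence_event : fails_atmost Pr (del' del) (fun w => forall t, (1 <= t <= T)%N ->
  mnorm (V t w) (thstar - thhat t w) <= beta t).
Proof.
have [_ [_ [_ [_ [_ [_ [my [_ [hat1 [cmle [_ [_ [_ pref]]]]]]]]]]]]] := run.
(* In the filtration [Ftraj], [x_t] is known at stage [t] and the answer [y_t] only at the next
   one. *)
have := C0v (Pr := Pr) (N := T) (G := Ftraj) (x := x) (y := y) (thhat := thhat) failure_share_bounds.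
case.
- by move=> t; have [] := run_sub_sigma t.
- move=> t; have [_ _ _ i4] := run_filtration t; have [i1 i2 i3 _] := run_filtration t.+1.
  exact: subset_trans i4 (subset_trans i1 (subset_trans i2 i3)).
- by move=> t _ i; exact: meas_x.
- move=> t _; have [i1 i2 i3 _] := run_filtration t.+1.
  by apply: i3; apply: i2; apply: i1; exact: my.
- by move=> t w _; exact: norm2_x.
- by move=> t E tT FE; exact: pref.
- move=> t w /andP[t1 tT]; move: t1; rewrite leq_eqVlt => /predU1P[<-|t1].
    (* With no data the likelihood is an empty sum, so [thhat 1 = 0] is a constrained minimiser. *)
    rewrite hat1; split; first by rewrite norm20 radius_ge0.
    by move=> th' _; rewrite /negloglik !big_geq.
  by apply: cmle; rewrite t1.
move=> E [mE [PE hE]]; apply: whp_fails_atmost; exists E; split => //; split => // w Ew t /andP[t1 tT].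
by apply: hE => //; rewrite t1 leqW.
Qed.

Lemma pac_event : (1 <= T)%N -> fails_atmost Pr (del' del) (fun w => forall t, (1 <= t <= T)%N ->
  J (thtil t w) - Vpi (thtil t w) (pol t w) <= eps_T T).
Proof.
move=> T1; have [_ [_ [_ [_ [_ [_ [_ [_ [_ [_ [_ [pac _]]]]]]]]]]]] := run.
have /andP[e0 e1] := failure_share_bounds.
have e : del' del = T%:R * (del' del / T%:R).
  by rewrite mulrCA divff ?mulr1// pnatr_eq0 -lt0n.
rewrite e; apply: fails_atmost_nat; first by rewrite divr_ge0 ?(ltW e0).
move=> t tT; have [_ s _ _] := run_sub_sigma t; have [_ _ s' _] := run_sub_sigma t.
have [G [FG [Gs hG]]] := pac t tT setT (sub_sigmaT s).
have mG := sub_sigma_measurable s' FG.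
apply: fails_atmostW (fails_atmost_ge mG _) (lexx _) _.
  by move: hG; rewrite probability_setT mule1.
by move=> w /Gs [].
Qed.

Lemma gauss_direction t (u : Om -> 'cV[R]_d) q psi (E : set Om) : (1 <= t <= T)%N ->
  Fmeas_mx (Fpre t) u -> 0 <= psi ->
  (forall m s : R, 0 < s -> (normal_prob m s `](m + q * s)%R, +oo[%classic <= psi%:E)%E) ->
  Fpre t E ->
  (Pr (E `&` [set w | (dotv (u w) (thhat t w) + q * (beta t * mnorm (invmx (V t w)) (u w))
       < dotv (u w) (thtil t w))%R]) <= psi%:E * Pr E)%E.
Proof.
move=> tT mu psi0 hpsi FE; have [s1 s2 _ _] := run_sub_sigma t.
have [_ [_ [_ [_ [_ [_ [_ [_ [_ [_ [gs _]]]]]]]]]]] := run.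
apply: (gaussian_direction (F := Fpre t)) => //.
- by apply: FmeasS_mx (meas_thtil t); case: s2.
- exact: meas_thhat.
- exact: meas_Vinv.
- by move=> w; apply/posdef_inv/V_posdef.
- exact: beta_gt0.
- by move=> E' v Bs FE' v0 mBs; exact: gs.
Qed.

Lemma direction_event t (u : Om -> 'cV[R]_d) q : (1 <= t <= T)%N -> Fmeas_mx (Fpre t) u -> 0 <= q ->
  fails_atmost Pr (2 * expR (- (q ^+ 2 / 2))) (fun w =>
    dotv (u w) (z t w) ^+ 2 <= (q * beta t) ^+ 2 * dotv (u w) (invmx (V t w) *m u w)).
Proof.
move=> tT mu q0; have [s1 s2 _ _] := run_sub_sigma t.
pose bad (v : Om -> 'cV[R]_d) := [set w | (dotv (v w) (thhat t w) +
  q * (beta t * mnorm (invmx (V t w)) (v w)) < dotv (v w) (thtil t w))%R].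
have one (v : Om -> 'cV[R]_d) : Fmeas_mx (Fpre t) v ->
    fails_atmost Pr (expR (- (q ^+ 2 / 2))) (fun w => ~ bad v w).
  move=> mv; apply: fails_atmost_le.
    have [_ inc] := s2; have [i1 _ _ _] := run_filtration t.
    apply: inc; apply: Fmeas_ltr => //; last by apply: Fmeas_dotv => //; [exact: FmeasS_mx mv|exact: meas_thtil].
    apply: (Fmeas_realS i1); apply: Fmeas_realD => //; first by apply: Fmeas_dotv => //; exact: meas_thhat.
    by do 2 apply: Fmeas_realZ => //; apply: Fmeas_mnorm => //; exact: meas_Vinv.
  have := gauss_direction (E := setT) tT mv (expR_ge0 (- (q ^+ 2 / 2)))
    (fun m s s0 => normal_upper_tail m s0 q0) (sub_sigmaT s1).
  by rewrite setTI probability_setT mule1.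
have mNu : Fmeas_mx (Fpre t) (fun w => - u w).
  by move=> i j; under eq_fun do rewrite mxE; exact: Fmeas_realN.
apply: fails_atmostW (fails_atmostI (one u mu) (one _ mNu)) _ _.
  by rewrite mulr2n mulrDl !mul1r.
move=> w [/negP h1 /negP h2]; move: h1 h2; rewrite -!leNgt mnormN !dotvNl.
set m := mnorm _ _ => h1 h2.
have p := posdef_ge0 (u w) (posdef_inv (V_posdef t w)).
have m2 : m ^+ 2 = dotv (u w) (invmx (V t w) *m u w) by rewrite sqr_sqrtr.
have m0 : 0 <= m by exact: sqrtr_ge0.
rewrite -m2 -exprMn -(real_normK (num_real (dotv (u w) (z t w)))).
rewrite lerXn2r ?nnegrE ?mulr_ge0 ?(ltW (beta_gt0 t))// ler_norml dotvBr.
by apply/andP; split; lra.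
Qed.

(** A union bound over the directions of [gram_directions], the coordinate axes and the past
    features, all known before the sample. The failure probability allots a share to each of the [T]
    features, so that it is the same in every round. *)
Lemma sample_event t q : (1 <= t <= T)%N -> 0 <= q ->
  fails_atmost Pr (2 * (d + T)%:R * expR (- (q ^+ 2 / 2)))
   (fun w => mnorm (V t w) (z t w) <= q * Num.sqrt d%:R * beta t).
Proof.
move=> tT q0; have [s1 _ _ _] := run_sub_sigma t.
have psi0 : 0 <= 2 * expR (- (q ^+ 2 / 2)) by rewrite mulr_ge0 ?expR_ge0.
have e1 := fails_atmost_seq (s := enum 'I_d) psi0
  (fun i _ => direction_event tT (Fmeas_cst_mx s1 (delta_mx i 0)) q0).
have e2 : fails_atmost Pr (T%:R * (2 * expR (- (q ^+ 2 / 2))))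
   (fun w => forall k, (1 <= k <= T)%N -> (k < t)%N ->
      dotv (x k w) (z t w) ^+ 2 <= (q * beta t) ^+ 2 * dotv (x k w) (invmx (V t w) *m x k w)).
  apply: fails_atmost_nat => // k kT; have [kt|kt] := ltnP k t; last first.
    by apply: fails_atmostT.
  have mx : Fmeas_mx (Fpre t) (x k).
    have [_ _ _ i4] := run_filtration k.
    by apply: FmeasS_mx (meas_x k); apply: subset_trans i4 (Fpre_mono kt).
  by apply: fails_atmostW (direction_event tT mx q0) (lexx _) _.
apply: fails_atmostW (fails_atmostI e1 e2) _ _.
  rewrite size_enum_ord -mulrDl -natrD; nra.
move=> w [h1 h2].
have qb : 0 <= q * beta t by rewrite mulr_ge0 ?(ltW (beta_gt0 t)).
have : dotv (z t w) (V t w *m z t w) <= (q * beta t) ^+ 2 * d%:R.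
  apply: gram_directions => //.
    move=> i; have := h1 i (mem_enum _ _).
    have de (v : 'cV[R]_d) : dotv (delta_mx i 0) v = v i 0.
      rewrite dotvE (bigD1 i)//= big1 => [|j ji]; last by rewrite mxE (negbTE ji) mul0r.
      by rewrite mxE !eqxx mul1r addr0.
    rewrite !de; congr (_ <= _ * _); rewrite mxE (bigD1 i)//= big1 => [|j ji]; last first.
      by rewrite mxE (negbTE ji) mulr0.
    by rewrite mxE !eqxx mulr1 addr0.
  move=> k /andP[k1 kt]; apply: h2 => //; rewrite k1.
  by apply: ltnW; apply: leq_trans kt _; case/andP: tT.
rewrite /mnorm => /ler_wsqrtr; rewrite sqrtrM ?sqr_ge0// sqrtr_sqr ger0_norm//.
by rewrite mulrAC.
Qed.

(** * Optimism and the predictable gap *)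

Definition opt_dir (pistar : @policy R _ _ S A) t w := phip pistar - phip (pol t.-1 w).

(** One deviation above the mean from [pi_(t-1)] towards the comparator: under the confidence bound
    this is enough, by duality, for the sample to value that direction at least as much as [thstar]
    does. *)
Definition optimistic pistar t : set Om :=
  [set w | beta t * mnorm (invmx (V t w)) (opt_dir pistar t w)
           <= dotv (opt_dir pistar t w) (z t w)].

Lemma pred_lt t : (1 <= t)%N -> (t.-1 < t)%N.
Proof. by case: t. Qed.

Lemma meas_phip_prev t : (1 <= t)%N -> Fmeas_mx (Fpre t) (fun w => phip (pol t.-1 w)).
Proof. by move=> t1; apply: FmeasS_mx (meas_phip t.-1); exact/Fpol_Fpre/pred_lt. Qed.

Lemma meas_opt_dir pistar t : (1 <= t)%N -> Fmeas_mx (Fpre t) (opt_dir pistar t).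
Proof.
move=> t1; have [s _ _ _] := run_sub_sigma t.
by apply: Fmeas_mxB => //; [exact: Fmeas_cst_mx|exact: meas_phip_prev].
Qed.

Lemma meas_optimistic pistar t : (1 <= t)%N -> Fth t (optimistic pistar t).
Proof.
move=> t1; have [s1 s2 _ _] := run_sub_sigma t; have [i1 _ _ _] := run_filtration t.
have mu := meas_opt_dir pistar t1.
apply: Fmeas_ler => //.
  apply: (Fmeas_realS i1); apply: Fmeas_realZ => //.
  by apply: Fmeas_mnorm => //; exact: meas_Vinv.
apply: Fmeas_dotv => //; first exact: FmeasS_mx mu.
by apply: Fmeas_mxB => //; [exact: meas_thtil|apply: FmeasS_mx i1 _; exact: meas_thhat].
Qed.

(** The Gaussian estimate bounds a strict excess from above; for the opposite direction and
    [q = -1], that excess is exactly the failure of optimism. *)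
Lemma optimism_prob pistar t E : (1 <= t <= T)%N -> Fpre t E ->
  Ex Pr (fun w => \1_E w * normal_p0) <= Ex Pr (fun w => \1_E w * \1_(optimistic pistar t) w).
Proof.
move=> tT FE; have /andP[t1 _] := tT; have [s1 s2 _ _] := run_sub_sigma t.
have mu := meas_opt_dir pistar t1.
have mNu : Fmeas_mx (Fpre t) (fun w => - opt_dir pistar t w).
  by move=> i j; under eq_fun do rewrite mxE; exact: Fmeas_realN.
have mE := sub_sigma_measurable s1 FE.
have mO := sub_sigma_measurable s2 (meas_optimistic pistar t1).
have p1 : 0 <= 1 - normal_p0 :> R by rewrite subr_ge0 normal_p0_lt1.
have := gauss_direction tT mNu p1 normal_anticoncentration FE.
have -> : E `&` [set w | (dotv (- opt_dir pistar t w) (thhat t w) +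
   -1 * (beta t * mnorm (invmx (V t w)) (- opt_dir pistar t w)) <
   dotv (- opt_dir pistar t w) (thtil t w))%R] = E `&` ~` optimistic pistar t.
  congr (_ `&` _); apply/seteqP; split => w; rewrite /optimistic /= mnormN !dotvNl dotvBr.
    by move=> h; apply/negP; rewrite -ltNge; lra.
  by move/negP; rewrite -ltNge => h; lra.
rewrite -[Pr (E `&` _)]fineK ?fin_num_measure//; last by apply: measurableI => //; exact: measurableC.
rewrite -[Pr E]fineK ?fin_num_measure// -EFinM lee_fin.
have bE : bmeas (\1_E : Om -> R) by exact: bmeas_indic.
have bO : bmeas (\1_(optimistic pistar t) : Om -> R) by exact: bmeas_indic.
rewrite -!Ex_indic//; last by apply: measurableI => //; exact: measurableC.
have -> : \1_(E `&` ~` optimistic pistar t) =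
   (fun w => \1_E w - \1_E w * \1_(optimistic pistar t) w) :> (Om -> R).
  apply/funext => w; rewrite !indicE in_setI in_setC.
  by case: (w \in E); case: (w \in _); rewrite /= ?mulr1 ?mulr0 ?subrr ?subr0.
rewrite ExB//; last exact: bmeasM.
have -> : (fun w => \1_E w * normal_p0) = (fun w => normal_p0 * \1_E w) :> (Om -> R).
  by apply/funext => w; rewrite mulrC.
by rewrite ExZ//; lra.
Qed.

(** The exponential supermartingale needs values in a fixed interval. The level [M] will dominate
    the regret of every round, and clipping at 0 only raises an upper bound. *)
Definition clip (M r : R) := Num.min M (Num.max 0 r).

Lemma clip_bounds M r : 0 <= M -> 0 <= clip M r <= M.
Proof.
move=> M0; rewrite /clip ge_min lexx/= andbT le_min M0/= le_max lexx//.
Qed.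

Lemma clip_lip M r s e : r <= s + e -> 0 <= e -> clip M r <= clip M s + e.
Proof.
move=> h e0; rewrite /clip /Num.min /Num.max.
by repeat case: ifPn => //; rewrite ?leNgt; repeat (move=> /negP/negP; rewrite -?leNgt); lra.
Qed.

Lemma clip_le M r e : 0 <= e -> r <= e -> clip M r <= e.
Proof. by move=> e0 h; rewrite /clip ge_min ge_max e0 h orbT. Qed.

(* The supremum over the ellipsoid runs over the rational vectors only, to stay
   measurable; [J] is Lipschitz, so nothing is lost ([gap_ge]). *)
Definition gap_at (c M : R) t n w : R :=
  \1_[set w | mnorm (V t w) (ratvec n - thhat t w) < c * beta t] w *
  clip M (J thstar - J (ratvec n) - dotv (thstar - ratvec n) (phip (pol t.-1 w))).

Definition gap (c M : R) t w : R := sups (fun n => gap_at c M t n w) 0.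

Section gap.
Variables (c M : R).
Hypotheses (c0 : 0 < c) (M0 : 0 < M).

Lemma gap_at_bounds t n w : 0 <= gap_at c M t n w <= M.
Proof.
rewrite /gap_at indicE; case: (w \in _); rewrite ?mul1r ?mul0r ?lexx ?(ltW M0)//.
exact/clip_bounds/ltW.
Qed.

Lemma gap_ubound t w : has_ubound (range (fun n => gap_at c M t n w)).
Proof. by exists M => _ [n _ <-]; have /andP[] := gap_at_bounds t n w. Qed.

Lemma gapE t w : gap c M t w = sup (range (fun n => gap_at c M t n w)).
Proof.
rewrite /gap /sups /=; congr sup.
by apply/seteqP; split => _ [n _ <-]; exists n.
Qed.

Lemma gap_at_le t n w : gap_at c M t n w <= gap c M t w.
Proof. by rewrite gapE; apply: sup_upper_bound; [split; [exists (gap_at c M t 0 w), 0%N|exact: gap_ubound]|exists n]. Qed.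

Lemma gap_le t w e : (forall n, gap_at c M t n w <= e) -> gap c M t w <= e.
Proof.
by move=> h; rewrite gapE; apply: ge_sup; [exists (gap_at c M t 0 w), 0%N|move=> _ [n _ <-]].
Qed.

Lemma gap_bounds t w : 0 <= gap c M t w <= M.
Proof.
apply/andP; split.
  by apply: le_trans (gap_at_le t 0 w); have /andP[] := gap_at_bounds t 0 w.
by apply: gap_le => n; have /andP[] := gap_at_bounds t n w.
Qed.

Lemma meas_gap t : (1 <= t)%N -> Fmeas_real (Fpre t) (gap c M t).
Proof.
move=> t1; have [s _ _ _] := run_sub_sigma t.
apply/(Fmeas_realP _ s); apply: measurable_fun_sups.
  by move=> w _; exact: gap_ubound.
move=> n; apply/(Fmeas_realP _ s); apply: Fmeas_realM => //.
  apply: Fmeas_indic => //; apply: Fmeas_ltr => //; last exact: Fmeas_cst.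
  apply: Fmeas_mnorm => //; first exact: meas_V.
  by apply: Fmeas_mxB => //; [exact: Fmeas_cst_mx|exact: meas_thhat].
have mr : Fmeas_real (Fpre t) (fun w => J thstar - J (ratvec n) -
    dotv (thstar - ratvec n) (phip (pol t.-1 w))).
  apply: Fmeas_realB => //; first exact: Fmeas_cst.
  by apply: Fmeas_dotv => //; [exact: Fmeas_cst_mx|exact: meas_phip_prev].
move/(Fmeas_realP _ s) : mr => mr; apply/(Fmeas_realP _ s).
by apply: measurable_minr => //; exact: measurable_maxr.
Qed.

End gap.

(** [K] may depend on the outcome: it serves only to replace the sample by a nearby rational
    vector. *)
Lemma mnorm_V_le t w : exists2 K, 0 < K & forall u, mnorm (V t w) u <= K * norm2 u.
Proof.
pose Q := lam + \sum_(1 <= k < t) norm2 (x k w) ^+ 2.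
have Q0 : 0 < Q by rewrite ltr_pwDl// sumr_ge0// => k _; exact: sqr_ge0.
exists (Num.sqrt Q); first by rewrite sqrtr_gt0.
move=> u; rewrite -[norm2 u]ger0_norm ?norm2_ge0// -sqrtr_sqr -sqrtrM ?(ltW Q0)//.
rewrite ler_wsqrtr// gram_quad norm2_sqr mulrDl lerD2l mulr_suml.
apply: ler_sum => k _; rewrite -norm2_sqr -exprMn -(real_normK (num_real (dotv _ _))).
by rewrite lerXn2r ?nnegrE ?mulr_ge0 ?norm2_ge0 ?dotv_cauchy.
Qed.

(** The ellipsoid has twice the radius reached by the sample, so that rational vectors close to the
    sample stay strictly inside. *)
Lemma gap_ge c M t w : 0 < c -> 0 < M -> mnorm (V t w) (z t w) <= c * beta t ->
  clip M (J thstar - J (thtil t w) - dotv (thstar - thtil t w) (phip (pol t.-1 w)))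
   <= gap (2 * c) M t w.
Proof.
move=> c0 M0 hz; have [K K0 hK] := mnorm_V_le t w.
have cb0 : 0 < c * beta t by rewrite mulr_gt0 ?beta_gt0.
pose e0 := c * beta t / (2 * K).
have e00 : 0 < e0 by apply: divr_gt0 => //; exact: mulr_gt0.
apply/ler_addgt0Pr => e e_gt0.
have X0 := diameter_ge0.
(* [e0] moves the vector by at most half of [c * beta t] in [V_t]-norm; [e / (X + 1)] changes [J]
   and the linear term by at most [e] together, the 1 covering [X = 0]. *)
pose r := Num.min e0 (e / (X + 1)).
have r0 : 0 < r by rewrite lt_min e00/= divr_gt0// ltr_wpDl.
have [n hn] := ratvec_dense (thtil t w) r0.
apply: le_trans (_ : gap_at (2 * c) M t n w + e <= _); last by rewrite lerD2r gap_at_le// mulr_gt0.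
have -> : gap_at (2 * c) M t n w = clip M (J thstar - J (ratvec n) -
    dotv (thstar - ratvec n) (phip (pol t.-1 w))).
  rewrite /gap_at indicE mem_set ?mul1r//=.
  have -> : ratvec n - thhat t w = (ratvec n - thtil t w) + z t w by rewrite addrA subrK.
  apply: le_lt_trans (mnormD _ _ (V_posdef t w)) _.
  have h1 : mnorm (V t w) (ratvec n - thtil t w) <= c * beta t / 2.
    apply: le_trans (hK _) _; apply: le_trans (ler_wpM2l (ltW K0) hn) _.
    apply: le_trans (_ : K * e0 <= _); first by rewrite ler_pM2l// ge_min lexx.
    by rewrite /e0 le_eqVlt; apply/orP; left; apply/eqP; field; rewrite gt_eqF.
  lra.
apply: clip_lip; last exact: ltW.
have lip := Vstar_lip trajlaw gam01 mphi phiL pi0 (ratvec n) (thtil t w).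
have ip : dotv (ratvec n - thtil t w) (phip (pol t.-1 w)) >= - (norm2 (ratvec n - thtil t w) * (L * H)).
  have := norm_Vpi trajlaw gam01 mphi phiL (ratvec n - thtil t w) (pol t.-1 w).
  by rewrite ler_norml => /andP[].
have small : norm2 (ratvec n - thtil t w) * X <= e.
  have h1 : norm2 (ratvec n - thtil t w) <= e / (X + 1).
    by apply: le_trans hn _; rewrite ge_min lexx orbT.
  apply: le_trans (ler_wpM2r X0 h1) _.
  rewrite mulrAC ler_pdivrMr ?ltr_wpDl// mulrDr mulr1 lerDl ltW//.
move: ip small; rewrite !dotvBl => ip small.
have : norm2 (ratvec n - thtil t w) * X = 2 * (norm2 (ratvec n - thtil t w) * (L * H)) by ring.
lra.
Qed.

Lemma exploration_event pistar c M : 0 < c -> 0 < M ->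
  fails_atmost Pr (del' del) (fun w =>
    normal_p0 * \sum_(1 <= t < T.+1) gap c M t w <=
    2 * \sum_(1 <= t < T.+1) \1_(optimistic pistar t) w * gap c M t w
    + 2 * M * ln (1 / del' del)).
Proof.
move=> c0 M0; have /andP[e0 e1] := failure_share_bounds.
have sF t : sub_sigma (Fpre t) by have [] := run_sub_sigma t.
have inc t : Fpre t `<=` Fpre t.+1 by exact: Fpre_mono.
pose G t w := M^-1 * gap c M t w.
have G01 t w : 0 <= G t w <= 1.
  have /andP[g0 g1] := gap_bounds c M0 t w.
  by rewrite /G mulr_ge0 ?invr_ge0 ?(ltW M0)//= ler_pdivrMl// mulr1.
have mG t : (1 <= t <= T)%N -> Fmeas_real (Fpre t) (G t).
  by move=> /andP[t1 _]; apply: Fmeas_realZ => //; exact: meas_gap.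
have mO t : (1 <= t <= T)%N -> Fmeas_real (Fpre t.+1) (\1_(optimistic pistar t) : Om -> R).
  move=> /andP[t1 _]; apply: Fmeas_indic => //.
  have [_ i2 i3 i4] := run_filtration t.
  exact: (subset_trans i2 (subset_trans i3 i4)) _ (meas_optimistic pistar t1).
have p0 := @normal_p0_gt0 R; have p1 := @normal_p0_lt1 R.
have [||||||E [mE PE hE]] := predictable_sum_concentration (Pr := Pr) (F := Fpre)
  (Y := fun t w => normal_p0 * G t w) (Z := fun t w => \1_(optimistic pistar t) w * G t w)
  (T := T) (del := del' del) sF inc.
- by move=> t tT; apply: Fmeas_realZ => //; exact: mG.
- by move=> t tT; apply: Fmeas_realM => //; [exact: mO|apply: Fmeas_realS (mG t tT)].
- move=> t w _; have /andP[g0 g1] := G01 t w; rewrite mulr_ge0 ?(ltW p0)//=.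
  by rewrite -[leRHS]mulr1 ler_pM ?(ltW p0).
- move=> t w _; rewrite indicE; case: (_ \in _); rewrite ?mul1r ?mul0r ?G01//.
  by rewrite lexx ler01.
- move=> t E tT FE.
  have mE := sub_sigma_measurable (sF t) FE.
  have mo : measurable (optimistic pistar t).
    by have /andP[t1 _] := tT; have [_ s2 _ _] := run_sub_sigma t; exact: sub_sigma_measurable s2 (meas_optimistic pistar t1).
  have -> : (fun w => \1_E w * (normal_p0 * G t w)) = (fun w => (\1_E w * G t w) * normal_p0).
    by apply/funext => w; ring.
  have -> : (fun w => \1_E w * (\1_(optimistic pistar t) w * G t w)) =
            (fun w => (\1_E w * G t w) * \1_(optimistic pistar t) w).
    by apply/funext => w; ring.
  (* The gap is known before the sample, so it joins the weight and leaves only the probability of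
     optimism to compare with [normal_p0]. *)
  apply: (cond_le_extend (F := Fpre t) (M := 1)) => //.
  + exact: bmeas_cst.
  + exact: bmeas_indic.
  + by move=> w; exact: ltW.
  + by apply: Fmeas_realM => //; [exact: Fmeas_indic|exact: mG].
  + move=> w; rewrite indicE; case: (_ \in _); rewrite ?mul1r ?mul0r ?G01//.
    by rewrite lexx ler01.
  + by move=> E' FE'; exact: optimism_prob.
- exact: e0.
exists E; split => // w /hE.
rewrite -!mulr_sumr.
have -> : \sum_(1 <= t < T.+1) \1_(optimistic pistar t) w * G t w =
  M^-1 * \sum_(1 <= t < T.+1) \1_(optimistic pistar t) w * gap c M t w.
  by rewrite mulr_sumr; apply: eq_bigr => t _; rewrite /G mulrCA.
set s1 := \sum_(_ <= _ < _) _; set s2 := \sum_(_ <= _ < _) _; set l := ln _.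
move=> /(ler_wpM2l (ltW M0)).
have -> : M * (normal_p0 * (M^-1 * s1)) = normal_p0 * s1 by field; rewrite gt_eqF.
by have -> : M * (2 * (M^-1 * s2) + 2 * l) = 2 * s2 + 2 * M * l by field; rewrite gt_eqF.
Qed.

(** * Mean feature differences and the potential *)

Lemma feature_mean t i E : (1 <= t <= T)%N -> Fpol t E ->
  Ex Pr (fun w => \1_E w * x t w i 0) = Ex Pr (fun w => \1_E w * D t w i 0).
Proof.
move=> tT FE; have /andP[t1 _] := tT.
have [_ _ s3 s4] := run_sub_sigma t; have [i1 i2 _ _] := run_filtration t.
have [_ [_ [_ [_ [_ [_ [_ [_ [_ [_ [_ [_ [law _]]]]]]]]]]]]] := run.
have bf := bmeas_phi_traj gam01 mphi phiL i.
have mprev C : measurable C -> Fmeas_real (Fpol t) (fun w => fine (trajlaw (pol t.-1 w) C)).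
  move=> mC; apply: Fmeas_realS (meas_kernel t.-1 mC).
  by apply: subset_trans (subset_trans i1 i2); exact/Fpol_Fpre/pred_lt.
have mt C : measurable C -> measurable (tau t @^-1` C) /\ measurable (tau' t @^-1` C).
  by move=> mC; have [h1 h2] := meas_tau t mC; split; exact: (sub_sigma_measurable s4).
have e1 : Ex Pr (fun w => \1_E w * phi_traj phi gam (tau t w) i 0) =
          Ex Pr (fun w => \1_E w * Ex (trajlaw (pol t w)) (fun u => phi_traj phi gam u i 0)).
  apply: (kernel_mean_law (F := Fpol t) (T := tau t) (kap := fun w => trajlaw (pol t w)) s3 _ _ _ bf FE).
  - by move=> C; exact: meas_kernel.
  - by move=> C /mt[].
  (* The marginal law of one trajectory: the event on the other one is taken to be everything. *)
  - move=> E' C FE' mC; have := law t tT E' C setT FE' mC measurableT.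
    rewrite (_ : [set w | C (tau t w) /\ setT (tau' t w)] = tau t @^-1` C); last first.
      by apply/seteqP; split => w /=; [case|].
    by move=> ->; apply: eq_integral => w _; rewrite probability_setT mule1.
have e2 : Ex Pr (fun w => \1_E w * phi_traj phi gam (tau' t w) i 0) =
          Ex Pr (fun w => \1_E w * Ex (trajlaw (pol t.-1 w)) (fun u => phi_traj phi gam u i 0)).
  apply: (kernel_mean_law (F := Fpol t) (T := tau' t) (kap := fun w => trajlaw (pol t.-1 w)) s3 _ _ _ bf FE).
  - by move=> C; exact: mprev.
  - by move=> C /mt[].
  - move=> E' C FE' mC; have := law t tT E' setT C FE' measurableT mC.
    rewrite (_ : [set w | setT (tau t w) /\ C (tau' t w)] = tau' t @^-1` C); last first.
      by apply/seteqP; split => w /=; [case|].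
    by move=> ->; apply: eq_integral => w _; rewrite probability_setT mul1e.
have mE := sub_sigma_measurable s3 FE.
have bE : bmeas (\1_E : Om -> R) by exact: bmeas_indic.
have bc (T' : Om -> traj S A) : (forall C, measurable C -> measurable (T' @^-1` C)) ->
    bmeas (fun w => \1_E w * phi_traj phi gam (T' w) i 0).
  move=> mT'; apply: bmeasM => //; have [mf [N hN]] := bf; split; last by exists N.
  move=> _ Bs mB; rewrite setTI; have := mf measurableT Bs mB; rewrite setTI => m.
  exact: (mT' _ m).
have bk (k : Om -> @policy R _ _ S A) : Fmeas_real (Fpol t) (fun w => phip (k w) i 0) ->
    bmeas (fun w => \1_E w * Ex (trajlaw (k w)) (fun u => phi_traj phi gam u i 0)).
  move=> mk; apply: bmeasM => //; split.
    have -> : (fun w => Ex (trajlaw (k w)) (fun u => phi_traj phi gam u i 0)) =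
      (fun w => phip (k w) i 0) by apply/funext => w; rewrite phi_polE.
    exact: Fmeas_real_measurable mk.
  exists (L * H) => w; rewrite -phi_polE.
  by apply: le_trans (norm2_phi_pol trajlaw gam01 mphi phiL (k w)); exact: ler_norm2_coord.
transitivity (Ex Pr (fun w => \1_E w * phi_traj phi gam (tau t w) i 0) -
              Ex Pr (fun w => \1_E w * phi_traj phi gam (tau' t w) i 0)).
  rewrite -ExB; [|apply: bc => C /mt[]//|apply: bc => C /mt[]//].
  by congr (Ex _ _); apply/funext => w; rewrite !mxE mulrBr.
rewrite e1 e2 -ExB; [|apply: bk|apply: bk].
- by congr (Ex _ _); apply/funext => w; rewrite -!phi_polE !mxE mulrBr.
- exact: meas_phip.
- by apply: (FmeasS_mx (subset_trans i1 i2)); exact: meas_phip_prev.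
Qed.

(** A convex quadratic form lies above its tangent at [u]. The tangent is affine in [v], so its mean
    needs nothing but the mean of [v]: this is how Jensen's inequality is obtained on events. *)
Lemma posdef_tangent (Q : 'M[R]_d) u v : posdef Q ->
  2 * dotv (Q *m u) v - dotv u (Q *m u) <= dotv v (Q *m v).
Proof.
move=> pQ; have := posdef_ge0 (v - u) pQ.
rewrite mulmxBr dotvBl !dotvBr (posdef_dotC u v pQ) (dotvC (Q *m u) v); lra.
Qed.

Local Notation N := (1 + X ^+ 2 / lam).

Lemma inv_quad_bounds t w u : norm2 u <= X ->
  0 <= dotv u (invmx (V t w) *m u) <= N.
Proof.
move=> uX; rewrite posdef_ge0/=; last exact/posdef_inv/V_posdef.
apply: le_trans (gram_inv_le _ lam0 _ _) _.
rewrite -norm2_sqr ler_wpDl// ler_pM2r ?invr_gt0//.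
by rewrite lerXn2r ?nnegrE ?norm2_ge0 ?diameter_ge0.
Qed.

Lemma jensen_step t E : (1 <= t <= T)%N -> Fpol t E ->
  Ex Pr (fun w => \1_E w * dotv (D t w) (invmx (V t w) *m D t w)) <=
  Ex Pr (fun w => \1_E w * dotv (x t w) (invmx (V t w) *m x t w)).
Proof.
move=> tT FE; have /andP[t1 _] := tT.
have [s1 s2 s3 s4] := run_sub_sigma t; have [i1 i2 i3 _] := run_filtration t.
have mE := sub_sigma_measurable s3 FE.
have bE : bmeas (\1_E : Om -> R) by exact: bmeas_indic.
have mD : Fmeas_mx (Fpol t) (fun w => D t w).
  apply: Fmeas_mxB => //; first exact: meas_phip.
  by apply: (FmeasS_mx (subset_trans i1 i2)); exact: meas_phip_prev.
have mI : Fmeas_mx (Fpol t) (fun w => invmx (V t w)).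
  by apply: (FmeasS_mx (subset_trans i1 i2)); exact: meas_Vinv.
have mID : Fmeas_mx (Fpol t) (fun w => invmx (V t w) *m D t w) by exact: Fmeas_mulmx.
(* For [v = V^-1 u], [lam |v|^2 <= <v, V v> = <u, v>] bounds the slope of the tangent by [X / lam],
   so that it can serve as a random weight. *)
have bID i : exists M, forall w, `|(invmx (V t w) *m D t w) i 0| <= M.
  exists (X / lam) => w; apply: le_trans (ler_norm2_coord _ i) _.
  set u := D t w; set v := invmx (V t w) *m u.
  have h1 : lam * dotv v v <= dotv u v.
    have -> : dotv u v = dotv v (V t w *m v).
      by rewrite /v mulKVmx; [exact: dotvC|exact/posdef_unit/V_posdef].
    by rewrite gram_quad lerDl sumr_ge0// => k _; exact: sqr_ge0.
  have h2 : dotv u v <= norm2 u * norm2 v by exact: dotv_le.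
  have [->|v0] := eqVneq (norm2 v) 0; first by rewrite divr_ge0 ?diameter_ge0 ?ltW.
  have vp : 0 < norm2 v by rewrite lt_neqAle eq_sym v0 norm2_ge0.
  rewrite ler_pdivlMr// -(ler_pM2r vp).
  apply: le_trans (_ : norm2 u * norm2 v <= _).
    by apply: le_trans h2; apply: le_trans h1; rewrite -norm2_sqr mulrAC -expr2 mulrC.
  by rewrite ler_pM2r// norm2_D.
have bW i : bmeas (fun w => \1_E w * (invmx (V t w) *m D t w) i 0).
  apply: bmeasM => //; split; last exact: bID.
  exact: Fmeas_real_measurable (mID i 0).
have bx i : bmeas (fun w => x t w i 0).
  split; first exact: Fmeas_real_measurable s4 (meas_x t i 0).
  by exists X => w; apply: le_trans (norm2_x t w); exact: ler_norm2_coord.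
have bD i : bmeas (fun w => D t w i 0).
  split; first exact: Fmeas_real_measurable s3 (mD i 0).
  by exists X => w; apply: le_trans (norm2_D t w); exact: ler_norm2_coord.
have coord i : Ex Pr (fun w => \1_E w * (invmx (V t w) *m D t w) i 0 * x t w i 0) =
               Ex Pr (fun w => \1_E w * (invmx (V t w) *m D t w) i 0 * D t w i 0).
  apply: (cond_eq_extend s3) => //.
  - by apply: Fmeas_realM => //; exact: Fmeas_indic.
  - by have [_] := bW i.
  - by move=> E' FE'; exact: feature_mean.
have dotE (u : Om -> 'cV[R]_d) :
   (fun w => \1_E w * dotv (invmx (V t w) *m D t w) (u w)) =
   (fun w => \sum_i (\1_E w * (invmx (V t w) *m D t w) i 0 * u w i 0)).
  by apply/funext => w; rewrite dotvE mulr_sumr; apply: eq_bigr => i _; rewrite mulrA.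
have mean : Ex Pr (fun w => \1_E w * dotv (invmx (V t w) *m D t w) (x t w)) =
            Ex Pr (fun w => \1_E w * dotv (invmx (V t w) *m D t w) (D t w)).
  rewrite !dotE !Ex_sum; try by move=> i; exact: bmeasM.
  by apply: eq_bigr => i _; exact: coord.
have bdx : bmeas (fun w => \1_E w * dotv (invmx (V t w) *m D t w) (x t w)).
  by rewrite dotE; apply: bmeas_sum => i; exact: bmeasM.
have bdD : bmeas (fun w => \1_E w * dotv (invmx (V t w) *m D t w) (D t w)).
  by rewrite dotE; apply: bmeas_sum => i; exact: bmeasM.
have bxx : bmeas (fun w => \1_E w * dotv (x t w) (invmx (V t w) *m x t w)).
  apply: bmeasM => //; apply: bounded_bmeas (fun w => inv_quad_bounds t w (norm2_x t w)).
  apply: (Fmeas_real_measurable s4); apply: Fmeas_dotv => //; first exact: meas_x.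
  by apply: Fmeas_mulmx => //; [exact: FmeasS_mx mI|exact: meas_x].
have b2 := bmeasM (bmeas_cst 2) bdx.
have -> : (fun w => \1_E w * dotv (D t w) (invmx (V t w) *m D t w)) =
          (fun w => \1_E w * dotv (invmx (V t w) *m D t w) (D t w)).
  by apply/funext => w; rewrite dotvC.
(* The slope is [Fpol t]-measurable and [x_t] has mean [D_t] on its events, so the tangent at [D_t],
   evaluated at [x_t], has the same mean as the form at [D_t]. *)
have -> : Ex Pr (fun w => \1_E w * dotv (invmx (V t w) *m D t w) (D t w)) =
  Ex Pr (fun w => 2 * (\1_E w * dotv (invmx (V t w) *m D t w) (x t w)) -
                  \1_E w * dotv (invmx (V t w) *m D t w) (D t w)).
  rewrite (ExB _ b2 bdD) (ExZ _ _ bdx) mean; ring.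
apply: (le_Ex _ (bmeasB b2 bdD) bxx).
move=> w; rewrite mulrCA -mulrBr ler_wpM2l//.
have := posdef_tangent (D t w) (x t w) (posdef_inv (V_posdef t w)).
by rewrite (dotvC (D t w) (invmx _ *m D t w)).
Qed.

(** Here predictable refers to [Fpol t]: the policies of the round are known, its trajectories are
    not. Dividing by [N] puts the quadratic forms in [[0, 1]]. *)
Lemma potential_event : fails_atmost Pr (del' del) (fun w =>
    \sum_(1 <= t < T.+1) dotv (D t w) (invmx (V t w) *m D t w) <=
    2 * (N * (d%:R * ln (1 + T%:R * (X ^+ 2 / lam)))) + 2 * N * ln (1 / del' del)).
Proof.
have /andP[e0 e1] := failure_share_bounds.
have N0 : 0 < N by rewrite ltr_pwDl// divr_ge0 ?sqr_ge0 ?ltW.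
have sF t : sub_sigma (Fpol t) by have [] := run_sub_sigma t.
have inc t : Fpol t `<=` Fpol t.+1.
  have [i1 i2 _ _] := run_filtration t.+1.
  by apply: subset_trans (subset_trans i1 i2); exact: Fpol_Fpre.
have scale u t w : norm2 u <= X -> 0 <= N^-1 * dotv u (invmx (V t w) *m u) <= 1.
  move=> /(inv_quad_bounds t w) /andP[h0 h1].
  by rewrite mulr_ge0 ?invr_ge0 ?(ltW N0)//= ler_pdivrMl// mulr1.
have [||||||E [mE PE hE]] := predictable_sum_concentration (Pr := Pr) (F := Fpol)
  (Y := fun t w => N^-1 * dotv (D t w) (invmx (V t w) *m D t w))
  (Z := fun t w => N^-1 * dotv (x t w) (invmx (V t w) *m x t w))
  (T := T) (del := del' del) sF inc.
- move=> t /andP[t1 _]; have [i1 i2 _ _] := run_filtration t.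
  have mD : Fmeas_mx (Fpol t) (fun w => D t w).
    apply: Fmeas_mxB => //; first exact: meas_phip.
    by apply: (FmeasS_mx (subset_trans i1 i2)); exact: meas_phip_prev.
  apply: Fmeas_realZ => //; apply: Fmeas_dotv => //; apply: Fmeas_mulmx => //.
  by apply: (FmeasS_mx (subset_trans i1 i2)); exact: meas_Vinv.
- move=> t /andP[t1 _]; have [_ _ _ i4] := run_filtration t; have [i1 i2 _ _] := run_filtration t.+1.
  have mx : Fmeas_mx (Fpol t.+1) (x t).
    by apply: FmeasS_mx (meas_x t); exact: subset_trans i4 (subset_trans i1 i2).
  apply: Fmeas_realZ => //; apply: Fmeas_dotv => //; apply: Fmeas_mulmx => //.
  apply: FmeasS_mx (meas_Vinv t); apply: subset_trans (subset_trans i1 i2).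
  exact: Fpre_mono.
- by move=> t w _; apply: scale; exact: norm2_D.
- by move=> t w _; apply: scale; exact: norm2_x.
- move=> t E tT FE.
  have [_ _ s3 s4] := run_sub_sigma t; have mE := sub_sigma_measurable s3 FE.
  have bE : bmeas (\1_E : Om -> R) by exact: bmeas_indic.
  have [i1 i2 i3 _] := run_filtration t; have /andP[t1 _] := tT.
  have mI F : Fpol t `<=` F -> Fmeas_mx F (fun w => invmx (V t w)).
    by move=> h; apply: FmeasS_mx (meas_Vinv t); exact: subset_trans (subset_trans i1 i2) h.
  have mD : Fmeas_mx (Fpol t) (fun w => D t w).
    apply: Fmeas_mxB => //; first exact: meas_phip.
    by apply: (FmeasS_mx (subset_trans i1 i2)); exact: meas_phip_prev.
  have bD : bmeas (fun w => dotv (D t w) (invmx (V t w) *m D t w)).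
    apply: bounded_bmeas (fun w => inv_quad_bounds t w (norm2_D t w)).
    apply: (Fmeas_real_measurable s3); apply: Fmeas_dotv => //; apply: Fmeas_mulmx => //.
    exact: mI.
  have bx : bmeas (fun w => dotv (x t w) (invmx (V t w) *m x t w)).
    apply: bounded_bmeas (fun w => inv_quad_bounds t w (norm2_x t w)).
    apply: (Fmeas_real_measurable s4); apply: Fmeas_dotv => //; first exact: meas_x.
    by apply: Fmeas_mulmx => //; [exact: mI|exact: meas_x].
  have pull (f : Om -> R) : bmeas f ->
      Ex Pr (fun w => \1_E w * (N^-1 * f w)) = N^-1 * Ex Pr (fun w => \1_E w * f w).
    move=> bf; rewrite -ExZ; last exact: bmeasM.
    by congr (Ex _ _); apply/funext => w; rewrite mulrCA.
  by rewrite (pull _ bD) (pull _ bx) ler_pM2l ?invr_gt0// jensen_step.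
- exact: e0.
exists E; split => // w /hE; rewrite -!mulr_sumr => h.
have hx k : dotv (x k w) (x k w) <= X ^+ 2.
  by rewrite -norm2_sqr lerXn2r ?nnegrE ?norm2_ge0 ?diameter_ge0 ?norm2_x.
have ep := elliptical_potential lam0 hx T (sqr_ge0 X).
move: h ep; set s1 := \sum_(_ <= _ < _) _; set s2 := \sum_(_ <= _ < _) _; set l := ln (1 / _).
move=> h ep.
have := ler_wpM2l (ltW N0) h.
have -> : N * (N^-1 * s1) = s1 by rewrite mulrA divff ?mul1r// gt_eqF.
have -> : N * (2 * (N^-1 * s2) + 2 * l) = 2 * s2 + 2 * N * l.
  by rewrite mulrDr; congr (_ + _); [rewrite mulrCA (mulrA N) divff ?mul1r// gt_eqF|ring].
move=> /le_trans; apply; rewrite lerD2r ler_pM2l//.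
Qed.

(** Optimism replaces [thstar] by the sample along the comparator direction, and the oracle replaces
    the comparator by [pi_t]. What remains is [<thtil - q, D_t>] for [q] in the ellipsoid, whose
    [V_t]-norm factor is at most [c + 2 c] radii; the two [eps] come from the comparator and the
    oracle. *)
Lemma gap_optimistic_le pistar t w c M eps : 0 < c -> 0 < M -> 0 <= eps ->
  J thstar - eps <= Vpi thstar pistar ->
  mnorm (V t w) (thstar - thhat t w) <= beta t ->
  mnorm (V t w) (z t w) <= c * beta t ->
  J (thtil t w) - Vpi (thtil t w) (pol t w) <= eps ->
  optimistic pistar t w ->
  gap (2 * c) M t w <= 2 * eps + 3 * c * beta t * mnorm (invmx (V t w)) (D t w).
Proof.
move=> c0 M0 eps0 star conf samp pac opt.
set b := mnorm _ (D t w).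
have b0 : 0 <= b by exact: sqrtr_ge0.
have e0 : 0 <= 2 * eps + 3 * c * beta t * b.
  by rewrite addr_ge0// ?mulr_ge0// ?(ltW c0)// ltW// beta_gt0.
apply: gap_le => // n; rewrite /gap_at indicE.
case: (boolP (w \in _)) => [/set_mem/= ell|_]; last by rewrite mul0r.
rewrite mul1r; apply: clip_le => //.
set q := ratvec n in ell *.
have Jq := Vpi_le_Vstar trajlaw gam01 mphi phiL pi0 q (pol t w).
have Jt := Vpi_le_Vstar trajlaw gam01 mphi phiL pi0 (thtil t w) pistar.
have dual (u v : 'cV[R]_d) : dotv u v <= mnorm (V t w) u * mnorm (invmx (V t w)) v.
  by apply: le_trans (ler_norm _) _; apply: mnorm_dual; exact: V_posdef.
have h1 : dotv (thstar - thhat t w) (opt_dir pistar t w) <=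
    beta t * mnorm (invmx (V t w)) (opt_dir pistar t w).
  by apply: le_trans (dual _ _) _; rewrite ler_wpM2r ?mnorm_ge0.
have h2 : dotv (thtil t w - q) (D t w) <= 3 * c * beta t * b.
  apply: le_trans (dual _ _) _; rewrite ler_wpM2r//.
  have -> : thtil t w - q = z t w - (q - thhat t w) by rewrite opprB addrA subrK.
  apply: le_trans (mnormD _ _ (V_posdef t w)) _; rewrite mnormN.
  by have := ltW ell; lra.
move: opt; rewrite /optimistic/= dotvC => opt.
move: h1 h2 star pac Jq Jt opt; rewrite /Defs.Vpi /opt_dir !dotvBl !dotvBr.
set m := mnorm _ _.
move: (beta t * m) (3 * c * beta t * b) => bm cb; lra.
Qed.

Definition instant_regret t w := J thstar - Vpi thstar (pol t w).

Lemma instant_regret_bounds t w : 0 <= instant_regret t w <= B * X.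
Proof.
rewrite /instant_regret subr_ge0 (Vpi_le_Vstar trajlaw gam01 mphi phiL pi0)/=.
have h1 := Vstar_bound trajlaw gam01 mphi phiL pi0 thstar.
have h2 := norm_Vpi trajlaw gam01 mphi phiL thstar (pol t w).
have h3 : norm2 thstar * (L * H) <= B * (L * H).
  by rewrite ler_wpM2r// mulr_ge0 ?(feature_bound_ge0 phiL)// ltW// Hgam_gt0.
move: h2; rewrite ler_norml => /andP[h2 _].
have -> : B * X = B * (L * H) + B * (L * H) by ring.
lra.
Qed.

Lemma instant_regret_le t w c M eps : 0 < c -> B * X <= M -> 0 < M -> 0 <= eps ->
  mnorm (V t w) (thstar - thhat t w) <= beta t ->
  mnorm (V t w) (z t w) <= c * beta t ->
  J (thtil t w) - Vpi (thtil t w) (pol t w) <= eps ->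
  instant_regret t w <= gap (2 * c) M t w + eps + (c + 1) * beta t * mnorm (invmx (V t w)) (D t w).
Proof.
move=> c0 BM M0 eps0 conf samp pac.
have g := gap_ge c0 M0 samp.
set b := mnorm _ (D t w).
have b0 : 0 <= b by exact: sqrtr_ge0.
have rM : instant_regret t w <= M.
  by apply: le_trans BM; have /andP[] := instant_regret_bounds t w.
(* From the sample to [thstar] through the estimate: [c] radii, then one. *)
have dual : dotv (thtil t w - thstar) (D t w) <= (c + 1) * beta t * b.
  apply: le_trans (ler_norm _) _; apply: le_trans (mnorm_dual _ _ (V_posdef t w)) _.
  rewrite ler_wpM2r//.
  have -> : thtil t w - thstar = z t w - (thstar - thhat t w) by rewrite opprB addrA subrK.
  apply: le_trans (mnormD _ _ (V_posdef t w)) _; rewrite mnormN; lra.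
have e0 : 0 <= (c + 1) * beta t * b.
  by rewrite !mulr_ge0// ?addr_ge0// ?(ltW c0)// ltW// beta_gt0.
set Y := J thstar - J (thtil t w) - _ in g.
have rY : instant_regret t w <= Y + eps + (c + 1) * beta t * b.
  move: dual pac; rewrite /Y /instant_regret /Defs.Vpi !dotvBr !dotvBl.
  lra.
(* Clipping is harmless: the regret is at most [M], and it is below [Y] plus the same non-negative
   terms. *)
have : instant_regret t w <= clip M Y + eps + (c + 1) * beta t * b.
  move: rM rY; rewrite /clip /Num.min /Num.max.
  by repeat case: ifPn => //; rewrite ?leNgt; repeat (move=> /negP/negP; rewrite -?leNgt); lra.
lra.
Qed.

(** The second policy of a round is the first one of the round before, so its regrets are a shift of
    the same sum and only that of [pi_0] is new. *)
Lemma regret_le_sum w : regret trajlaw phi gam thstar T pol w <=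
  \sum_(1 <= t < T.+1) instant_regret t w + B * X.
Proof.
have r0 t : 0 <= instant_regret t w by have /andP[] := instant_regret_bounds t w.
rewrite /regret.
have -> : \sum_(1 <= t < T.+1) (2 * J thstar - Vpi thstar (pol t w) - Vpi thstar (pol t.-1 w)) =
  \sum_(1 <= t < T.+1) instant_regret t w + \sum_(1 <= t < T.+1) instant_regret t.-1 w.
  by rewrite -big_split/=; apply: eq_bigr => t _; rewrite /instant_regret; ring.
have h : \sum_(1 <= t < T.+1) instant_regret t.-1 w <=
    instant_regret 0 w + \sum_(1 <= t < T.+1) instant_regret t w.
  rewrite big_add1/= -(big_ltn (F := fun t => instant_regret t w))//.
  by rewrite big_nat_recr//= lerDl.
have /andP[_ h0] := instant_regret_bounds 0 w.
have /andP[h1 _] := instant_regret_bounds 0 w.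
lra.
Qed.

Lemma sum_le_sqrt (b : nat -> R) : (forall t, 0 <= b t) ->
  \sum_(1 <= t < T.+1) b t <= Num.sqrt (T%:R * \sum_(1 <= t < T.+1) b t ^+ 2).
Proof.
move=> b0; rewrite !big_add1/= !big_mkord.
have := dotv_le (\col_(i < T) 1) (\col_(i < T) b i.+1).
rewrite dotvE /norm2 !dotvE.
have -> : \sum_(i < T) (\col_(i < T) 1 : 'cV[R]_T) i 0 * (\col_(i < T) b i.+1) i 0 = \sum_(i < T) b i.+1.
  by apply: eq_bigr => i _; rewrite !mxE mul1r.
have -> : \sum_(i < T) (\col_(i < T) 1 : 'cV[R]_T) i 0 * (\col_(i < T) 1) i 0 = T%:R.
  by under eq_bigr do rewrite !mxE mul1r; rewrite sumr_const card_ord.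
have -> : \sum_(i < T) (\col_(i < T) b i.+1 : 'cV[R]_T) i 0 * (\col_(i < T) b i.+1) i 0 = \sum_(i < T) b i.+1 ^+ 2.
  by apply: eq_bigr => i _; rewrite !mxE expr2.
by rewrite -sqrtrM.
Qed.

Lemma regret_event q bbar : (1 <= T)%N -> (1 <= d)%N -> 0 < q ->
  T%:R * (2 * (d + T)%:R * expR (- (q ^+ 2 / 2))) <= del' del ->
  (forall t, (1 <= t <= T)%N -> beta t <= bbar) ->
  fails_atmost Pr del (fun w =>
    let M := B * X + 1 in let l := ln (1 / del' del) in
    let c := q * Num.sqrt d%:R in let eps := eps_T T in
    let Sb := Num.sqrt (T%:R * (2 * (N * (d%:R * ln (1 + T%:R * (X ^+ 2 / lam)))) + 2 * N * l)) in
    let r := regret trajlaw phi gam thstar T pol w in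
    r <= M * T%:R + M /\
    r <= normal_p0^-1 * (2 * (T%:R * (2 * eps) + 3 * c * bbar * Sb) + 2 * M * l)
         + T%:R * eps + (c + 1) * bbar * Sb + M).
Proof.
move=> T1 d1 q0 hq hb.
(* [B * X] bounds the regret of a round; the added 1 keeps the clipping level positive. *)
set M := B * X + 1; set c := q * Num.sqrt d%:R; set eps := eps_T T; set l := ln _.
have BX0 : 0 <= B * X by rewrite mulr_ge0 ?radius_ge0 ?diameter_ge0.
have M0 : 0 < M by rewrite ltr_wpDl.
have BM : B * X <= M by rewrite lerDl.
have c0 : 0 < c by rewrite mulr_gt0// sqrtr_gt0 ltr0n.
have eps0 : 0 < eps by rewrite invr_gt0 sqrtr_gt0 ltr0n.
have [pistar /ltW star] := Vstar_approx trajlaw gam01 mphi phiL pi0 thstar eps0.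
have psi0 : 0 <= 2 * (d + T)%:R * expR (- (q ^+ 2 / 2)) by rewrite !mulr_ge0 ?expR_ge0.
have Ez := fails_atmost_nat psi0 (fun t tT => sample_event tT (ltW q0)).
have c20 : 0 < 2 * c by rewrite mulr_gt0.
(* Confidence, oracle, sample width, exploration and potential each use [delta / 5]. *)
have good := fails_atmostI confidence_event (fails_atmostI (pac_event T1) (fails_atmostI Ez
  (fails_atmostI (exploration_event pistar c20 M0) potential_event))).
apply: (fails_atmostW good) => [|w [conf [pac [samp [expl pot]]]]].
  by move: hq; rewrite /del'; lra.
have p0 := @normal_p0_gt0 R.
set b := fun t => mnorm (invmx (V t w)) (D t w).
have b0 t : 0 <= b t by exact: sqrtr_ge0.
cbv zeta; rewrite -/M -/l -/c -/eps.
set Sb := Num.sqrt (T%:R * _).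
have hSb : \sum_(1 <= t < T.+1) b t <= Sb.
  apply: le_trans (sum_le_sqrt b0) _; apply: ler_wsqrtr; rewrite ler_wpM2l//.
  apply: le_trans pot; apply: ler_sum => t _; rewrite /b sqr_sqrtr//.
  exact/posdef_ge0/posdef_inv/V_posdef.
have Sb0 : 0 <= Sb by exact: sqrtr_ge0.
have bbar0 : 0 <= bbar.
  by apply: le_trans (hb 1%N _); [exact/ltW/beta_gt0|rewrite T1].
have rsum := regret_le_sum w.
split.
  apply: le_trans rsum _; apply: lerD => //.
  apply: (@le_trans _ _ (\sum_(1 <= t < T.+1) M)).
    apply: ler_sum => t _; apply: le_trans BM; by have /andP[] := instant_regret_bounds t w.
  by rewrite sumr_const_nat subSS subn0 (mulr_natr M).
set G := \sum_(1 <= t < T.+1) gap (2 * c) M t w in expl.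
have range (f g : nat -> R) : (forall t, (1 <= t <= T)%N -> f t <= g t) ->
    \sum_(1 <= t < T.+1) f t <= \sum_(1 <= t < T.+1) g t.
  by move=> h; rewrite big_nat_cond [leRHS]big_nat_cond; apply: ler_sum => t; rewrite andbT ltnS => /h.
have cst (a : R) : \sum_(1 <= t < T.+1) a = T%:R * a.
  by rewrite sumr_const_nat subSS subn0 (mulr_natl a).
have hO : \sum_(1 <= t < T.+1) \1_(optimistic pistar t) w * gap (2 * c) M t w <=
    T%:R * (2 * eps) + 3 * c * bbar * Sb.
  apply: (@le_trans _ _ (\sum_(1 <= t < T.+1) (2 * eps + 3 * c * bbar * b t))).
    apply: range => t tT; rewrite indicE.
    have e0 : 0 <= 2 * eps + 3 * c * bbar * b t.
      by rewrite addr_ge0 ?mulr_ge0// ltW.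
    case: (boolP (w \in _)) => [/set_mem opt|_]; last by rewrite mul0r.
    rewrite mul1r.
    apply: le_trans (gap_optimistic_le c0 M0 (ltW eps0) star (conf t tT) (samp t tT) (pac t tT) opt) _.
    rewrite lerD2l ler_wpM2r ?b0// ler_wpM2l ?hb// mulr_ge0// ltW//.
  rewrite big_split/= cst lerD2l -mulr_sumr ler_wpM2l//.
  by rewrite mulr_ge0// mulr_ge0// ltW.
have hG : G <= normal_p0^-1 * (2 * (T%:R * (2 * eps) + 3 * c * bbar * Sb) + 2 * M * l).
  rewrite ler_pdivlMl//; apply: le_trans expl _.
  by rewrite lerD2r ler_pM2l.
apply: le_trans rsum _; apply: lerD => //.
apply: (@le_trans _ _ (\sum_(1 <= t < T.+1) (gap (2 * c) M t w + (eps + (c + 1) * bbar * b t)))).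
  apply: range => t tT.
  apply: le_trans (instant_regret_le c0 BM M0 (ltW eps0) (conf t tT) (samp t tT) (pac t tT)) _.
  rewrite -addrA lerD2l lerD2l ler_wpM2r ?b0// ler_wpM2l ?hb//.
  by rewrite addr_ge0// ltW.
rewrite big_split/= -/G big_split/= cst -mulr_sumr -addrA lerD// lerD2l ler_wpM2l//.
by rewrite mulr_ge0// addr_ge0// ltW.
Qed.

End run_analysis.

(** * The rate *)

Section constants.
Context {R : realType}.
Variables (B L gam lam C0 : R).
Hypotheses (gam01 : 0 < gam < 1) (lam0 : 0 < lam) (C01 : 1 <= C0) (B0 : 0 <= B) (L0 : 0 <= L).
Local Notation H := (Hgam gam).
Local Notation X := (2 * L * H).

(** In units of [ln (dT/delta)], the term [ln (1 / del')] costs [1 + ln 5], and the logarithm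
    growing with the round costs 2 plus that of [Num.max 1 _]. *)
Definition beta_const : R :=
  C0 * (3 + ln 5 + ln (Num.max 1 (4 * expR 1 * B * L * H)) + lam * B ^+ 2).

Definition width_const : R := 1 + X ^+ 2 / lam.

Definition potential_const : R := 2 * width_const * (2 + ln 5 + ln width_const).

(** [W] is the constant of width times radius times potential sum, 14 coming from the squared width
    [14 l]. The inverse of [normal_p0] is the price of bounding all gaps by those of the optimistic
    rounds. *)
Definition regret_const : R :=
  let M := B * X + 1 in
  let W := Num.sqrt (14 * beta_const * potential_const) in
  2 * M + normal_p0^-1 * (2 * (2 + 3 * W) + 2 * M * (1 + ln 5)) + 1 + 2 * W + M.

Let ln5 : 0 <= ln 5 :> R. Proof. by rewrite ln_ge0// ler1n. Qed.

Let X0 : 0 <= X.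
Proof. by rewrite !mulr_ge0// ltW// (Hgam_gt0 gam01). Qed.

Let width1 : 1 <= width_const.
Proof. by rewrite lerDl divr_ge0 ?sqr_ge0 ?ltW. Qed.

Let max1 (a : R) : 1 <= Num.max 1 a. Proof. by rewrite le_max lexx. Qed.

Let beta_const_ge0 : 0 <= beta_const.
Proof.
have h := ln_ge0 (max1 (4 * expR 1 * B * L * H)).
have h2 : 0 <= lam * B ^+ 2 by rewrite mulr_ge0 ?sqr_ge0 ?ltW.
by rewrite mulr_ge0 ?(le_trans ler01 C01)//; have := ln5; lra.
Qed.

Let potential_const_ge0 : 0 <= potential_const.
Proof.
have h := ln_ge0 width1.
by rewrite mulr_ge0 ?mulr_ge0// ?(le_trans ler01 width1)//; have := ln5; lra.
Qed.

Let M_ge0 : 0 <= B * X + 1.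
Proof. by rewrite addr_ge0// mulr_ge0. Qed.

Lemma regret_const_ge0 : 0 <= regret_const.
Proof.
have p0 := @normal_p0_gt0 R; rewrite /regret_const.
have W0 := sqrtr_ge0 (14 * beta_const * potential_const).
set W := Num.sqrt _ in W0 *; have M0 := M_ge0; set M := B * X + 1 in M0 *.
have h1 : 0 <= M * ln 5 by rewrite mulr_ge0.
have : 0 <= normal_p0^-1 * (2 * (2 + 3 * W) + 2 * M * (1 + ln 5)).
  by rewrite mulr_ge0 ?invr_ge0 ?(ltW p0)//; lra.
cbv zeta; lra.
Qed.

Section bounds.
Variables (d T : nat) (del : R).
Hypotheses (del01 : 0 < del < 1) (hl : expR 1 <= d%:R * T%:R / del).
Local Notation l := (ln (d%:R * T%:R / del)).
Local Notation kap := (kappa d B L gam).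

Let u_gt0 : 0 < d%:R * T%:R / del.
Proof. exact: lt_le_trans (expR_gt0 1) hl. Qed.

Lemma log_ge1 : 1 <= l.
Proof. by rewrite -[leLHS](expRK 1) ler_ln ?posrE ?expR_gt0 ?u_gt0. Qed.

Lemma dim_gt0 : (1 <= d)%N.
Proof. by rewrite lt0n; apply: contraTneq u_gt0 => ->; rewrite mulr0n !mul0r ltxx. Qed.

Lemma horizon_gt0 : (1 <= T)%N.
Proof. by rewrite lt0n; apply: contraTneq u_gt0 => ->; rewrite mulr0n mulr0 mul0r ltxx. Qed.

Let d1 : 1 <= d%:R :> R. Proof. by rewrite ler1n dim_gt0. Qed.
Let T1 : 1 <= T%:R :> R. Proof. by rewrite ler1n horizon_gt0. Qed.

Let T_le : T%:R <= d%:R * T%:R / del.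
Proof.
have /andP[h0 h1] := del01; rewrite ler_pdivlMr//.
have a : 0 <= (1 - del) * T%:R by rewrite mulr_ge0// subr_ge0 ltW.
have b : 0 <= (d%:R - 1) * T%:R :> R by rewrite mulr_ge0// subr_ge0 d1.
lra.
Qed.

Let lnT : ln T%:R <= l.
Proof. by rewrite ler_ln ?posrE// (lt_le_trans ltr01 T1). Qed.

Lemma log_del' : ln (1 / del' del) <= (1 + ln 5) * l.
Proof.
have /andP[h0 h1] := del01.
have -> : 1 / del' del = 5 * (1 / del) by rewrite /del' ; field; rewrite gt_eqF.
rewrite lnM ?posrE ?divr_gt0// mulrDl [leLHS]addrC.
have h : ln (1 / del) <= l.
  rewrite ler_ln ?posrE ?u_gt0 ?divr_gt0// ler_pM2r ?invr_gt0//.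
  by apply: le_trans T1 _; rewrite ler_peMl// d1.
have h2 : ln 5 <= ln 5 * l :> R by rewrite ler_peMr ?log_ge1.
by rewrite [1 * l]mul1r lerD.
Qed.

Let kap1 : 1 <= kap. Proof. exact: kappa_ge1. Qed.

Lemma beta_bound t : (1 <= t <= T)%N ->
  beta_t (d := d) gam B L lam C0 del t <= Num.sqrt (beta_const * (kap * (d%:R * l))).
Proof.
move=> /andP[t1 tT]; apply: ler_wsqrtr; rewrite /beta_const -[leRHS]mulrA ler_pM2l ?(lt_le_trans ltr01)//.
set c1 := 4 * expR 1 * B * L * H.
have c10 : 0 <= c1.
  by rewrite !mulr_ge0 ?expR_ge0// ltW// (Hgam_gt0 gam01).
have h1 : ln (Num.max (expR 1) (c1 * t.-1%:R / d%:R)) <= (2 + ln (Num.max 1 c1)) * l.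
  have m0 : 0 < Num.max 1 c1 by rewrite (lt_le_trans ltr01 (max1 _)).
  have T0 : 0 < T%:R :> R by rewrite (lt_le_trans ltr01 T1).
  have e1 : 1 <= expR 1 :> R by have := expR_ge1Dx (1 : R); lra.
  apply: (@le_trans _ _ (ln (expR 1 * (Num.max 1 c1 * T%:R)))).
    rewrite ler_ln ?posrE ?mulr_gt0 ?expR_gt0// ?lt_max ?expR_gt0//.
    rewrite ge_max; apply/andP; split.
      rewrite ler_peMr ?expR_ge0//.
      by rewrite -[leLHS]mulr1 ler_pM ?max1.
    apply: (@le_trans _ _ (Num.max 1 c1 * T%:R)); last by rewrite ler_peMl ?mulr_ge0// ltW.
    rewrite ler_pdivrMr ?(lt_le_trans ltr01)//.
    apply: (@le_trans _ _ (Num.max 1 c1 * T%:R)); last by rewrite ler_peMr ?mulr_ge0// ltW.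
    rewrite ler_pM// ?le_max ?lexx ?orbT// ler_nat.
    by apply: leq_trans tT; exact: leq_pred.
  rewrite lnM ?posrE ?mulr_gt0 ?expR_gt0// expRK lnM ?posrE//.
  have := ln_ge0 (max1 c1); have := log_ge1; have := lnT; nra.
have ldel := log_del'.
have m := ln_ge0 (max1 c1); have l1 := log_ge1.
set a := ln (Num.max 1 c1) in h1 m *.
have lB : 0 <= lam * B ^+ 2 by rewrite mulr_ge0 ?sqr_ge0 ?ltW.
have dl : 1 <= d%:R * l by rewrite -[leLHS]mulr1 ler_pM.
have kdl : 1 <= kap * (d%:R * l) by rewrite -[leLHS]mulr1 ler_pM.
have g1 : ln (1 / del' del) <= (1 + ln 5) * (d%:R * l).
  apply: le_trans ldel _; rewrite ler_wpM2l ?addr_ge0// ler_peMl// (le_trans ler01)//.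
have g2 : d%:R * ln (Num.max (expR 1) (c1 * t.-1%:R / d%:R)) <= (2 + a) * (d%:R * l).
  by rewrite [leRHS]mulrCA; apply: ler_wpM2l.
have g3 : ln (1 / del' del) + d%:R * ln (Num.max (expR 1) (c1 * t.-1%:R / d%:R)) <=
   (3 + ln 5 + a) * (d%:R * l) by move: g1 g2; lra.
have g4 := ler_wpM2l (le_trans ler01 kap1) g3.
have g5 : lam * B ^+ 2 <= lam * B ^+ 2 * (kap * (d%:R * l)) by rewrite ler_peMr.
apply: le_trans (lerD g4 g5) _.
by rewrite le_eqVlt; apply/orP; left; apply/eqP; ring.
Qed.

(** With [u = dT/delta], the width [sqrt (14 l)] turns the Gaussian tail into [u^-7]. The number of
    directions over all rounds is of order [(u delta)^2], which leaves [u^-5], and [u >= e >= 2]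
    makes [u^5] at least 32, enough for the share [delta / 5]. *)
Lemma failure_budget : T%:R * (2 * (d + T)%:R * expR (- (Num.sqrt (14 * l) ^+ 2 / 2))) <= del' del.
Proof.
have /andP[h0 h1] := del01; have l1 := log_ge1.
have l0 : 0 <= l by exact: le_trans l1.
rewrite sqr_sqrtr ?mulr_ge0//.
have -> : 14 * l / 2 = 7%:R * l by field.
rewrite expRN expRM_natl lnK ?posrE//.
set u := d%:R * T%:R / del.
have u2 : 2 <= u by apply: le_trans hl; have := expR_ge1Dx (1 : R); lra.
have dT : d%:R * T%:R = u * del by rewrite divfK ?gt_eqF.
have hT : T%:R <= u * del by rewrite -dT ler_peMl// (le_trans ler01 T1).
have hd : d%:R <= u * del by rewrite -dT ler_peMr// (le_trans ler01 d1).
rewrite natrD mulrA mulrA ler_pdivrMr ?exprn_gt0//.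
have ud0 : 0 <= u * del by rewrite -dT mulr_ge0.
apply: (@le_trans _ _ (u * del * 2 * (u * del + u * del))).
  by rewrite ler_pM ?mulr_ge0 ?addr_ge0// ?lerD// ler_wpM2r.
rewrite /del'.
have u5 : 2 ^+ 5 <= u ^+ 5 by rewrite lerXn2r ?nnegrE ?(le_trans _ u2).
have -> : u * del * 2 * (u * del + u * del) = del * (u ^+ 2 * (4 * del)) by ring.
have -> : del / 5 * u ^+ 7 = del * (u ^+ 2 * (u ^+ 5 / 5)) by field.
by rewrite ler_pM2l// ler_pM2l ?exprn_gt0//; move: u5; lra.
Qed.

Local Notation M := (B * X + 1).
Local Notation W := (Num.sqrt (14 * beta_const * potential_const)).
Local Notation Q := (Num.sqrt (kap * d%:R ^+ 3 * T%:R * l ^+ 3)).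

Lemma potential_bound :
  2 * (width_const * (d%:R * ln (1 + T%:R * (X ^+ 2 / lam)))) +
  2 * width_const * ln (1 / del' del) <= potential_const * (d%:R * l).
Proof.
have l1 := log_ge1; have w1 := width1; have lw := ln_ge0 width1.
have m0 : 0 <= X ^+ 2 / lam by rewrite divr_ge0 ?sqr_ge0 ?ltW.
have T0 : 0 < T%:R :> R by rewrite (lt_le_trans ltr01 T1).
have w0 : 0 < width_const by exact: lt_le_trans width1.
have h1 : ln (1 + T%:R * (X ^+ 2 / lam)) <= (1 + ln width_const) * l.
  apply: (@le_trans _ _ (ln (width_const * T%:R))).
    have Tm := mulr_ge0 (ltW T0) m0.
    rewrite ler_ln ?posrE ?mulr_gt0// ?ltr_wpDr//.
    by rewrite /width_const [leRHS]mulrDl mul1r [X in _ <= _ + X]mulrC lerD2r.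
  rewrite lnM ?posrE//; have := lnT; nra.
have dl : l <= d%:R * l by rewrite ler_peMl// (le_trans ler01).
have h2 : ln (1 / del' del) <= (1 + ln 5) * (d%:R * l).
  by apply: le_trans log_del' _; rewrite ler_wpM2l// addr_ge0.
have h3 : d%:R * ln (1 + T%:R * (X ^+ 2 / lam)) <= (1 + ln width_const) * (d%:R * l).
  by rewrite [leRHS]mulrCA; apply: ler_wpM2l.
have h4 := ler_wpM2l (ltW w0) (lerD h3 h2).
have -> : potential_const * (d%:R * l) =
  2 * (width_const * ((1 + ln width_const) * (d%:R * l) + (1 + ln 5) * (d%:R * l))).
  by rewrite /potential_const; ring.
have -> : 2 * (width_const * (d%:R * ln (1 + T%:R * (X ^+ 2 / lam)))) +
  2 * width_const * ln (1 / del' del) =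
  2 * (width_const * (d%:R * ln (1 + T%:R * (X ^+ 2 / lam)) + ln (1 / del' del))) by ring.
by rewrite ler_pM2l.
Qed.

Lemma rate_bound (r : R) :
  let lp := ln (1 / del' del) in
  let c := Num.sqrt (14 * l) * Num.sqrt d%:R in let eps := eps_T T in
  let bbar := Num.sqrt (beta_const * (kap * (d%:R * l))) in
  let Sb := Num.sqrt (T%:R * (2 * (width_const * (d%:R * ln (1 + T%:R * (X ^+ 2 / lam))))
                              + 2 * width_const * lp)) in
  r <= M * T%:R + M /\
  r <= normal_p0^-1 * (2 * (T%:R * (2 * eps) + 3 * c * bbar * Sb) + 2 * M * lp)
         + T%:R * eps + (c + 1) * bbar * Sb + M ->
  r <= regret_const * Q.
Proof.
move=> lp c eps bbar Sb [r1 r2].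
have l1 := log_ge1; have l0 : 0 <= l by exact: le_trans l1.
have T0 : 0 <= T%:R :> R by [].
have d0 : 0 <= d%:R :> R by [].
have k0 : 0 <= kap by exact: le_trans kap1.
have p0 := @normal_p0_gt0 R.
have d31 : 1 <= d%:R ^+ 3 :> R by rewrite exprn_ege1.
have l31 : 1 <= l ^+ 3 by rewrite exprn_ege1.
have kd1 : 1 <= kap * d%:R ^+ 3 by rewrite -[leLHS]mulr1 ler_pM.
have kdl1 : l <= kap * d%:R ^+ 3 * l ^+ 3.
  rewrite -[leLHS]mul1r ler_pM// exprS ler_peMr// exprn_ege1//.
have QE : Q = Num.sqrt (T%:R * (kap * d%:R ^+ 3 * l ^+ 3)) by congr Num.sqrt; ring.
have Q1 : Num.sqrt (T%:R * l) <= Q by rewrite QE ler_wsqrtr// ler_wpM2l.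
have QT : Num.sqrt T%:R <= Q.
  by apply: le_trans Q1; rewrite ler_wsqrtr// ler_peMr.
have Qge1 : 1 <= Q by apply: le_trans QT; rewrite -[leLHS]sqrtr1 ler_wsqrtr.
have Q0 : 0 <= Q by exact: sqrtr_ge0.
have W0 : 0 <= W by exact: sqrtr_ge0.
have MM := M_ge0.
set rest := normal_p0^-1 * (2 * (2 + 3 * W) + 2 * M * (1 + ln 5)) + 1 + 2 * W.
have rest0 : 0 <= rest.
  have h1 : 0 <= M * ln 5 by rewrite mulr_ge0.
  have : 0 <= normal_p0^-1 * (2 * (2 + 3 * W) + 2 * M * (1 + ln 5)).
    by rewrite mulr_ge0 ?invr_ge0 ?(ltW p0)//; lra.
  by rewrite /rest; lra.
have KE : regret_const = 2 * M + rest + M by rewrite /regret_const /rest; ring.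
(* The additive [M * log (1 / del)] is of the right order only when [l < T];
   otherwise the trivial bound [M * T] suffices. *)
have [Tl|lT] := leP T%:R l.
  apply: le_trans r1 _; rewrite KE.
  have TQ : T%:R <= Q.
    apply: le_trans Q1; rewrite -[leLHS](ger0_norm T0) -sqrtr_sqr ler_wsqrtr// expr2.
    by rewrite ler_wpM2l.
  have h1 : M * T%:R <= M * Q by rewrite ler_wpM2l.
  have h2 : M <= M * Q by rewrite ler_peMr.
  have h3 : 0 <= rest * Q by rewrite mulr_ge0.
  have h4 : 0 <= M * Q by rewrite mulr_ge0.
  have -> : (2 * M + rest + M) * Q = 2 * (M * Q) + rest * Q + M * Q by ring.
  lra.
have lQ : l <= Q.
  apply: le_trans Q1; rewrite -[leLHS](ger0_norm l0) -sqrtr_sqr ler_wsqrtr// expr2.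
  by rewrite ler_wpM2r// ltW.
have hlp : lp <= (1 + ln 5) * Q.
  by apply: le_trans log_del' _; rewrite ler_wpM2l// addr_ge0.
have heps : T%:R * eps <= Q.
  apply: le_trans QT; rewrite /eps /eps_T ler_pdivrMr ?sqrtr_gt0 ?(lt_le_trans ltr01)//.
  by rewrite -expr2 sqr_sqrtr.
have c1 : 1 <= c.
  rewrite -[leLHS]mulr1 ler_pM// -[leLHS]sqrtr1 ler_wsqrtr//; lra.
have bb0 : 0 <= bbar by exact: sqrtr_ge0.
have Sb0 : 0 <= Sb by exact: sqrtr_ge0.
have hW : c * bbar * Sb <= W * Q.
  have hSb : Sb <= Num.sqrt (T%:R * (potential_const * (d%:R * l))).
    by rewrite ler_wsqrtr// ler_wpM2l// potential_bound.
  apply: le_trans (ler_wpM2l _ hSb) _; first exact: mulr_ge0 (le_trans ler01 c1) bb0.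
  (* Each of the squared width, the squared radius and the potential brings one factor [d] and one
     factor [l], whence the cubes. *)
  have key (b p : R) : 0 <= b -> 0 <= p ->
      Num.sqrt (14 * l) * Num.sqrt d%:R * Num.sqrt (b * (kap * (d%:R * l))) *
      Num.sqrt (T%:R * (p * (d%:R * l))) = Num.sqrt (14 * b * p) * Q.
    move=> bp pp; rewrite -!sqrtrM ?mulr_ge0//.
    by congr Num.sqrt; ring.
  by rewrite /c /bbar key ?beta_const_ge0 ?potential_const_ge0.
have cb0 : 0 <= bbar * Sb by rewrite mulr_ge0.
have h1 : (c + 1) * bbar * Sb <= 2 * (W * Q).
  apply: (@le_trans _ _ (2 * (c * bbar * Sb))); last by rewrite ler_pM2l// hW.
  have : bbar * Sb <= c * (bbar * Sb) by rewrite ler_peMl.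
  lra.
have h2 : normal_p0^-1 * (2 * (T%:R * (2 * eps) + 3 * c * bbar * Sb) + 2 * M * lp) <=
   normal_p0^-1 * (2 * (2 + 3 * W) + 2 * M * (1 + ln 5)) * Q.
  rewrite -[leRHS]mulrA ler_wpM2l ?invr_ge0 ?(ltW p0)//.
  have hM : M * lp <= M * ((1 + ln 5) * Q) by rewrite ler_wpM2l.
  by move: hM heps hW; lra.
have h3 : M <= M * Q by rewrite ler_peMr.
have h4 : 0 <= M * Q by rewrite mulr_ge0.
apply: le_trans r2 _; rewrite KE /rest.
move: h2; set a := normal_p0^-1 * (2 * (2 + 3 * W) + _) => h2.
have -> : (2 * M + (a + 1 + 2 * W) + M) * Q = 2 * (M * Q) + a * Q + Q + 2 * (W * Q) + M * Q by ring.
lra.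
Qed.

End bounds.

End constants.

Theorem theorem1 :
  forall (R : realType) (B L gam lam C0 : R),
    0 < gam < 1 -> 0 < lam -> 1 <= C0 ->
  exists K : R, 0 <= K /\
  forall (dS dA dO : measure_display)
    (S : measurableType dS) (A : measurableType dA) (Om : measurableType dO)
    (d : nat) (nu0 : probability S R) (P : R.-pker (S * A)%type ~> S)
    (phi : S * A -> 'cV[R]_d) (thstar : 'cV[R]_d)
    (trajlaw : @policy R _ _ S A -> probability (traj S A) R)
    (T : nat) (del : R)
    (Pr : probability Om R) (Fpre Fth Fpol Ftraj : nat -> set (set Om))
    (pi0 : @policy R _ _ S A)
    (thtil thhat : nat -> Om -> 'cV[R]_d)
    (pol : nat -> Om -> @policy R _ _ S A)
    (tau tau' : nat -> Om -> traj S A)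
    (y : nat -> Om -> bool),
    (* the MDP and the features *)
    (forall i : 'I_d, measurable_fun [set: S * A] (fun sa => phi sa i 0)) ->
    (forall sa, norm2 (phi sa) <= L) ->
    norm2 thstar <= B ->
    (forall pi, is_traj_law nu0 P pi (trajlaw pi)) ->
    (* the absolute constant C0 in the confidence radius *)
    C0_valid thstar B L gam lam C0 ->
    (* inputs *)
    0 < del < 1 ->
    expR 1 <= d%:R * T%:R / del ->
    (* a run of RPO-Regret *)
    rpo_run trajlaw phi gam thstar B L lam C0 T del Pr Fpre Fth Fpol Ftraj
      pi0 thtil thhat pol tau tau' y ->
    whp Pr (1 - del) (fun w =>
      regret trajlaw phi gam thstar T pol w
        <= K * Num.sqrt (kappa d B L gam * d%:R ^+ 3 * T%:R
                         * ln (d%:R * T%:R / del) ^+ 3)).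
Proof.
move=> R B L gam lam C0 gam01 lam0 C01.
(* [K] is chosen before the features and the parameter. If [B] or [L] is negative, the norm bounds
   cannot hold and any [K] works. *)
have [/andP[B0 L0]|BL] := boolP ((0 <= B) && (0 <= L)); last first.
  exists 0; split => // dS dA dO S A Om d nu0 P phi thstar ? ? ? ? ? ? ? ? ? ? ? ? ? ? ? _ phiL starB.
  move: BL; rewrite (le_trans (norm2_ge0 _) starB).
  by rewrite (feature_bound_ge0 phiL).
exists (regret_const B L gam lam C0); split; first exact: regret_const_ge0.
move=> dS dA dO S A Om d nu0 P phi thstar trajlaw T del Pr Fpre Fth Fpol Ftraj pi0
  thtil thhat pol tau tau' y mphi phiL starB _ C0v del01 hl run.
apply: fails_atmost_whp.
have l1 := log_ge1 hl.
have q0 : 0 < Num.sqrt (14 * ln (d%:R * T%:R / del)).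
  by rewrite sqrtr_gt0 mulr_gt0// (lt_le_trans ltr01 l1).
have ev := regret_event gam01 lam0 C01 mphi phiL starB C0v del01 run (horizon_gt0 hl)
  (dim_gt0 hl) q0 (failure_budget del01 hl) (beta_bound gam01 lam0 C01 B0 L0 del01 hl).
apply: (fails_atmostW ev) => // w h.
exact: (rate_bound gam01 lam0 C01 B0 L0 del01 hl h).
Qed.
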